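(* Let $n\ge 2$ be an integer and let $s,p,r,\alpha,\gamma,\mu,\theta$ be real numbers such that $0<s<n$, $1<p\le r$, $\alpha<\frac{n}{p'}$, $-\gamma<\frac{n}{r}$, $\alpha-\frac{\gamma}{\theta}\ge 0$, $\mu>0$, $\max\left\{\frac{p}{r},\frac{\mu}{\mu+s}\right\}\le\theta\le 1$, and $$\gamma+\frac{n}{r}=\theta\Big(\alpha+\frac{n}{p}-s\Big)+(1-\theta)\mu .$$ Then there is a constant $C>0$, depending only on the parameters $n,s,p,r,\alpha,\gamma,\mu,\theta$, such that for every $f\in L^p(\mathbb{R}^n,|x|^{\alpha p})\cap\dot{B}^{-\mu-s}_{\infty,\infty}$ $$\big\||x|^\gamma(-\Delta)^{-s/2}f\big\|_{L^r}\le C\,\big\||x|^\alpha f\big\|_{L^p}^{\theta}\,\|f\|_{\dot{B}^{-\mu-s}_{\infty,\infty}}^{1-\theta},$$ or, equivalently, for every $u\in\dot{H}^{s,p}_\alpha(\mathbb{R}^n)\cap\dot{B}^{-\mu}_{\infty,\infty}$ $$\big\||x|^\gamma u\big\|_{L^r}\le C\,\big\||x|^\alpha(-\Delta)^{s/2}u\big\|_{L^p}^{\theta}\,\|u\|_{\dot{B}^{-\mu}_{\infty,\infty}}^{1-\theta}.$$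
   Context: Here $\frac1p+\frac1{p'}=1$, all $L^q$ norms are over $\mathbb{R}^n$ with Lebesgue measure, and $L^p(\mathbb{R}^n,|x|^{\alpha p})$ is the space of measurable $f$ with $\||x|^\alpha f\|_{L^p}<\infty$. The heat semigroup is $e^{t\Delta}f=f*h_t$, with $h_t(x)=(4\pi t)^{-n/2}\exp(-|x|^2/(4t))$, $t>0$. For $0<s<n$, the negative power of the Laplacian is the Riesz potential $$(-\Delta)^{-s/2}f(x)=I_s f(x)=c(n,s)\int_{\mathbb{R}^n}\frac{f(y)}{|x-y|^{n-s}}\,dy,$$ with the standard normalizing constant $c(n,s)>0$; it is represented through the heat semigroup as $$(-\Delta)^{-s/2}f=\frac{1}{\Gamma(s/2)}\int_0^\infty t^{s/2-1}e^{t\Delta}f\,dt ,$$ and this representation is the one to be used as the meaning of $(-\Delta)^{-s/2}f$ should the first integral not converge absolutely. For $\delta>0$, the homogeneous Besov space $\dot{B}^{-\delta}_{\infty,\infty}$ is the space of tempered distributions $v$ on $\mathbb{R}^n$ (possibly modulo polynomials) for which $$\|v\|_{\dot{B}^{-\delta}_{\infty,\infty}}:=\sup_{t>0}t^{\delta/2}\|e^{t\Delta}v\|_{L^\infty}<\infty .$$ The weighted homogeneous Sobolev space of potential type is $\dot{H}^{s,p}_\alpha(\mathbb{R}^n)=\{u=(-\Delta)^{-s/2}f:\ f\in L^p(\mathbb{R}^n,|x|^{\alpha p})\}$ with norm $\|u\|_{\dot{H}^{s,p}_\alpha}=\||x|^\alpha f\|_{L^p}$; for $u=(-\Delta)^{-s/2}f$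 in this space one writes $(-\Delta)^{s/2}u=f$. *)

(* Defs.v *)
From HB Require Import structures.
From mathcomp Require Import all_boot all_order all_algebra.
From mathcomp Require Import all_classical all_reals all_analysis.

Set Implicit Arguments.
Unset Strict Implicit.
Unset Printing Implicit Defensive.

Import Order.TTheory GRing.Theory Num.Theory.
Import numFieldNormedType.Exports.

Local Open Scope classical_set_scope.
Local Open Scope ring_scope.

(* R^n is 'rV[R]_n with the sigma-algebra generated by the coordinates, which
   is its Borel sigma-algebra. *)
Section measurable_rV.
Context {R : realType} (n : nat).

Definition rV_coord (i : 'I_n) (x : 'rV[R]_n) : measurableTypeR R := x ord0 i.

Let rV_set0 : g_sigma_preimage rV_coord set0.
Proof. exact: sigma_algebra0. Qed.

Let rV_setC A : g_sigma_preimage rV_coord A -> g_sigma_preimage rV_coord (~` A).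
Proof. exact: sigma_algebraC. Qed.

Let rV_bigcup (F : _^nat) : (forall i, g_sigma_preimage rV_coord (F i)) ->
  g_sigma_preimage rV_coord (\bigcup_i (F i)).
Proof. exact: sigma_algebra_bigcup. Qed.

HB.instance Definition _ := @isMeasurable.Build default_measure_display
  'rV[R]_n (g_sigma_preimage rV_coord) rV_set0 rV_setC rV_bigcup.

Lemma measurable_rV_coord i : measurable_fun [set: 'rV[R]_n] (rV_coord i).
Proof.
move=> _ Y mY; rewrite setTI; apply: sub_sigma_algebra => /=.
rewrite -bigcup_seq/=; exists i => /=; first by rewrite mem_index_enum.
by exists Y => //; rewrite setTI.
Qed.

Lemma measurable_fun_rVP d (T : measurableType d) (f : T -> 'rV[R]_n) :
  measurable_fun setT f <->
  forall i, measurable_fun setT (rV_coord i \o f).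
Proof.
split=> [mf i|mf].
  by apply: measurableT_comp => //; exact: measurable_rV_coord.
suff : g_sigma_preimage rV_coord `<=` [set A | measurable (f @^-1` A)].
  by move=> H _ A /H; rewrite setTI.
apply: smallest_sub.
  split; first by rewrite /= preimage_set0.
    by move=> A /= mA; rewrite setTD -preimage_setC; exact: measurableC.
  by move=> F /= mF; rewrite preimage_bigcup; exact: bigcup_measurable.
rewrite -bigcup_seq => A [i _ [B mB <-]] /=.
by rewrite setTI -comp_preimage -[X in measurable X]setTI; exact: mf.
Qed.

Lemma measurable_rV_box (A : 'I_n -> set (measurableTypeR R)) :
  (forall i, measurable (A i)) ->
  measurable [set x : 'rV[R]_n | forall i, A i (x ord0 i)].
Proof.
move=> mA; have -> : [set x : 'rV[R]_n | forall i, A i (x ord0 i)] =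
    \bigcap_(i in [set: 'I_n]) (rV_coord i @^-1` A i).
  by apply/seteqP; split => x /= h i => [_|]; exact: h.
apply: fin_bigcap_measurable => // i _.
by rewrite -[X in measurable X]setTI; exact: measurable_rV_coord.
Qed.

End measurable_rV.

Section lebesgue_measure_rV.
Context {R : realType}.

Section cons.
Variable n : nat.

Definition rV_cons (z : measurableTypeR R * 'rV[R]_n) : 'rV[R]_n.+1 :=
  \row_i if unlift ord0 i is Some j then z.2 ord0 j else z.1.

Definition rV_uncons (v : 'rV[R]_n.+1) : measurableTypeR R * 'rV[R]_n :=
  (v ord0 ord0, \row_j v ord0 (lift ord0 j)).

Lemma rV_consE0 z : rV_cons z ord0 ord0 = z.1.
Proof. by rewrite mxE unlift_none. Qed.

Lemma rV_consES z j : rV_cons z ord0 (lift ord0 j) = z.2 ord0 j.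
Proof. by rewrite mxE liftK. Qed.

Lemma rV_consK : cancel rV_cons rV_uncons.
Proof.
move=> [x v]; rewrite /rV_uncons rV_consE0; congr pair.
by apply/rowP => j; rewrite mxE rV_consES.
Qed.

Lemma measurable_rV_cons : measurable_fun setT rV_cons.
Proof.
apply/measurable_fun_rVP => i.
case: (unliftP ord0 i) => [j ->|->].
- rewrite (_ : _ \o _ = rV_coord j \o snd); last first.
    by apply/funext => z; rewrite /= /rV_coord rV_consES.
  by apply: measurableT_comp => //; exact: measurable_rV_coord.
- rewrite (_ : _ \o _ = fst)//.
  by apply/funext => z; rewrite /= /rV_coord rV_consE0.
Qed.

Lemma measurable_rV_uncons : measurable_fun setT rV_uncons.
Proof.
apply/measurable_fun_pairP; split; first exact: (measurable_rV_coord ord0).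
apply/measurable_fun_rVP => i.
rewrite (_ : _ \o _ = rV_coord (lift ord0 i)); first exact: measurable_rV_coord.
by apply/funext => v; rewrite /= /rV_coord mxE.
Qed.

Variable m : {sigma_finite_measure set 'rV[R]_n -> \bar R}.

Definition cons_measure : set 'rV[R]_n.+1 -> \bar R :=
  pushforward (@lebesgue_measure R \x m)%E rV_cons.

Let cons_measure0 : cons_measure set0 = 0%E.
Proof. by rewrite /cons_measure /pushforward preimage_set0 measure0. Qed.

Let cons_measure_ge0 A : (0 <= cons_measure A)%E.
Proof. by rewrite /cons_measure /pushforward measure_ge0. Qed.

Let cons_measure_sigma_additive : semi_sigma_additive cons_measure.
Proof.
move=> F mF tF mUF; rewrite /cons_measure /pushforward preimage_bigcup.
apply: measure_semi_sigma_additive.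
- by move=> k; rewrite -[X in measurable X]setTI; exact: measurable_rV_cons.
- apply/trivIsetP => /= i j _ _ ij; rewrite -preimage_setI.
  by move/trivIsetP : tF => /(_ _ _ _ _ ij) ->//; rewrite preimage_set0.
- rewrite -preimage_bigcup -[X in measurable X]setTI.
  exact: measurable_rV_cons.
Qed.

HB.instance Definition _ := isMeasure.Build _ _ _ cons_measure
  cons_measure0 cons_measure_ge0 cons_measure_sigma_additive.

Let cons_measure_sigma_finite : sigma_finite setT cons_measure.
Proof.
have /sigma_finiteP[F [TF ndF Foo]] := sigma_finiteT (@lebesgue_measure R).
have /sigma_finiteP[G [TG ndG Goo]] := sigma_finiteT m.
exists (fun k => rV_uncons @^-1` (F k `*` G k)).
  rewrite -preimage_bigcup -[LHS](preimage_setT rV_uncons); congr (_ @^-1` _).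
  apply/seteqP; split => // -[x y] _.
  have [i _ Fx] : (\bigcup_i F i) x by rewrite -TF.
  have [j _ Gy] : (\bigcup_i G i) y by rewrite -TG.
  exists (maxn i j) => //; split => /=.
    exact: (subsetPset _ _ (ndF _ _ (leq_maxl i j))).
  exact: (subsetPset _ _ (ndG _ _ (leq_maxr i j))).
move=> k; have [? ?] := Foo k; have [? ?] := Goo k; split.
  rewrite -[X in measurable X]setTI; apply: measurable_rV_uncons => //.
  exact: measurableX.
rewrite /cons_measure /pushforward -comp_preimage.
rewrite (_ : rV_uncons \o rV_cons = id) ?preimage_id; last first.
  by apply/funext => z; exact: rV_consK.
by rewrite product_measure1E// lte_mul_pinfty// ge0_fin_numE.
Qed.

HB.instance Definition _ := Measure_isSigmaFinite.Build _ _ _ cons_measure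
  cons_measure_sigma_finite.

End cons.

Fixpoint lebesgue_rV n : {sigma_finite_measure set 'rV[R]_n -> \bar R} :=
  if n is k.+1 then cons_measure (lebesgue_rV k) else \d_(0 : 'rV[R]_0).

Lemma lebesgue_rV_box n (A : 'I_n -> set (measurableTypeR R)) :
  (forall i, measurable (A i)) ->
  lebesgue_rV n [set x | forall i, A i (x ord0 i)] =
  (\prod_(i < n) lebesgue_measure (A i))%E.
Proof.
elim: n A => [|n IH] A mA /=.
  by rewrite big_ord0 diracE mem_set// => -[].
rewrite big_ord_recl -IH// -product_measure1E//; last first.
  by apply: (measurable_rV_box (A := fun i => A (lift ord0 i))).
rewrite /cons_measure /pushforward; congr product_measure1.
apply/seteqP; split => [z /= h|z /= [h0 hS] i].
  split; first by have := h ord0; rewrite rV_consE0.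
  by move=> i; have := h (lift ord0 i); rewrite rV_consES.
case: (unliftP ord0 i) => [j ->|->]; first by rewrite rV_consES; exact: hS.
by rewrite rV_consE0.
Qed.

End lebesgue_measure_rV.

Section function_spaces.
Context {R : realType} {n : nat}.
Local Notation mu := (lebesgue_rV n).
Implicit Types (x y : 'rV[R]_n) (f u phi psi : 'rV[R]_n -> R)
  (T : ('rV[R]_n -> R) -> R).

(* The library norm `|x| on 'rV[R]_n is the sup norm, not this one. *)
Definition enorm x : R := Num.sqrt (\sum_(i < n) x ord0 i ^+ 2).

(* ||  |x|^a g  ||_{L^q}, for possibly infinite-valued g *)
Definition weighted_norm (a q : R) (g : 'rV[R]_n -> \bar R) : \bar R :=
  Lnorm mu q%:E (fun x => (enorm x `^ a)%:E * g x)%E.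

(* f belongs to L^q(R^n, |x|^(a q)) *)
Definition weighted_Lp (a q : R) f : Prop :=
  measurable_fun setT f /\ (weighted_norm a q (EFin \o f) < +oo)%E.

Definition partial (i : 'I_n) phi : 'rV[R]_n -> R :=
  fun x => 'D_(delta_mx ord0 i) phi x.

Definition partials (l : seq 'I_n) phi : 'rV[R]_n -> R := foldr partial phi l.

Definition schwartz phi : Prop :=
  (forall l x, differentiable (partials l phi) x) /\
  (forall (k : nat) l, exists M : R,
     forall x, enorm x ^+ k * `|partials l phi x| <= M).

(* Functionals are total on ('rV[R]_n -> R); only their values on Schwartz
   functions matter. *)
Definition tempered_distribution T : Prop :=
  (forall (a : R) phi psi, schwartz phi -> schwartz psi ->
     T (fun x => a * phi x + psi x) = a * T phi + T psi) /\
  (exists (N : nat) (C : R), forall phi (M : R), schwartz phi ->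
     (forall (k : nat) (l : seq 'I_n) x, (k <= N)%N -> (size l <= N)%N ->
        enorm x ^+ k * `|partials l phi x| <= M) ->
     `|T phi| <= C * M).

Definition heat_kernel (t : R) x : R :=
  (4 * pi * t) `^ (- (n%:R / 2)) * expR (- (enorm x ^+ 2 / (4 * t))).

(* e^(t Delta) T = T * h_t *)
Definition heat T (t : R) : 'rV[R]_n -> R :=
  fun x => T (fun y => heat_kernel t (x - y)).

Definition besov_norm (delta : R) T : \bar R :=
  ereal_sup [set ((t `^ (delta / 2))%:E * Lnorm mu +oo%E (EFin \o heat T t))%E
            | t in [set t : R | 0 < t]].

Definition besov (delta : R) T : Prop :=
  tempered_distribution T /\ (besov_norm delta T < +oo)%E.

Definition distribution_of f : ('rV[R]_n -> R) -> R :=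
  fun phi => (\int[mu]_y (f y * phi y))%R.

Lemma heat_distribution_of f t x :
  heat (distribution_of f) t x =
  (\int[mu]_y (f y * heat_kernel t (x - y)))%R.
Proof. by []. Qed.

(* The integrability clause is what makes distribution_of f meaningful: the
   real-valued integral of a non-integrable function is a junk value. *)
Definition in_besov (delta : R) f : Prop :=
  (forall phi, schwartz phi ->
     mu.-integrable setT (fun y => (f y * phi y)%:E)) /\
  besov delta (distribution_of f).

Definition Gamma (z : R) : R :=
  (\int[lebesgue_measure]_(t in `]0%R, +oo[) (t `^ (z - 1) * expR (- t)))%R.

Definition riesz_const (s : R) : R :=
  Gamma ((n%:R - s) / 2) / (2 `^ s * pi `^ (n%:R / 2) * Gamma (s / 2)).

Definition riesz_integrand (s : R) f x y : R :=
  f y / enorm (x - y) `^ (n%:R - s).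

(* (-Delta)^(-s/2) f x: the Riesz potential where it converges absolutely, the
   heat representation elsewhere. The value is infinite when the integral used
   does not converge absolutely, since the library then makes it +oo or -oo. *)
Definition neg_laplacian_pow (s : R) f x : \bar R :=
  if `[< mu.-integrable setT (fun y => (riesz_integrand s f x y)%:E) >]
  then ((riesz_const s)%:E * \int[mu]_y (riesz_integrand s f x y)%:E)%E
  else ((Gamma (s / 2))^-1%:E *
        \int[lebesgue_measure]_(t in `]0%R, +oo[)
           (t `^ (s / 2 - 1) * heat (distribution_of f) t x)%:E)%E.

(* u belongs to the weighted Sobolev space of order s and
   (-Delta)^(s/2) u = f. The equation forces absolute convergence a.e., as u is
   finite-valued. *)
Definition potential_of (s p a : R) u f : Prop :=
  [/\ weighted_Lp a p f, measurable_fun setT u &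
      {ae mu, forall x, (u x)%:E = neg_laplacian_pow s f x}].

End function_spaces.

(* Main.v *)
Require Import Defs.
From HB Require Import structures.
From mathcomp Require Import all_boot all_order all_algebra.
From mathcomp Require Import all_classical all_reals all_analysis.
From mathcomp Require Import measurable_realfun ess_sup_inf.
From mathcomp Require Import ring lra.

(* With sigma = s + mu - mu / theta, which lies in [0, s], the function f has a
   fractional maximal majorant N, in the sense that the integral of |f| over the
   cube of centre x and radius rho is at most N(x) rho^(n - sigma), and the weighted
   L^(theta r) norm of N is controlled by the weighted L^p norm of f; this comes
   from the Hardy-Littlewood maximal theorem for scales below |x| / 2 and from a
   sum over dyadic scales for the others. Integrating against Gaussians gives
   |e^(t Delta) f (x)| <= C N(x) t^(- sigma / 2), hence, for theta < 1, the part
   t <= T of the integral defining the potential is O(N(x) T^((s - sigma) / 2)),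
   while the Besov norm bounds the part t > T by O(B T^(- mu / 2)); optimising over T
   gives |(-Delta)^(-s/2) f| <= C N^theta B^(1 - theta) pointwise.
   When only u is in the Besov space, u(x) is compared with the averages of
   u(x + j z), 1 <= j <= m, against a Gaussian in z at scale T, which are
   e^(j^2 T Delta) u (x): the remaining m-th difference gains (T / t)^(m / 2) for
   t > T. For theta = 1 the potential is bounded by the geometric mean of the
   majorants of regularities s - ep and s + ep, and Hoelder's inequality concludes. *)

Set Implicit Arguments.
Unset Strict Implicit.
Unset Printing Implicit Defensive.

Import Order.TTheory GRing.Theory Num.Theory.
Import numFieldNormedType.Exports.

Local Open Scope classical_set_scope.
Local Open Scope ring_scope.

(** * Integrals and measurability on R^n *)

(** The hypotheses linking the exponents are conditions on sigma. Dividing the scaling identity by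
    theta gives gamma/theta + n/(theta r) = alpha + n/p - sigma, the scaling of an estimate for N in
    L^(theta r) with weight exponent gamma/theta. Such an estimate asks for gamma/theta <= alpha and
    p <= theta r, and for alpha < n/p', which makes f integrable near the origin; theta >= mu/(mu +
    s) says sigma >= 0. This sigma is the one value for which the optimisation over T returns the
    exponents theta and 1 - theta. For theta = 1 it equals s and the integral of t^(-1) over small
    times diverges: hence the two regularities s - ep and s + ep. The two forms of the inequality
    are proved separately. The definition gives u from f and not f from u, so a bound on the heat
    flow of u is not turned into one on that of f; finite differences of u avoid this, being
    computable both from f and, after averaging, from the heat flow of u at finitely many times. *)

Section integral_prelim.
Context d (T : measurableType d) {R : realType} (mu : {measure set T -> \bar R}).
Local Open Scope ereal_scope.
Import HBNNSimple.

(** The integral of a nonnegative function is a supremum over the simple functions below it, and a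
    larger function admits more of them. This serves integrands whose measurability would be tedious
    to establish. *)
Lemma ge0_le_integral_nm (D : set T) (f g : T -> \bar R) :
  (forall x, D x -> 0 <= f x) -> (forall x, D x -> f x <= g x) ->
  \int[mu]_(x in D) f x <= \int[mu]_(x in D) g x.
Proof.
move=> f0 fg; have g0 x : D x -> 0 <= g x.
  by move=> Dx; rewrite (le_trans (f0 _ Dx)) ?fg.
rewrite !ge0_integralE//; apply: ereal_sup_le => _ [h hf <-].
by exists h => // x; rewrite (le_trans (hf x))//; exact: lee_restrict.
Qed.

Lemma ge0_ae_le_integral_nm (f g : T -> \bar R) :
  (forall x, 0 <= f x) -> (forall x, 0 <= g x) -> measurable_fun [set: T] g ->
  {ae mu, forall x, f x <= g x} ->
  \int[mu]_x f x <= \int[mu]_x g x.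
Proof.
move=> f0 g0 mg [N [mN N0 fgN]].
(* Raising g to +oo on the null set N makes the bound pointwise and does not change the integral. *)
pose k x := if x \in N then +oo else g x.
have mk : measurable_fun setT k.
  apply: measurable_fun_ifT => //.
  by apply: (@measurable_fun_bool _ _ _ _ true); rewrite setTI preimage_mem_true.
rewrite (@le_trans _ _ (\int[mu]_x k x))//.
  apply: ge0_le_integral_nm => // x _; rewrite /k.
  have [xN|xN] := boolP (x \in N); first by rewrite leey.
  apply: contrapT => fgx; move/negP: xN; apply.
  by rewrite inE; apply: fgN => /=.
rewrite le_eqVlt; apply/orP; left; apply/eqP; apply: ge0_ae_eq_integral => //.
  by move=> x _; rewrite /k; case: ifP => // _; exact: leey.
exists N; split => //= x /= kg; apply: contrapT => xN; apply: kg => _.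
by rewrite /k memNset.
Qed.

Lemma integral_scale (k : R) (f : T -> \bar R) : (0 <= k)%R ->
  measurable_fun [set: T] f -> (forall x, 0 <= f x) ->
  \int[mu]_x (k%:E * f x) = k%:E * \int[mu]_x f x.
Proof. by move=> k0 mf f0; rewrite ge0_integralZl. Qed.

End integral_prelim.

Section rV_measurability.
Context {R : realType} (n : nat).
Local Notation V := 'rV[R]_n.

Lemma measurable_rV_norm : measurable_fun setT (fun x : V => `|x| : R).
Proof.
rewrite (_ : (fun _ => _) =
    fun x : V => \big[Num.max/0%R]_(ij : 'I_1 * 'I_n) `|x ij.1 ij.2|); last first.
  by apply/funext => x; rewrite -mx_normrE.
rewrite (_ : (fun _ => _) = fun x : V =>
  \big[Num.max/0%R]_(ij <- index_enum ('I_1 * 'I_n)%type) `|x ij.1 ij.2|) //.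
elim: (index_enum _) => [|ij l IH].
  rewrite (_ : (fun _ => _) = cst 0)//.
  by apply/funext => x; rewrite big_nil.
rewrite (_ : (fun _ => _) = (fun x : V => `|x ij.1 ij.2|) \max
    (fun x : V => \big[Num.max/0%R]_(ij <- l) `|x ij.1 ij.2|)); last first.
  by apply/funext => x; rewrite big_cons.
apply: measurable_maxr => //; rewrite (ord1 ij.1).
by apply: measurableT_comp => //; exact: (measurable_rV_coord ij.2).
Qed.

Lemma measurable_enorm : measurable_fun setT (@enorm R n).
Proof.
rewrite /enorm (_ : (fun _ => _) = (@powR R ^~ 2^-1) \o
    fun x : V => \sum_(i < n) x ord0 i ^+ 2); last first.
  apply/funext => x /=; rewrite powR12_sqrt//.
  by apply: sumr_ge0 => i _; exact: sqr_ge0.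
apply: measurableT_comp; first exact: measurable_powR.
apply: measurable_sum => i; apply: measurable_funX.
exact: (measurable_rV_coord i).
Qed.

Lemma measurable_rVD d (T : measurableType d) (f g : T -> V) :
  measurable_fun setT f -> measurable_fun setT g ->
  measurable_fun setT (fun t => f t + g t).
Proof.
move=> /measurable_fun_rVP mf /measurable_fun_rVP mg.
apply/measurable_fun_rVP => i.
rewrite (_ : _ \o _ = (rV_coord i \o f) \+ (rV_coord i \o g)); last first.
  by apply/funext => t; rewrite /= /rV_coord mxE.
exact: measurable_funD (mf i) (mg i).
Qed.

Lemma measurable_rVZ d (T : measurableType d) (c : T -> R) (f : T -> V) :
  measurable_fun setT c -> measurable_fun setT f ->
  measurable_fun setT (fun t => c t *: f t).
Proof.
move=> mc /measurable_fun_rVP mf.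
apply/measurable_fun_rVP => i.
rewrite (_ : _ \o _ = c \* (rV_coord i \o f)); last first.
  by apply/funext => t; rewrite /= /rV_coord mxE.
exact: measurable_funM mc (mf i).
Qed.

Lemma measurable_rVN d (T : measurableType d) (f : T -> V) :
  measurable_fun setT f -> measurable_fun setT (fun t => - f t).
Proof.
move=> mf; under eq_fun do rewrite -scaleN1r.
exact: measurable_rVZ.
Qed.

Lemma measurable_rVB d (T : measurableType d) (f g : T -> V) :
  measurable_fun setT f -> measurable_fun setT g ->
  measurable_fun setT (fun t => f t - g t).
Proof. by move=> mf mg; apply: measurable_rVD => //; exact: measurable_rVN. Qed.

Lemma rV_norm_le (x : V) (r : R) : 0 <= r ->
  (`|x| <= r) <-> (forall i, `|x ord0 i| <= r).
Proof.
move=> r0; rewrite [X in X <= _](mx_normrE x); split => [/bigmax_leP[_ h] i|h].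
  by have := h (ord0, i) isT.
by apply/bigmax_leP; split => // -[i j] _ /=; rewrite (ord1 i).
Qed.

Lemma rV_norm_coord (x : V) i : `|x ord0 i| <= `|x|.
Proof. by have /(rV_norm_le x (normr_ge0 x)) := lexx `|x|; apply. Qed.

(** Closed balls of the sup norm, hence cubes of side 2 r. Their measure is an explicit product, and
    the passage to the Euclidean norm costs only constants depending on n. *)
Definition cube (x : V) (r : R) : set V := [set y | `|x - y| <= r].

Lemma measurable_cube x r : measurable (cube x r).
Proof.
have : measurable_fun setT (fun y : V => `|x - y| : R).
  apply: (measurableT_comp measurable_rV_norm).
  by apply: measurable_rVB.
move=> /(_ measurableT `]-oo, r]%classic (measurable_itv _)).
by rewrite setTI (_ : _ @^-1` _ = cube x r).
Qed.

Lemma lebesgue_cube x r : 0 <= r ->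
  lebesgue_rV n (cube x r) = ((2 * r) ^+ n)%:E.
Proof.
move=> r0.
rewrite (_ : cube x r = [set y : V | forall i,
   `[x ord0 i - r, x ord0 i + r]%classic (y ord0 i)]); last first.
  apply/seteqP; split => y; rewrite /cube /=.
    move=> /(rV_norm_le _ r0) h i; have := h i.
    by rewrite !mxE in_itv/= ler_norml => /andP[a b]; apply/andP; split; lra.
  move=> h; apply/(rV_norm_le _ r0) => i; have := h i.
  by rewrite !mxE in_itv/= ler_norml => /andP[a b]; apply/andP; split; lra.
rewrite (lebesgue_rV_box (A := fun i => `[x ord0 i - r, x ord0 i + r]%classic))//.
rewrite (eq_bigr (fun=> (2 * r)%:E)); last first.
  move=> i _; rewrite lebesgue_measure_itv/= lte_fin.
  case: ifPn => [_|h]; first by rewrite -EFinB; congr EFin; lra.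
  by congr EFin; lra.
by rewrite prodEFin prodr_const card_ord.
Qed.

Lemma cube_sub x y r s : `|x - y| + r <= s -> cube y r `<=` cube x s.
Proof.
move=> h z; rewrite /cube/= => zr.
rewrite (le_trans _ h)// -(subrKA y x) (le_trans (ler_normD _ _))//.
by rewrite lerD2l.
Qed.

End rV_measurability.

Lemma integral_rV_cons {R : realType} n (f : 'rV[R]_n.+1 -> \bar R) :
  measurable_fun setT f -> (forall x, 0 <= f x)%E ->
  (\int[lebesgue_rV n.+1]_x f x =
   \int[@lebesgue_measure R]_t \int[lebesgue_rV n]_v f (rV_cons (t, v)))%E.
Proof.
move=> mf f0 /=.
rewrite (ge0_integral_pushforward (@measurable_rV_cons R n) (@lebesgue_measure R \x lebesgue_rV n)%E)//=; last first.
rewrite fubini_tonelli1//.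
by apply: measurableT_comp => //; exact: measurable_rV_cons.
Qed.

Section tonelli.
Context d1 d2 (T1 : measurableType d1) (T2 : measurableType d2) {R : realType}.
Variables (m1 : {sigma_finite_measure set T1 -> \bar R})
  (m2 : {sigma_finite_measure set T2 -> \bar R}).
Local Open Scope ereal_scope.

Lemma tonelli_measurable (f : T1 -> T2 -> \bar R) :
  measurable_fun [set: T1 * T2] (fun z => f z.1 z.2) -> (forall x y, 0 <= f x y) ->
  measurable_fun [set: T1] (fun x => \int[m2]_y f x y).
Proof.
move=> mf f0.
exact: (@measurable_fun_fubini_tonelli_F _ _ _ _ _ m2 (fun z => f z.1 z.2)).
Qed.

Lemma tonelli_swap (f : T1 -> T2 -> \bar R) :
  measurable_fun [set: T1 * T2] (fun z => f z.1 z.2) -> (forall x y, 0 <= f x y) ->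
  \int[m1]_x \int[m2]_y f x y = \int[m2]_y \int[m1]_x f x y.
Proof.
move=> mf f0.
exact: (@fubini_tonelli _ _ _ _ _ m1 m2 (fun z => f z.1 z.2)).
Qed.

End tonelli.

Section affine.
Context {R : realType}.
Local Notation leb := (@lebesgue_measure R).

Let aff (a c : R) (t : measurableTypeR R) : measurableTypeR R := a + c * t.

Let measurable_aff a c : measurable_fun setT (aff a c).
Proof. by apply: measurable_funD => //; exact: mulrl_measurable. Qed.

(** By uniqueness of Lebesgue measure: c times the pushforward gives every half-open interval its
    length. *)
Lemma lebesgue_measure_affine (a c : R) (A : set (measurableTypeR R)) : 0 < c ->
  measurable A -> leb (aff a c @^-1` A) = (c^-1%:E * leb A)%E.
Proof.
move=> c0 mA.
pose m := mscale (NngNum (ltW c0)) (pushforward leb (aff a c)).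
have : leb A = m (measurable_aff a c) A.
  apply: lebesgue_measure_unique => //.
  move=> _ [[x y] /= xy <-].
  rewrite /m /mscale/= /pushforward.
  have -> : aff a c @^-1` `]x, y] = `](x - a) / c, (y - a) / c]%classic.
    apply/seteqP; split => t; rewrite /= !in_itv/= /aff => /andP[h1 h2]; apply/andP.
      by rewrite ltr_pdivrMr// ler_pdivlMr//; split; lra.
    by move: h1 h2; rewrite ltr_pdivrMr// ler_pdivlMr//; split; lra.
  rewrite !lebesgue_measure_itv/= !lte_fin ltr_pM2r ?invr_gt0// ltrD2r.
  case: ifPn => _; last by rewrite mule0.
  rewrite -!EFinB -EFinM; congr EFin; field; lra.
move=> ->; rewrite /m /mscale/= /pushforward muleA -EFinM mulVf ?gt_eqF//.
by rewrite mul1e.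
Qed.

Lemma integral_affine (a c : R) (f : measurableTypeR R -> \bar R) : 0 < c ->
  measurable_fun [set: measurableTypeR R] f -> (forall t, 0 <= f t)%E ->
  (\int[leb]_t f (a + c * t)%R = c^-1%:E * \int[leb]_t f t)%E.
Proof.
move=> c0 mf f0.
have := ge0_integral_pushforward (measurable_aff a c) leb measurableT mf (fun y _ => f0 y).
rewrite preimage_setT => <-.
have ci : 0 <= c^-1 by rewrite invr_ge0 ltW.
transitivity (\int[mscale (NngNum ci) leb]_t f t)%E.
  apply: eq_measure_integral => A mA _.
  by rewrite /mscale/= /pushforward lebesgue_measure_affine.
by rewrite ge0_integral_mscale.
Qed.

Lemma integral_rV_affine n (a : 'rV[R]_n) (c : R) (f : 'rV[R]_n -> \bar R) :
  0 < c -> measurable_fun [set: 'rV[R]_n] f -> (forall t, 0 <= f t)%E ->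
  (\int[lebesgue_rV n]_z f (a + c *: z)%R =
   (c ^- n)%:E * \int[lebesgue_rV n]_z f z)%E.
Proof.
move=> c0; elim: n a f => [|n IH] a f mf f0.
  rewrite /= expr0 invr1 mul1e; apply: eq_integral => z _.
  by congr f; apply/rowP => -[].
have mfc : measurable_fun [set: measurableTypeR R * 'rV[R]_n] (f \o @rV_cons R n).
  by apply: measurableT_comp => //; exact: measurable_rV_cons.
have maff : measurable_fun [set: 'rV[R]_n.+1] (fun z => a + c *: z).
  by apply: measurable_rVD => //; exact: measurable_rVZ.
rewrite !integral_rV_cons//; last exact: measurableT_comp mf maff.
(* The affine map acts on the head coordinate and on the tail separately, so scaling on the line
   combines with the induction hypothesis for the tail b of a. *)
pose b : 'rV[R]_n := \row_j a ord0 (lift ord0 j).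
have E t v : a + c *: rV_cons (t, v) = rV_cons (a ord0 ord0 + c * t, b + c *: v).
  apply/rowP => i; rewrite !mxE; case: (unliftP ord0 i) => [j ->|->].
    by rewrite /= !mxE.
  by [].
under eq_integral => t _ do under eq_integral => v _ do rewrite E.
under eq_integral => t _.
  rewrite (IH b (fun v => f (rV_cons (a ord0 ord0 + c * t, v))))//; last first.
    apply: (measurableT_comp mf); apply: (measurableT_comp (@measurable_rV_cons R n)).
    exact: measurable_fun_pair.
  over.
have mF : measurable_fun [set: measurableTypeR R]
    (fun t => \int[lebesgue_rV n]_v f (rV_cons (t, v)))%E.
  apply: (tonelli_measurable _ (f := fun t v => f (rV_cons (t, v)))) => //.
rewrite integral_scale; last 3 first.
- by rewrite invr_ge0 exprn_ge0// ltW.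
- exact: (measurableT_comp mF (measurable_aff (a ord0 ord0) c)).
- by move=> t; exact: integral_ge0.
rewrite (integral_affine (a ord0 ord0)
  (f := fun t => (\int[lebesgue_rV n]_v f (rV_cons (t, v)))%E) c0 mF).
  by rewrite muleA -EFinM -invfM exprSr.
by move=> t; exact: integral_ge0.
Qed.

Lemma ae_rV_affine n (a : 'rV[R]_n) (c : R) (P : 'rV[R]_n -> Prop) : 0 < c ->
  {ae lebesgue_rV n, forall x, P x} -> {ae lebesgue_rV n, forall z, P (a + c *: z)}.
Proof.
move=> c0 [N [mN N0 PN]].
exists ((fun z => a + c *: z) @^-1` N).
have maff : measurable_fun [set: 'rV[R]_n] (fun z => a + c *: z).
  by apply: measurable_rVD => //; exact: measurable_rVZ.
have mpre : measurable ((fun z => a + c *: z) @^-1` N).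
  by rewrite -[X in measurable X]setTI; exact: maff.
split => //.
  have I0 : (\int[lebesgue_rV n]_z (\1_N z)%:E = 0)%E.
    by rewrite integral_indic// setIT.
  have := @integral_rV_affine n a c (fun x => (\1_N x)%:E) c0.
  rewrite I0 mule0 => <-.
  + have := integral_indic (lebesgue_rV n) measurableT mpre.
    by rewrite setIT => <-; apply: eq_integral => z _; rewrite !indicE; congr (_%:R%:E); apply: asbool_equiv_eq.
  + by apply/measurable_EFinP; exact: measurable_indic.
  + by move=> t; rewrite lee_fin indicE.
by move=> z /= h; apply: PN => /= h'; apply: h.
Qed.

End affine.

(** * Powers and dyadic shells *)

Section real_prelim.
Context {R : realType}.
Implicit Types u v b L : R.

Lemma le_powR u v b : 0 <= b -> 0 <= u -> u <= v -> u `^ b <= v `^ b.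
Proof.
move=> b0 u0 uv; have v0 := le_trans u0 uv.
by rewrite ge0_ler_powR.
Qed.

(** Comparability in both directions is assumed because the sign of b is arbitrary: for negative b
    the inequality between the inverses is the one that is raised to a power. *)
Lemma powR_comparable u v b L : 0 < u -> 0 < v -> 1 <= L -> u <= L * v ->
  v <= L * u -> u `^ b <= L `^ `|b| * v `^ b.
Proof.
move=> u0 v0 L1 uv vu; have L0 : 0 < L by lra.
have [b0|b0] := leP 0 b.
  rewrite ger0_norm// -powRM ?(ltW L0) ?(ltW v0)//.
  by apply: le_powR => //; exact: ltW.
rewrite ltr0_norm//.
have -> : u `^ b = (u^-1) `^ (- b) by rewrite -powR_inv1 ?ltW// -powRrM mulN1r opprK.
have -> : v `^ b = (v^-1) `^ (- b) by rewrite -powR_inv1 ?ltW// -powRrM mulN1r opprK.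
rewrite -powRM ?invr_ge0 ?(ltW L0) ?(ltW v0)//; apply: le_powR.
- lra.
- by rewrite invr_ge0 ltW.
- by rewrite -[u^-1]mul1r ler_pdivrMr// mulrAC ler_pdivlMr// mul1r.
Qed.

Lemma powR_exprn u b k : 0 <= u -> (u ^+ k) `^ b = (u `^ b) ^+ k.
Proof.
move=> u0; elim: k => [|k IH]; first by rewrite !expr0 powR1.
by rewrite !exprS powRM// ?exprn_ge0// IH.
Qed.

Lemma powR_lt1 u b : 1 < u -> b < 0 -> u `^ b < 1.
Proof.
move=> u1 b0; rewrite /powR gt_eqF; last by lra.
by rewrite expR_lt1 nmulr_rlt0// ln_gt0.
Qed.

Lemma ltr_pow2_ex v : exists m : nat, v < 2 ^+ m.
Proof.
exists (Num.bound `|v|); apply: (@lt_le_trans _ _ (Num.bound `|v|)%:R).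
  exact: le_lt_trans (ler_norm v) (archi_boundP (normr_ge0 v)).
by rewrite -natrX ler_nat ltnW// ltn_expl.
Qed.

(** Take the least j with v <= 2^(j + 1) u; its minimality is the strict lower bound. *)
Lemma dyadic_ge u v : 0 < u -> u < v ->
  exists j : nat, 2 ^+ j * u < v /\ v <= 2 * (2 ^+ j * u).
Proof.
move=> u0 uv; have ex : exists j : nat, v <= 2 * (2 ^+ j * u).
  have [m hm] := ltr_pow2_ex (v / u); exists m.
  by move: hm; rewrite ltr_pdivrMr// => hm; lra.
case: (ex_minnP ex) => -[|j] hj jmin; first by exists 0%N; split => //; rewrite expr0 mul1r.
exists j.+1; split => //; rewrite ltNge; apply/negP => h.
by have := jmin j; rewrite ltnn mulrA -exprS => /(_ h).
Qed.

Lemma dyadic_le u v : 0 < v -> v <= u ->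
  exists j : nat, 2^-1 ^+ j * (u / 2) < v /\ v <= 2 * (2^-1 ^+ j * (u / 2)).
Proof.
move=> v0 vu; have ex : exists j : nat, 2^-1 ^+ j * (u / 2) < v.
  have [m hm] := ltr_pow2_ex (u / v); exists m.
  move: hm; rewrite exprVn ltr_pdivrMr// => hm.
  by rewrite mulrC ltr_pdivrMr ?exprn_gt0//; lra.
case: (ex_minnP ex) => -[|j] hj jmin; first by exists 0%N; move: hj; rewrite expr0; lra.
exists j.+1; split => //; rewrite exprS.
have -> : 2 * (2^-1 * 2^-1 ^+ j * (u / 2)) = 2^-1 ^+ j * (u / 2) :> R by field.
rewrite leNgt; apply/negP => h.
by have := jmin j; rewrite ltnn => /(_ h).
Qed.

Lemma nneseries_geometric_le (A q : R) : 0 <= A -> 0 < q -> q < 1 ->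
  (\sum_(j <oo) (A * q ^+ j)%:E <= (A / (1 - q))%:E)%E.
Proof.
move=> A0 q0 q1; apply: lime_le.
  apply: is_cvg_nneseries => n _ _; rewrite lee_fin mulr_ge0// exprn_ge0// (ltW q0)//.
near=> n; rewrite sumEFin lee_fin.
have := @geometric_le_lim R n A q A0 q0; rewrite gtr0_norm// => /(_ q1).
by rewrite /series/=.
Unshelve. all: by end_near. Qed.

End real_prelim.

Section shells.
Context d (T : measurableType d) {R : realType} (mu : {measure set T -> \bar R}).
Variables (N : T -> R) (w : T -> \bar R).
Hypothesis mN : measurable_fun [set: T] N.
Hypothesis mw : measurable_fun [set: T] w.
Hypothesis w0 : forall x, (0 <= w x)%E.

Let measurable_sublevel r : measurable [set x | N x <= r].
Proof.
have := mN measurableT (measurable_itv `]-oo, r]); rewrite setTI.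
by congr measurable; apply/seteqP; split => x /=; rewrite in_itv.
Qed.

(** Here b is 2 for shells going outwards and 1/2 for shells going inwards. On the shell of index j
    the factor N^(-a) is comparable to its value at the radius b^j rho, while the mass is at most K
    (2 b^j rho)^e, so the contributions form a geometric series of ratio b^(e - a). *)
Lemma shell_bound (D : set T) (K e a b rho : R) :
  0 < rho -> 0 < b -> b `^ (e - a) < 1 -> 0 <= K ->
  (forall r : R, 0 < r -> (\int[mu]_(x in [set x | N x <= r]%R) w x <= (K * r `^ e)%:E)%E) ->
  (forall x, D x -> exists j : nat, b ^+ j * rho < N x /\ N x <= 2 * (b ^+ j * rho)) ->
  (\int[mu]_(x in D) (w x * (N x `^ (- a))%:E) <=
    (2 `^ `|a| * 2 `^ e * K * rho `^ (e - a) / (1 - b `^ (e - a)))%:E)%E.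
Proof.
move=> rho0 b0 q1 K0 HK HD.
pose s j := b ^+ j * rho.
have s0 j : 0 < s j by rewrite mulr_gt0// exprn_gt0.
pose S j := [set x | N x <= 2 * s j].
pose c j := 2 `^ `|a| * s j `^ (- a).
have c0 j : 0 <= c j by rewrite mulr_ge0// powR_ge0.
pose F j x := ((c j)%:E * (w x * (\1_(S j) x)%:E))%E.
have F0 j x : (0 <= F j x)%E by rewrite !mule_ge0 ?lee_fin// indicE.
have mF1 j : measurable_fun [set: T] (fun x => w x * (\1_(S j) x)%:E)%E.
  apply: emeasurable_funM => //; apply/measurable_EFinP.
  by apply: measurable_indic; exact: measurable_sublevel.
have mF j : measurable_fun [set: T] (F j) by exact: measurable_funeM.
have le1 : (\int[mu]_(x in D) (w x * (N x `^ (- a))%:E) <=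
    \int[mu]_x \sum_(j <oo) F j x)%E.
  rewrite [leLHS]integral_mkcond; apply: ge0_le_integral_nm => x _.
    by apply: erestrict_ge0 => y _; rewrite mule_ge0// lee_fin powR_ge0.
  rewrite patchE; case: ifPn => [|_]; last by apply: nneseries_ge0.
  rewrite inE => /HD[j [j1 j2]].
  (* The point is charged to one shell containing it; the other terms of the series are
     nonnegative. *)
  apply: (@le_trans _ _ (F j x)); last first.
    apply: (le_trans _ (nneseries_lim_ge j.+1 _)) => //.
    by rewrite big_nat_recr//= leeDr// sume_ge0.
  rewrite /F indicE mem_set//= mule1 muleC; apply: lee_wpmul2r => //.
  rewrite lee_fin; have N0 : 0 < N x by rewrite (lt_trans (s0 j)).
  rewrite /c -[`|a|]normrN; apply: powR_comparable => //; first lra.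
  rewrite /s; lra.
apply: (le_trans le1).
rewrite integral_nneseries//.
pose A := 2 `^ `|a| * 2 `^ e * K * rho `^ (e - a).
have A0 : 0 <= A by rewrite !mulr_ge0// powR_ge0.
apply: (le_trans _ (nneseries_geometric_le A0 _ q1)); last exact: powR_gt0.
apply: lee_nneseries => [j _ _|j _]; first by apply: integral_ge0 => x _; exact: F0.
rewrite integral_scale//; last by move=> x; rewrite mule_ge0// lee_fin indicE.
have -> : (\int[mu]_x (w x * (\1_(S j) x)%:E) = \int[mu]_(x in S j) w x)%E.
  rewrite [RHS]integral_mkcond; apply: eq_integral => x _.
  by rewrite patchE indicE; case: ifP => _; rewrite ?mule1 ?mule0.
apply: (@le_trans _ _ ((c j)%:E * (K * (2 * s j) `^ e)%:E)%E).
  by apply: lee_wpmul2l; rewrite ?lee_fin//; apply: HK; rewrite mulr_gt0.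
rewrite -EFinM lee_fin le_eqVlt; apply/orP; left; apply/eqP.
rewrite /A /c powRM ?(ltW (s0 j))//.
have sE : s j `^ e * s j `^ (- a) = rho `^ (e - a) * (b `^ (e - a)) ^+ j.
  rewrite -powRD; last by apply/implyP => _; rewrite gt_eqF.
  rewrite /s powRM ?exprn_ge0 ?ltW// mulrC; congr (_ * _).
  by rewrite powR_exprn// ltW.
by rewrite -[RHS]mulrA -sE; ring.
Qed.

(** One constant for both directions: with the absolute value, the ratio of the geometric series is
    2^(- |e - a|) whether e < a or e > a. *)
Definition shell_const (e a : R) : R :=
  2 `^ `|a| * 2 `^ e * 2 `^ `|e - a| / (1 - 2 `^ (- `|e - a|)).

Lemma shell_const_gt0 e a : e != a -> 0 < shell_const e a.
Proof.
move=> ea; rewrite /shell_const divr_gt0 ?mulr_gt0 ?powR_gt0//.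
rewrite subr_gt0 powR_lt1 ?ltr1n//.
by rewrite oppr_lt0 normr_gt0 subr_eq0.
Qed.

Lemma shell_outer (K e a rho : R) :
  0 < rho -> e < a -> 0 <= K ->
  (forall r : R, 0 < r -> (\int[mu]_(x in [set x | N x <= r]%R) w x <= (K * r `^ e)%:E)%E) ->
  (\int[mu]_(x in [set x | rho < N x]%R) (w x * (N x `^ (- a))%:E) <=
    (shell_const e a * K * rho `^ (e - a))%:E)%E.
Proof.
move=> rho0 ea K0 HK.
have ea' : e != a by rewrite lt_eqF.
apply: (le_trans (@shell_bound _ K e a 2 rho rho0 _ _ K0 HK _)) => //.
- by apply: powR_lt1; lra.
- by move=> x /= h; exact: dyadic_ge.
rewrite lee_fin /shell_const.
have -> : - `|e - a| = e - a by rewrite ltr0_norm ?opprK//; lra.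
have q1 : 2 `^ (e - a) < 1 :> R.
  by apply: powR_lt1; lra.
set X := 2 `^ `|a| * 2 `^ e; set Q := 1 - _; set r := rho `^ _.
have h1 : 1 <= 2 `^ `|e - a| :> R.
  by rewrite -[leLHS](powRr0 2) ler_powR ?ler1n.
have XQ : 0 <= X / Q * K * r.
  rewrite !mulr_ge0// ?powR_ge0//; last by rewrite invr_ge0 /Q; lra.
have -> : X * K * r / Q = X / Q * K * r by ring.
have -> : X * 2 `^ `|e - a| / Q * K * r = 2 `^ `|e - a| * (X / Q * K * r) by ring.
nra.
Qed.

Lemma shell_inner (K e a rho : R) :
  0 < rho -> a < e -> 0 <= K ->
  (forall r : R, 0 < r -> (\int[mu]_(x in [set x | N x <= r]%R) w x <= (K * r `^ e)%:E)%E) ->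
  (\int[mu]_(x in [set x | 0 < N x <= rho]%R) (w x * (N x `^ (- a))%:E) <=
    (shell_const e a * K * rho `^ (e - a))%:E)%E.
Proof.
move=> rho0 ea K0 HK.
have ea' : e != a by rewrite gt_eqF.
have bE : 2^-1 `^ (e - a) = 2 `^ (- `|e - a|) :> R.
  by rewrite -powR_inv1// -powRrM mulN1r gtr0_norm//; lra.
(* The shells start at rho / 2, since each one ends at twice its lower radius: the outermost is ]rho
   / 2, rho]. *)
have rho2 : 0 < rho / 2 by lra.
have q1 : 2 `^ (- `|e - a|) < 1 :> R.
  rewrite powR_lt1 ?ltr1n//.
  by rewrite oppr_lt0 normr_gt0 subr_eq0.
apply: (le_trans (@shell_bound _ K e a 2^-1 (rho / 2) rho2 _ _ K0 HK _)) => //.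
- by rewrite bE.
- by move=> x /= /andP[h1 h2]; exact: dyadic_le.
rewrite lee_fin /shell_const bE powRM ?invr_ge0 ?(ltW rho0)//.
set X := 2 `^ `|a| * 2 `^ e; set Q := 1 - _; set r := rho `^ _.
have h1 : 2 `^ (- `|e - a|) <= 2 `^ `|e - a| :> R.
  by rewrite ler_powR ?ler1n// ge0_cp.
rewrite bE.
have XQ : 0 <= X / Q * K * r.
  rewrite !mulr_ge0// ?powR_ge0//; last by rewrite invr_ge0 /Q; lra.
have -> : X * K * (r * 2 `^ (- `|e - a|)) / Q = 2 `^ (- `|e - a|) * (X / Q * K * r) by ring.
have -> : X * 2 `^ `|e - a| / Q * K * r = 2 `^ `|e - a| * (X / Q * K * r) by ring.
nra.
Qed.

End shells.

Section power_integrals.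
Context {R : realType}.
Local Notation leb := (@lebesgue_measure R).

Let w (t : measurableTypeR R) : \bar R := (\1_(`]0, +oo[%classic : set R) t)%:E.

Let mw : measurable_fun [set: measurableTypeR R] w.
Proof. by apply/measurable_EFinP; exact: measurable_indic. Qed.

Let w0 t : (0 <= w t)%E.
Proof. by rewrite /w lee_fin indicE. Qed.

Let w1 t : 0 < t -> w t = 1%E.
Proof. by move=> t0; rewrite /w indicE mem_set//= in_itv/= t0. Qed.

Let int_w (r : R) : 0 < r -> (\int[leb]_(t in [set t | t <= r]%R) w t <= (1 * r `^ 1)%:E)%E.
Proof.
move=> r0; rewrite mul1r powRr1 ?(ltW r0)//.
have -> : [set t | t <= r] = `]-oo, r]%classic by apply/seteqP; split => t; rewrite /= in_itv.
rewrite integral_indic//.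
have -> : `]0, +oo[ `&` `]-oo, r] = `]0, r]%classic.
  apply/seteqP; split => t /=; rewrite !in_itv/= ?andbT; first by move=> [-> ->].
  by move=> /andP[].
by have := lebesgue_measure_itv (`]0, r] : interval R); rewrite /= lte_fin r0 sube0 => ->.
Qed.

(** The shell estimate on the line, with N the identity and w the indicator of the positive
    half-line, for which the mass of t <= r is r, that is e = 1. *)
Lemma integral_powR_low (a rho : R) : 0 < a -> 0 < rho ->
  (\int[leb]_(t in `]0%R, rho]) (t `^ (a - 1))%:E <=
   (shell_const 1 (1 - a) * rho `^ a)%:E)%E.
Proof.
move=> a0 rho0.
have h1 : 1 - a < 1 by lra.
have := @shell_inner _ _ _ leb id w (@measurable_id _ _ _) mw w0 1 1 (1 - a) rho rho0 h1 ler01 int_w.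
rewrite mulr1; have -> : 1 - (1 - a) = a by lra.
apply: le_trans; rewrite le_eqVlt; apply/orP; left; apply/eqP.
have -> : `]0, rho]%classic = [set x | 0 < id x <= rho].
  by apply/seteqP; split => t; rewrite /= in_itv.
apply: eq_integral => t; rewrite inE/= => /andP[t0 _].
by rewrite w1// mul1e opprB.
Qed.

Lemma integral_powR_high (a rho : R) : 0 < a -> 0 < rho ->
  (\int[leb]_(t in `]rho, +oo[) (t `^ (- a - 1))%:E <=
   (shell_const 1 (1 + a) * rho `^ (- a))%:E)%E.
Proof.
move=> a0 rho0.
have h1 : 1 < 1 + a by lra.
have := @shell_outer _ _ _ leb id w (@measurable_id _ _ _) mw w0 1 1 (1 + a) rho rho0 h1 ler01 int_w.
rewrite mulr1; have -> : 1 - (1 + a) = - a by lra.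
apply: le_trans; rewrite le_eqVlt; apply/orP; left; apply/eqP.
have -> : `]rho, +oo[%classic = [set x | rho < id x].
  by apply/seteqP; split => t; rewrite /= in_itv/= andbT.
apply: eq_integral => t; rewrite inE/= => t0.
rewrite w1 ?(lt_trans rho0)// mul1e; congr (_ `^ _)%:E; lra.
Qed.

End power_integrals.

(** * The Hardy-Littlewood maximal function *)

Section dyadic.
Context {R : realType}.

Definition dyad (k : int) : R := 2 ^ k.

Lemma dyad_gt0 k : 0 < dyad k.
Proof. by rewrite exprz_gt0. Qed.

Lemma dyadS k : dyad (k + 1) = 2 * dyad k.
Proof. by rewrite /dyad expfzDr// mulrC expr1z. Qed.

Lemma dyadic_int (v : R) : 0 < v -> exists k : int, dyad k < v /\ v <= 2 * dyad k.
Proof.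
move=> v0; have [v1|v1] := leP v 1.
  have [j [h1 h2]] := dyadic_le v0 v1; exists (- (j.+1)%:Z).
  have -> : dyad (- (j.+1)%:Z) = 2^-1 ^+ j * (1 / 2).
    by rewrite /dyad -exprz_inv -exprnP exprSr mul1r.
  by [].
have [j [h1 h2]] := dyadic_ge ltr01 v1; exists j%:Z.
by rewrite /dyad -exprnP; rewrite mulr1 in h1 h2.
Qed.

End dyadic.

Section maximal.
Context {R : realType} (n : nat).
Local Notation V := 'rV[R]_n.
Local Notation mu := (lebesgue_rV n).

Lemma lebesgue_cube_scale (x : V) (r : R) (k : R) : 0 <= r -> 0 <= k ->
  (mu (cube x (k * r)) = (k ^+ n)%:E * mu (cube x r))%E.
Proof.
move=> r0 k0; rewrite !lebesgue_cube ?mulr_ge0// -EFinM; congr EFin.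
by rewrite -exprMn; congr (_ ^+ _); ring.
Qed.

Definition cubes (s : seq (V * R)) : set V := \big[setU/set0]_(q <- s) cube q.1 q.2.

Lemma cubesP s y : cubes s y <-> exists2 q, q \in s & cube q.1 q.2 y.
Proof.
rewrite /cubes -bigcup_seq; split => [[q /= qs qy]|[q qs qy]]; first by exists q.
by exists q.
Qed.

Lemma measurable_cubes s : measurable (cubes s).
Proof. by apply: bigsetU_measurable => q _; exact: measurable_cube. Qed.

Let max_radius (s : seq (V * R)) : s != [::] ->
  exists2 q0, q0 \in s & forall q, q \in s -> q.2 <= q0.2.
Proof.
elim: s => // q [|q' s] IH _.
  by exists q; rewrite ?mem_head// => q'; rewrite inE => /eqP ->.
have [//|q0 q0s h] := IH; have [le|le] := leP q.2 q0.2.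
  exists q0; first by rewrite inE q0s orbT.
  by move=> a; rewrite inE => /predU1P[-> //|]; exact: h.
exists q; first exact: mem_head.
move=> a; rewrite inE => /predU1P[-> //|/h ha]; exact: le_trans ha (ltW le).
Qed.

(* Greedy Vitali selection: keep a largest cube, discard the cubes that meet it
   (its threefold dilation covers them), and recurse. *)
Lemma vitali_weak (phi : V -> \bar R) (lam : R) (s : seq (V * R)) :
  measurable_fun [set: V] phi -> (forall x, 0 <= phi x)%E -> 0 <= lam ->
  (forall q, q \in s -> 0 < q.2 /\
    (lam%:E * mu (cube q.1 q.2) <= \int[mu]_(x in cube q.1 q.2) phi x)%E) ->
  (lam%:E * mu (cubes s) <= (3 ^+ n)%:E * \int[mu]_(x in cubes s) phi x)%E.
Proof.
move=> mphi phi0 lam0.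
have [m] := ubnP (size s); elim: m s => // m IH s sm Hs.
have [->|sN] := eqVneq s [::].
  by rewrite /cubes big_nil measure0 mule0 integral_set0 mule0.
have [q0 q0s q0max] := max_radius sN.
have [r0 avg0] := Hs _ q0s.
pose meets q := `[< cube q.1 q.2 `&` cube q0.1 q0.2 !=set0 >].
pose s' := [seq q <- s | ~~ meets q].
have mq0 : meets q0.
  by apply/asboolP; exists q0.1; split; rewrite /cube/= subrr normr0 ltW.
have s'm : (size s' < m)%N.
  rewrite -ltnS (leq_trans _ sm)// ltnS size_filter -(count_predC meets s).
  rewrite -[ltnLHS]add0n ltn_add2r -has_count; apply/hasP; by exists q0.
have cov : cubes s `<=` cube q0.1 (3 * q0.2) `|` cubes s'.
  move=> y /cubesP[q qs qy]; have [mq|mq] := boolP (meets q); last first.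
    by right; apply/cubesP; exists q => //; rewrite mem_filter mq.
  left; move/asboolP : mq => [z [zq zq0]]; have := q0max _ qs.
  rewrite /cube/= in qy zq zq0 *; move=> qq0.
  rewrite -(subrKA z) (le_trans (ler_normD _ _))//.
  have : `|z - y| <= `|q.1 - z| + `|q.1 - y|.
    by rewrite -(subrKA q.1 z (- y)) (le_trans (ler_normD _ _))// distrC.
  by lra.
have dis : cube q0.1 q0.2 `&` cubes s' = set0.
  apply/seteqP; split => // y [yq0 /cubesP[q]]; rewrite mem_filter.
  by move=> /andP[/asboolP nq _] yq; apply: nq; exists y.
have IHs' := IH s' s'm (fun q qs' => Hs q (mem_subseq (filter_subseq _ _) qs')).
apply: (@le_trans _ _ (lam%:E * (mu (cube q0.1 (3 * q0.2)) + mu (cubes s')))%E).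
  apply: lee_wpmul2l; rewrite ?lee_fin//.
  apply: (@le_trans _ _ (mu (cube q0.1 (3 * q0.2) `|` cubes s'))).
    apply: le_measure; rewrite ?inE//; first exact: measurable_cubes.
    by apply: measurableU; [exact: measurable_cube|exact: measurable_cubes].
  by apply: measureU2; [exact: measurable_cube|exact: measurable_cubes].
rewrite ge0_muleDr// lebesgue_cube_scale ?(ltW r0)//.
apply: (@le_trans _ _ ((3 ^+ n)%:E * \int[mu]_(x in cube q0.1 q0.2) phi x +
                       (3 ^+ n)%:E * \int[mu]_(x in cubes s') phi x)%E).
  by apply: leeD => //; rewrite muleCA; apply: lee_wpmul2l.
rewrite -ge0_muleDr; [|exact: integral_ge0|exact: integral_ge0].
apply: lee_wpmul2l; first by rewrite lee_fin exprn_ge0.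
rewrite -ge0_integral_setU//; last 4 first.
- exact: measurable_cube.
- exact: measurable_cubes.
- exact: measurable_funTS.
- by rewrite disj_set2E dis eqxx.
apply: ge0_subset_integral => //.
- by apply: measurableU; [exact: measurable_cube|exact: measurable_cubes].
- exact: measurable_cubes.
- exact: measurable_funTS.
- move=> y [yq0|/cubesP[q]]; first by apply/cubesP; exists q0.
  by rewrite mem_filter => /andP[_ qs] qy; apply/cubesP; exists q.
Qed.

(* A countable family of cubes is enough: every cube is contained in a member of
   comparable measure. *)
Definition dyadic_cube (i : nat) : V * R :=
  if @unpickle (int * 'rV[int]_n)%type i is Some (k, m)
  then (dyad k *: map_mx intr m, 2 * dyad k) else (0, 1).

Lemma dyadic_cube_gt0 i : 0 < (dyadic_cube i).2.
Proof.
rewrite /dyadic_cube; case: unpickle => [[k m]|]//=.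
by rewrite mulr_gt0// dyad_gt0.
Qed.

Lemma dyadic_cube_cover (x : V) (r : R) : 0 < r ->
  exists i, [/\ cube x r `<=` cube (dyadic_cube i).1 (dyadic_cube i).2 &
    (dyadic_cube i).2 <= 4 * r].
Proof.
move=> r0; have [k [k1 k2]] := dyadic_int r0.
have dE : dyad (k + 1) = 2 * dyad k :> R by exact: dyadS.
(* The mesh dyad (k + 1) is at least r, and x is within one mesh of the chosen grid point; so a
   radius of two meshes covers the cube, and it equals 4 dyad k, less than 4 r. *)
pose m : 'rV[int]_n := \row_i Num.floor (x ord0 i / dyad (k + 1)).
exists (pickle (k + 1, m)); rewrite /dyadic_cube pickleK /=.
have d0 := dyad_gt0 (R := R) (k + 1).
split; last by rewrite dE; lra.
apply: cube_sub; rewrite dE in d0 *.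
suff : `|2 * dyad k *: map_mx intr m - x| <= 2 * dyad k by lra.
apply/rV_norm_le; first lra.
move=> i; rewrite !mxE dE.
have /andP[f1 f2] := mem_rg1_floor (x ord0 i / (2 * dyad k)).
set F := (Num.floor _)%:~R in f1 f2 *.
move: f1 f2; rewrite ler_pdivlMr// ltr_pdivrMr// => f1 f2.
rewrite ler_norml; apply/andP; split; lra.
Qed.

Definition cube_avg (phi : V -> \bar R) (i : nat) : \bar R :=
  (((2 * (dyadic_cube i).2) ^- n)%:E *
  \int[mu]_(x in cube (dyadic_cube i).1 (dyadic_cube i).2) phi x)%E.

(** An uncentred maximal function over the grid cubes. The indicator expresses that the cube
    contains x, which makes this a countable supremum of measurable functions of x. *)
Definition maximal (phi : V -> \bar R) (x : V) : \bar R :=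
  esups (fun i => cube_avg phi i *
    (\1_(cube (dyadic_cube i).1 (dyadic_cube i).2) x)%:E)%E 0%N.

Lemma cube_avg_ge0 phi i : (forall x, 0 <= phi x)%E -> (0 <= cube_avg phi i)%E.
Proof.
move=> phi0; apply: mule_ge0; last exact: integral_ge0.
by rewrite lee_fin invr_ge0 exprn_ge0// mulr_ge0// ltW// dyadic_cube_gt0.
Qed.

Lemma measurable_maximal phi : measurable_fun [set: V] (maximal phi).
Proof.
apply: (@measurable_fun_esups _ _ _ setT (fun i x => cube_avg phi i *
    (\1_(cube (dyadic_cube i).1 (dyadic_cube i).2) x)%:E)%E) => i.
apply: measurable_funeM; apply/measurable_EFinP.
by apply: measurable_indic; exact: measurable_cube.
Qed.

Lemma maximal_ge phi i x : (cube_avg phi i *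
    (\1_(cube (dyadic_cube i).1 (dyadic_cube i).2) x)%:E <= maximal phi x)%E.
Proof. by apply: ereal_sup_ubound; exists i. Qed.

Lemma maximal_ge0 phi x : (forall x, 0 <= phi x)%E -> (0 <= maximal phi x)%E.
Proof.
move=> phi0; apply: le_trans (maximal_ge phi 0%N x).
by rewrite mule_ge0 ?cube_avg_ge0// lee_fin indicE.
Qed.

Lemma maximal_gtP phi (lam : R) x : 0 <= lam ->
  (lam%:E < maximal phi x)%E <->
  exists i, cube (dyadic_cube i).1 (dyadic_cube i).2 x /\ (lam%:E < cube_avg phi i)%E.
Proof.
move=> lam0; split => [/ereal_sup_gt[_ [i _ <-]]|[i [ix h]]]; last first.
  apply: lt_le_trans (maximal_ge phi i x).
  by rewrite indicE mem_set// mule1.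
rewrite indicE; case: (boolP (x \in _)) => [/set_mem h|_]; last first.
  by rewrite mule0 lte_fin ltNge lam0.
by rewrite mule1; exists i.
Qed.

(** The factor 8 r bounds the side of the grid cube containing the given cube, whose radius is at
    most 4 r. *)
Lemma cube_le_maximal phi x r : measurable_fun [set: V] phi ->
  (forall x, 0 <= phi x)%E -> 0 < r ->
  (\int[mu]_(y in cube x r) phi y <= ((8 * r) ^+ n)%:E * maximal phi x)%E.
Proof.
move=> mphi phi0 r0; have [i [sub le]] := dyadic_cube_cover x r0.
have xi : cube (dyadic_cube i).1 (dyadic_cube i).2 x.
  by apply: sub; rewrite /cube/= subrr normr0 ltW.
have ri := dyadic_cube_gt0 i.
apply: (@le_trans _ _ (((2 * (dyadic_cube i).2) ^+ n)%:E * cube_avg phi i)%E).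
  rewrite /cube_avg muleA -EFinM mulfV; last first.
    by rewrite expf_neq0// mulf_neq0// gt_eqF.
  rewrite mul1e; apply: ge0_subset_integral => //; try exact: measurable_cube.
  exact: measurable_funTS.
apply: lee_pmul.
- by rewrite lee_fin exprn_ge0//; lra.
- exact: cube_avg_ge0.
- by rewrite lee_fin lerXn2r// ?nnegrE; lra.
- by apply: le_trans (maximal_ge phi i x); rewrite indicE mem_set// mule1.
Qed.

(** The superlevel set is the increasing union over K of the cubes with large average among the
    first K ones. The covering bound for a finite family does not depend on K and passes to the
    limit. *)
Lemma maximal_weak phi (lam : R) : measurable_fun [set: V] phi ->
  (forall x, 0 <= phi x)%E -> 0 <= lam ->
  (lam%:E * mu [set x | (lam%:E < maximal phi x)%E] <=
    (3 ^+ n)%:E * \int[mu]_x phi x)%E.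
Proof.
move=> mphi phi0 lam0.
pose s K := [seq dyadic_cube i | i <- iota 0 K & (lam%:E < cube_avg phi i)%E].
have E : [set x | (lam%:E < maximal phi x)%E] = \bigcup_K cubes (s K).
  apply/seteqP; split => x /=.
    move=> /(maximal_gtP _ _ lam0)[i [ix ai]]; exists i.+1 => //.
    apply/cubesP; exists (dyadic_cube i) => //.
    by apply/map_f; rewrite mem_filter ai mem_iota/=.
  move=> [K _ /cubesP[q /mapP[i]]]; rewrite mem_filter => /andP[ai _] -> ix.
  by apply/maximal_gtP => //; exists i.
have nd : {homo (fun K => cubes (s K)) : i j / (i <= j)%N >-> (i <= j)%O}.
  move=> i j ij; apply/subsetPset => x /cubesP[q /mapP[k]].
  rewrite mem_filter mem_iota add0n => /andP[ak ki] -> kx.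
  apply/cubesP; exists (dyadic_cube k) => //.
  by apply/map_f; rewrite mem_filter ak mem_iota add0n (leq_trans ki).
have := nondecreasing_cvg_mu (mu := mu) (fun K => measurable_cubes (s K))
  (bigcup_measurable (fun K _ => measurable_cubes (s K))) nd.
rewrite -E => cvg.
have [->|lamN] := eqVneq lam 0.
  by rewrite mul0e mule_ge0 ?lee_fin ?exprn_ge0//; exact: integral_ge0.
have {lamN}lamp : 0 < lam by rewrite lt_neqAle eq_sym lamN.
rewrite -lee_pdivlMl// muleA -EFinM.
rewrite -(cvg_lim _ cvg)//; apply: lime_le; first exact: cvgP cvg.
apply: nearW => K /=; rewrite EFinM -muleA lee_pdivlMl//.
apply: (le_trans (vitali_weak mphi phi0 lam0 _)).
  move=> q /mapP[i]; rewrite mem_filter => /andP[ai _] ->.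
  have ri := dyadic_cube_gt0 i; split => //.
  rewrite lebesgue_cube ?(ltW ri)// muleC -lee_pdivlMl; last first.
    by rewrite exprn_gt0// mulr_gt0.
  exact: ltW.
apply: lee_wpmul2l; first by rewrite lee_fin exprn_ge0.
by apply: ge0_subset_integral => //; exact: measurable_cubes.
Qed.

End maximal.

(** * Strong type bound for the maximal function, by layer cake *)

Section maximal_strong.
Context {R : realType} (n : nat).
Local Notation V := 'rV[R]_n.
Local Notation mu := (lebesgue_rV n).
Local Notation leb := (@lebesgue_measure R).
Local Notation RR := (measurableTypeR R).

Lemma measurable_fun_powR d (T : measurableType d) (f : T -> R) (b : R) :
  measurable_fun [set: T] f -> measurable_fun [set: T] (fun t => f t `^ b).
Proof. by move=> mf; exact: measurableT_comp (measurable_powR b) mf. Qed.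

Lemma measurable_fun_poweR d (T : measurableType d) (f : T -> \bar R) (b : R) :
  measurable_fun [set: T] f -> measurable_fun [set: T] (fun t => f t `^ b)%E.
Proof. by move=> mf; exact: measurableT_comp (measurable_poweR b) mf. Qed.

Lemma measurable_fun_lte d (T : measurableType d) (f : T -> R) (g : T -> \bar R) :
  measurable_fun [set: T] f -> measurable_fun [set: T] g ->
  measurable_fun [set: T] (fun t => ((f t)%:E < g t)%E).
Proof.
move=> mf mg; apply: (@measurable_fun_bool _ _ _ _ true).
rewrite (_ : _ @^-1` _ = [set x | (0 < g x - (f x)%:E)%E]).
  apply: emeasurable_fun_o_infty => //; apply: emeasurable_funB => //.
  exact/measurable_EFinP.
have E t : (0 < g t - (f t)%:E)%E = ((f t)%:E < g t)%E.
  by case: (g t) => [y| |]; rewrite ?ltry ?ltNyr//= -EFinB !lte_fin subr_gt0.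
by apply/seteqP; split => t; rewrite /mkset E.
Qed.

(** Marcinkiewicz truncation: the part of phi below lam / 2 adds at most lam / 2 to any average, so
    where the maximal function exceeds lam, that of the remaining part phi1 exceeds lam / 2. *)
Lemma maximal_weak_refined (phi : V -> \bar R) (lam : R) :
  measurable_fun [set: V] phi -> (forall x, 0 <= phi x)%E -> 0 < lam ->
  (lam%:E * mu [set x | (lam%:E < maximal phi x)%E] <=
    (2 * 3 ^+ n)%:E * \int[mu]_x (if (lam%:E < 2%:E * phi x)%E then phi x else 0))%E.
Proof.
move=> mphi phi0 lam0.
pose phi1 x := (if (lam%:E < 2%:E * phi x)%E then phi x else 0)%E.
have phi10 x : (0 <= phi1 x)%E by rewrite /phi1; case: ifP.
have mphi1 : measurable_fun [set: V] phi1.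
  apply: measurable_fun_ifT => //; apply: measurable_fun_lte => //.
  exact: measurable_funeM.
have lam20 : 0 <= lam / 2 by lra.
apply: (@le_trans _ _ (2%:E * ((lam / 2)%:E * mu [set x | ((lam / 2)%:E < maximal phi1 x)%E]))%E).
  rewrite muleA -EFinM (_ : 2 * (lam / 2) = lam); last by lra.
  apply: lee_wpmul2l; first by rewrite lee_fin ltW.
  have mset (f : V -> \bar R) (l : R) : measurable [set x | (l%:E < maximal f x)%E].
    by rewrite -[X in measurable X]setTI; apply: emeasurable_fun_o_infty => //;
      exact: measurable_maximal.
  apply: le_measure; rewrite ?inE; [exact: mset|exact: mset|].
  move=> x /= /maximal_gtP[]; first exact: ltW.
  move=> i [ix ai]; apply/maximal_gtP => //; exists i; split => //.
  have ri := dyadic_cube_gt0 (R := R) n i.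
  set Q := cube _ _ in ix.
  have mQ : measurable Q by exact: measurable_cube.
  have le1 : (\int[mu]_(y in Q) phi y <= \int[mu]_(y in Q) phi1 y + (lam / 2)%:E * mu Q)%E.
    rewrite -integral_cst// -ge0_integralD//; last exact: measurable_funTS.
    apply: ge0_le_integral_nm => // y _ /=; rewrite /phi1.
    have [h|h] := ltP lam%:E (2%:E * phi y)%E; first by rewrite leeDl// lee_fin.
    by rewrite /= add0e mulrC EFinM lee_pdivlMl.
  have {}le1 : (cube_avg phi i <= cube_avg phi1 i + (lam / 2)%:E)%E.
    rewrite /cube_avg; set c := (2 * _) ^- n.
    have cQ : (c%:E * mu Q = 1)%E.
      rewrite /Q lebesgue_cube ?(ltW ri)// -EFinM mulVf// expf_neq0// gt_eqF//.
      by rewrite mulr_gt0.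
    have c0 : 0 <= c by rewrite invr_ge0 exprn_ge0// mulr_ge0// ltW.
    apply: (le_trans (lee_wpmul2l _ le1)); first by rewrite lee_fin.
    rewrite ge0_muleDr ?mule_ge0 ?lee_fin//; last exact: integral_ge0.
    by rewrite muleCA cQ mule1.
  have := lt_le_trans ai le1.
  by rewrite -lteBlDr// -EFinB (_ : lam - lam / 2 = lam / 2)//; lra.
rewrite [(2 * 3 ^+ n)%:E]EFinM -muleA; apply: lee_wpmul2l => //.
exact: maximal_weak.
Qed.

Variable p : R.
Hypothesis p1 : 1 < p.

Let p0 : 0 < p. Proof. exact: lt_trans p1. Qed.
Let pN0 : p != 0. Proof. by rewrite gt_eqF. Qed.
Let p10 : 0 < p - 1. Proof. by rewrite subr_gt0. Qed.

(** The integral of A over lam is v^p up to a constant. B has exponent p - 2 because the weak type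
    bound at level lam costs a factor 1 / lam, and its range lam < 2 v comes from the truncation at
    lam / 2. *)
Let A (v : \bar R) (lam : RR) : \bar R :=
  if (0 < lam) && (lam%:E < v)%E then (lam `^ (p - 1))%:E else 0%E.
Let B (v : \bar R) (lam : RR) : \bar R :=
  if (0 < lam) && (lam%:E < 2%:E * v)%E then (lam `^ (p - 2))%:E else 0%E.

Let A0 v lam : (0 <= A v lam)%E.
Proof. by rewrite /A; case: ifP => // _; rewrite lee_fin powR_ge0. Qed.
Let B0 v lam : (0 <= B v lam)%E.
Proof. by rewrite /B; case: ifP => // _; rewrite lee_fin powR_ge0. Qed.

Let measurable_A (f : V -> \bar R) : measurable_fun [set: V] f ->
  measurable_fun [set: V * RR] (fun z => A (f z.1) z.2).
Proof.
move=> mf; apply: measurable_fun_ifT => //.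
- apply: measurable_and; first exact: measurable_fun_ltr.
  by apply: measurable_fun_lte => //; exact: measurableT_comp.
- exact/measurable_EFinP/measurable_fun_powR.
Qed.

Let measurable_B (f : V -> \bar R) : measurable_fun [set: V] f ->
  measurable_fun [set: V * RR] (fun z => B (f z.1) z.2).
Proof.
move=> mf; apply: measurable_fun_ifT => //.
- apply: measurable_and; first exact: measurable_fun_ltr.
  by apply: measurable_fun_lte => //; apply: measurable_funeM; exact: measurableT_comp.
- exact/measurable_EFinP/measurable_fun_powR.
Qed.

(** Only the levels in [v / 2, v[ are kept: A is at least (v / 2)^(p - 1) there, on an interval of
    length v / 2. This explains the constant 2^p. *)
Let layer_cake_fin (v : R) : 0 < v ->
  ((v `^ p)%:E <= (2 `^ p)%:E * \int[leb]_lam A v%:E lam)%E.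
Proof.
move=> v0.
have h : (((v / 2) `^ p)%:E <= \int[leb]_lam A v%:E lam)%E.
  apply: (@le_trans _ _ (\int[leb]_(lam in `[(v / 2)%R, v[) ((v / 2) `^ (p - 1))%:E)%E).
    rewrite integral_cst//= lebesgue_measure_itv/= lte_fin.
    have -> : v / 2 < v by lra.
    rewrite -EFinB -EFinM lee_fin (_ : v - v / 2 = v / 2); last by lra.
    have v20 : 0 <= v / 2 by lra.
    by rewrite [leRHS]mulrC (mulr_powRB1 v20 p0).
  rewrite integral_mkcond; apply: ge0_le_integral_nm => lam _.
    by apply: erestrict_ge0 => ? _; rewrite lee_fin powR_ge0.
  rewrite patchE; case: ifPn => // /set_mem/=; rewrite in_itv/= => /andP[l1 l2].
  rewrite /A lte_fin l2 andbT.
  have -> : 0 < lam by lra.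
  rewrite lee_fin; apply: le_powR; [exact: ltW|lra|exact: l1].
have -> : (v `^ p)%:E = ((2 `^ p)%:E * ((v / 2) `^ p)%:E)%E.
  by rewrite -EFinM -powRM//; [congr (_ `^ _)%:E; lra|lra].
by apply: lee_wpmul2l => //; rewrite lee_fin powR_ge0.
Qed.

Let layer_cake (v : \bar R) : (0 <= v)%E ->
  (v `^ p <= (2 `^ p)%:E * \int[leb]_lam A v lam)%E.
Proof.
case: v => [v| |//]; last first.
  move=> _; rewrite [leRHS](_ : _ = +oo%E) ?leey//; apply/eqyP => X X0.
  (* For v = +oo the integral exceeds every X, by comparison with the finite height X^(1/p). *)
  have X1 : 0 < X `^ p^-1 by rewrite powR_gt0.
  rewrite (_ : X = (X `^ p^-1) `^ p); last first.
    by rewrite -powRrM mulVf// powRr1// ltW.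
  apply: (le_trans (layer_cake_fin X1)); apply: lee_wpmul2l.
    by rewrite lee_fin powR_ge0.
  apply: ge0_le_integral_nm => // lam _; rewrite /A ltry andbT.
  by case: ifP => [/andP[-> _]//|_]; case: ifP => // _; rewrite lee_fin powR_ge0.
rewrite lee_fin le_eqVlt => /predU1P[<-|v0].
  rewrite poweR0r//.
  by rewrite mule_ge0 ?lee_fin ?powR_ge0//; exact: integral_ge0.
exact: layer_cake_fin.
Qed.

Let C2 := shell_const 1 (1 - (p - 1)) * 2 `^ (p - 1) :> R.

(** The power lam^(p - 2) is integrable at 0 because p > 1; this is the place where the exponent 1
    is excluded. *)
Let layer_upper (v : \bar R) : (0 <= v)%E ->
  (v * \int[leb]_lam B v lam <= C2%:E * v `^ p)%E.
Proof.
have sc : 0 < shell_const 1 (1 - (p - 1)) :> R.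
  by apply: shell_const_gt0; rewrite gt_eqF// ltrBlDr ltrDl.
have C20 : 0 < C2 by rewrite mulr_gt0// powR_gt0.
case: v => [v| |//]; last first.
  by move=> _; rewrite poweRyr// gt0_muley ?leey.
rewrite lee_fin le_eqVlt => /predU1P[<-|v0].
  by rewrite mul0e mule_ge0 ?lee_fin ?(ltW C20)// poweR_ge0.
have v20 : 0 < 2 * v by lra.
have := @integral_powR_low R (p - 1) (2 * v) p10 v20.
have -> : p - 1 - 1 = p - 2 by lra.
move=> h; rewrite poweR_EFin.
have -> : (C2%:E * (v `^ p)%:E = v%:E * (shell_const 1 (1 - (p - 1)) * (2 * v) `^ (p - 1))%:E)%E.
  rewrite -!EFinM powRM ?(ltW v0)//; congr EFin.
  by rewrite -(mulr_powRB1 (ltW v0) p0) /C2; ring.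
apply: lee_wpmul2l; first by rewrite lee_fin ltW.
apply: le_trans h; rewrite [leRHS]integral_mkcond.
apply: ge0_le_integral_nm => // lam _.
rewrite /B -EFinM lte_fin patchE; case: ifPn => [/andP[l1 l2]|_].
  by rewrite mem_set//= in_itv/= l1 ltW.
by case: ifP => // _; rewrite lee_fin powR_ge0.
Qed.

(** Tonelli exchanges x and the level, the truncated weak type bound is applied at each level, and a
    second exchange leaves an integral in lam for each x, which is [layer_upper]. *)
Lemma maximal_strong : exists2 C : R, 0 < C & forall phi : V -> \bar R,
  measurable_fun [set: V] phi -> (forall x, 0 <= phi x)%E ->
  (\int[mu]_x (maximal phi x `^ p) <= C%:E * \int[mu]_x (phi x `^ p))%E.
Proof.
have sc : 0 < shell_const 1 (1 - (p - 1)) :> R.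
  by apply: shell_const_gt0; rewrite gt_eqF// ltrBlDr ltrDl.
have C20 : 0 < C2 by rewrite mulr_gt0// powR_gt0.
have c30 : 0 < 2 * 3 ^+ n :> R by rewrite mulr_gt0// exprn_gt0.
exists (2 `^ p * (2 * 3 ^+ n * C2)).
  by apply: mulr_gt0; [exact: powR_gt0|exact: mulr_gt0].
move=> phi mphi phi0.
have mM := measurable_maximal phi.
have M0 x := maximal_ge0 x phi0.
apply: (@le_trans _ _ (\int[mu]_x ((2 `^ p)%:E * \int[leb]_lam A (maximal phi x) lam))%E).
  apply: ge0_le_integral_nm => x _; first exact: poweR_ge0.
  exact: layer_cake.
rewrite integral_scale; last 3 first.
- exact: powR_ge0.
- exact: (tonelli_measurable leb (measurable_A mM) (fun x lam => A0 (maximal phi x) lam)).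
- by move=> x; exact: integral_ge0.
rewrite EFinM -muleA; apply: lee_wpmul2l; first by rewrite lee_fin powR_ge0.
rewrite (tonelli_swap mu leb (f := fun x lam => A (maximal phi x) lam))//; last first.
  exact: measurable_A.
have mPB : measurable_fun [set: V * RR] (fun z => phi z.1 * B (phi z.1) z.2)%E.
  apply: emeasurable_funM; first exact: measurableT_comp.
  exact: measurable_B.
have PB0 x lam : (0 <= phi x * B (phi x) lam)%E by rewrite mule_ge0.
apply: (@le_trans _ _ (\int[leb]_lam ((2 * 3 ^+ n)%:E *
    \int[mu]_x (phi x * B (phi x) lam)))%E).
  apply: ge0_le_integral_nm => lam _; first by apply: integral_ge0 => x _; exact: A0.
  have [l0|l0] := ltP 0 lam; last first.
    rewrite integral0_eq; last by move=> x _; rewrite /A ltNge l0.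
    by rewrite mule_ge0 ?lee_fin ?(ltW c30)//; exact: integral_ge0.
  have mset : measurable [set x | (lam%:E < maximal phi x)%E].
    by rewrite -[X in measurable X]setTI; apply: emeasurable_fun_o_infty.
  have -> : (\int[mu]_x A (maximal phi x) lam =
      (lam `^ (p - 2))%:E * (lam%:E * mu [set x | (lam%:E < maximal phi x)%E]))%E.
    rewrite muleA -EFinM -integral_cst// integral_mkcond; apply: eq_integral => x _.
    rewrite patchE /A l0/=; case: ifPn => h.
      rewrite mem_set//=; congr EFin.
      by rewrite mulrC -(mulr_powRB1 (ltW l0) p10); congr (_ * _ `^ _); ring.
    by rewrite memNset//=; exact/negP.
  have -> : (\int[mu]_x (phi x * B (phi x) lam) = (lam `^ (p - 2))%:E *
     \int[mu]_x (if (lam%:E < 2%:E * phi x)%E then phi x else 0))%E.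
    rewrite -integral_scale ?powR_ge0//; last 2 first.
    - apply: measurable_fun_ifT => //; apply: measurable_fun_lte => //.
      exact: measurable_funeM.
    - by move=> x; case: ifP.
    apply: eq_integral => x _; rewrite /B l0/=; case: ifP => _; last by rewrite !mule0.
    by rewrite muleC.
  rewrite [leRHS]muleCA; apply: lee_wpmul2l; first by rewrite lee_fin powR_ge0.
  exact: maximal_weak_refined.
rewrite integral_scale ?(ltW c30)//; last 2 first.
- apply: (tonelli_measurable mu (f := fun lam x => phi x * B (phi x) lam)%E) => //.
  have := measurableT_comp mPB (measurable_fun_pair (@measurable_snd _ _ RR V)
    (@measurable_fst _ _ RR V)).
  by apply.
- by move=> lam; exact: integral_ge0.
rewrite (EFinM (2 * 3 ^+ n) C2) -[leRHS]muleA; apply: lee_wpmul2l.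
  by rewrite lee_fin (ltW c30).
rewrite -(tonelli_swap mu leb (f := fun x lam => phi x * B (phi x) lam)%E)//.
rewrite -integral_scale ?(ltW C20)//; last 2 first.
- exact: measurable_fun_poweR.
- by move=> x; exact: poweR_ge0.
apply: ge0_le_integral_nm => x _; first exact: integral_ge0.
rewrite ge0_integralZl//; last first.
  exact: (measurableT_comp (measurable_B mphi) (pair1_measurable x)).
exact: layer_upper.
Qed.

End maximal_strong.

(** * The fractional maximal majorant *)

Section cube_integrals.
Context {R : realType} (n : nat).
Local Notation V := 'rV[R]_n.
Local Notation mu := (lebesgue_rV n).
Hypothesis n0 : (0 < n)%N.
Local Notation D := (n%:R : R).

Lemma lebesgue_rV_set1 : mu [set 0 : V] = 0%E.
Proof.
have -> : [set 0 : V] = cube 0 0.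
  apply/seteqP; split => x; rewrite /cube/= sub0r normrN; first by move=> ->; rewrite normr0.
  by rewrite normr_le0 => /eqP.
by rewrite lebesgue_cube// mulr0 expr0n gtn_eqF.
Qed.

Lemma ae_rV_neq0 : {ae mu, forall x : V, x != 0}.
Proof.
exists [set 0 : V]; split; [|exact: lebesgue_rV_set1|].
  rewrite (_ : [set 0] = cube 0 0); first exact: measurable_cube.
  apply/seteqP; split => x; rewrite /cube/= sub0r normrN; first by move=> ->; rewrite normr0.
  by rewrite normr_le0 => /eqP.
by move=> x /= /negP; rewrite negbK => /eqP.
Qed.

(** The shell estimate for Lebesgue measure, with e = n and a = - b. The shells miss the origin,
    which is a null set. *)
Lemma integral_cube_powR (b : R) : - D < b -> exists2 C : R, 0 < C &
  forall d : R, 0 < d -> (\int[mu]_(x in cube 0%R d) (`|x| `^ b)%:E <= (C * d `^ (D + b))%:E)%E.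
Proof.
move=> bD; exists (shell_const D (- b) * 2 `^ D).
  rewrite mulr_gt0 ?powR_gt0// shell_const_gt0//.
  by rewrite -subr_eq0 opprK gt_eqF//; lra.
move=> d d0.
have hw (r : R) : 0 < r -> (\int[mu]_(x in [set x : V | `|x| <= r]%R) 1%E <= (2 `^ D * r `^ D)%:E)%E.
  move=> r0; rewrite (_ : [set x : V | `|x| <= r] = cube 0 r); last first.
    by apply/seteqP; split => x; rewrite /cube/= sub0r normrN.
  rewrite integral_cst ?mul1e; last exact: measurable_cube.
  rewrite [leLHS](_ : _ = ((2 * r) ^+ n)%:E); last exact: lebesgue_cube (ltW r0).
  by rewrite lee_fin -powRM ?(ltW r0)// powR_mulrn// mulr_ge0// ltW.
have bD' : - b < D by lra.
have := @shell_inner _ _ _ mu (fun x : V => `|x|) (fun=> 1%E) (@measurable_rV_norm R n)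
  (@measurable_cst _ _ _ _ _ _) (fun=> lee01) (2 `^ D) D (- b) d d0 bD' (powR_ge0 _ _) hw.
rewrite !opprK; apply: le_trans.
rewrite [leLHS]integral_mkcond [leRHS]integral_mkcond.
apply: ae_ge0_le_integral => //.
- by move=> x _; apply: erestrict_ge0 => y _; rewrite lee_fin powR_ge0.
- apply/(measurable_restrictT _ _).1; first exact: measurable_cube.
  apply/measurable_EFinP; apply: measurable_funTS.
  exact: (measurable_fun_powR b (@measurable_rV_norm R n)).
- by move=> x _; apply: erestrict_ge0 => y _; rewrite mul1e lee_fin powR_ge0.
- apply/(measurable_restrictT _ _).1.
    have := @measurable_rV_norm R n measurableT _ (measurable_itv `]0, d]); rewrite setTI.
    by congr measurable; apply/seteqP; split => x /=; rewrite in_itv.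
  apply: measurable_funTS; under eq_fun do rewrite mul1e.
  apply/measurable_EFinP; exact: (measurable_fun_powR b (@measurable_rV_norm R n)).
apply: filterS (ae_rV_neq0) => x xN _.
rewrite !patchE; case: ifPn => [/set_mem|_]; last first.
  by case: ifP => // _; rewrite mul1e lee_fin powR_ge0.
rewrite /cube/= sub0r normrN => h; rewrite mem_set ?mul1e//=.
by rewrite normr_gt0 xN.
Qed.

Lemma hoelder_set (Q : set V) (F G : V -> R) (p : R) : measurable Q -> 1 < p ->
  measurable_fun [set: V] F -> measurable_fun [set: V] G ->
  (forall x, 0 <= F x) -> (forall x, 0 <= G x) ->
  (\int[mu]_(x in Q) (F x * G x)%:E <=
   (\int[mu]_(x in Q) (F x `^ (p / (p - 1)))%:E) `^ (1 - p^-1) *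
   (\int[mu]_(x in Q) (G x `^ p)%:E) `^ p^-1)%E.
Proof.
move=> mQ p1 mF mG F0 G0.
have p0 : 0 < p by exact: lt_trans p1.
have pp0 : 0 < p - 1 by rewrite subr_gt0.
pose p' := p / (p - 1).
have p'0 : 0 < p' by rewrite divr_gt0.
have p'V : p'^-1 = 1 - p^-1 by rewrite /p' invf_div; field; rewrite gt_eqF.
have pq : p'^-1 + p^-1 = 1 by rewrite p'V subrK.
pose i (x : V) : R := \1_Q x.
have mi : measurable_fun [set: V] i by exact: measurable_indic.
have i0 x : 0 <= i x by rewrite /i indicE.
have := hoelder mu (measurable_funM mF mi) (measurable_funM mG mi) p'0 p0 pq.
have iE (h : V -> R) (r : R) : r != 0 -> (forall x, 0 <= h x) ->
    (\int[mu]_x (`|(h x * i x)%:E| `^ r) = \int[mu]_(x in Q) (h x `^ r)%:E)%E.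
  move=> r0 h0; rewrite [RHS]integral_mkcond; apply: eq_integral => x _.
  rewrite patchE /i indicE; case: ifP => _.
    by rewrite /= mulr1 ger0_norm.
  by rewrite /= mulr0 normr0 powR0.
rewrite Lnorm1 unlock /= !iE ?gt_eqF// p'V; apply: le_trans.
rewrite [leLHS]integral_mkcond; apply: ge0_le_integral_nm => x _.
  by apply: erestrict_ge0 => y _; rewrite lee_fin mulr_ge0.
rewrite patchE /i indicE; case: ifP => _; last by rewrite lee_fin normr_ge0.
by rewrite !mulr1 ger0_norm// mulr_ge0.
Qed.

End cube_integrals.

Section ereal_prelim.
Context {R : realType}.

Lemma powR_expR (x a : R) : 0 < x -> x `^ a = expR (a * ln x).
Proof. by move=> x0; rewrite /powR gt_eqF. Qed.

Lemma le_poweR (x y : \bar R) (r : R) : 0 <= r -> (0 <= x -> x <= y -> x `^ r <= y `^ r)%E.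
Proof.
move=> r0 x0 xy; have y0 := le_trans x0 xy.
by apply: gt0_ler_poweR => //; rewrite in_itv/= leey ?x0 ?y0.
Qed.

(** Write b as b^t b^(1 - t) and bound each factor by one of the two majorants. *)
Lemma interp_poweR (b Y t : R) (X : \bar R) : 0 < t -> t <= 1 -> 0 <= b -> 0 <= Y ->
  (b%:E <= X)%E -> b <= Y -> (b%:E <= X `^ t * (Y `^ (1 - t))%:E)%E.
Proof.
move=> t0 t1 b0 Y0 bX bY; have [->|bN] := eqVneq b 0.
  by rewrite mule_ge0 ?poweR_ge0// lee_fin powR_ge0.
have {bN}b0 : 0 < b by rewrite lt_neqAle eq_sym bN.
have Yp : 0 < Y by rewrite (lt_le_trans b0).
case: X bX => [x| |//]; last first.
  by move=> _; rewrite poweRyr ?gt_eqF// gt0_mulye ?leey// lte_fin powR_gt0.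
rewrite poweR_EFin -EFinM !lee_fin => bx.
rewrite -[leLHS]powRr1 ?(ltW b0)// -[in leLHS](subrKC t 1) powRD; last first.
  by apply/implyP => _; rewrite gt_eqF.
apply: ler_pM; rewrite ?powR_ge0//; apply: le_powR => //; rewrite ?subr_ge0 ?(ltW b0) ?(ltW t0)//.
Qed.

Lemma integral_ge_cst d (T : measurableType d) (mu : {measure set T -> \bar R})
    (E : set T) (c : \bar R) (h : T -> \bar R) : measurable E -> (0 <= c)%E ->
  (forall x, E x -> c <= h x)%E -> (c * mu E <= \int[mu]_(x in E) h x)%E.
Proof. by move=> mE c0 ch; rewrite -integral_cst//; apply: ge0_le_integral_nm. Qed.

Lemma integral_scale_set d (T : measurableType d) (mu : {measure set T -> \bar R})
    (E : set T) (k : R) (h : T -> \bar R) : 0 <= k -> measurable E ->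
  measurable_fun [set: T] h -> (forall x, 0 <= h x)%E ->
  (\int[mu]_(x in E) (k%:E * h x) = k%:E * \int[mu]_(x in E) h x)%E.
Proof.
by move=> k0 mE mh h0; rewrite ge0_integralZl//; exact: measurable_funTS.
Qed.

End ereal_prelim.

Lemma dyad_le2 {R : realType} (k k' : int) : k < k' -> 2 * dyad k <= dyad k' :> R.
Proof. by move=> kk'; rewrite -dyadS ler_weXz2l ?ler1n// lezD1. Qed.

Section fractional_maximal.
Context {R : realType} (n : nat).
Local Notation V := 'rV[R]_n.
Local Notation mu := (lebesgue_rV n).
Local Notation D := (n%:R : R).
Variables (p q alpha gam sigma : R).
Hypotheses (n0 : (0 < n)%N) (p1 : 1 < p) (pq : p <= q) (ga : gam <= alpha)
  (alphaD : alpha < D - D / p) (gamD : 0 < gam + D / q)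
  (scal : gam + D / q = alpha + D / p - sigma).

Let D0 : 0 < D. Proof. by rewrite ltr0n. Qed.
Let p0 : 0 < p. Proof. exact: lt_trans p1. Qed.
Let q0 : 0 < q. Proof. exact: lt_le_trans pq. Qed.

(** Hoelder's inequality will be applied to |x|^alpha f with exponent 1/t. Then alpha < D (1 - t)
    makes the dual weight |x|^(- alpha / (1 - t)) locally integrable, and t > 1/p leaves room for
    the maximal theorem in L^(t p). That 1/p lies below 1 - alpha / D is the hypothesis alpha < D -
    D/p. *)
Lemma exists_interior_exponent : exists t, [/\ p^-1 < t, t < 1 & alpha < D * (1 - t)].
Proof.
pose u := Num.min 1 (1 - alpha / D).
have hu : p^-1 < u.
  rewrite lt_min; apply/andP; split; first by rewrite invf_lt1.
  rewrite -subr_gt0 (_ : _ - _ = (D - D / p - alpha) / D); last by field; rewrite !gt_eqF.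
  by rewrite divr_gt0// subr_gt0.
have [u1 u2] : u <= 1 /\ u <= 1 - alpha / D.
  by split; rewrite ge_min lexx// orbT.
exists ((p^-1 + u) / 2); split; [lra|lra|].
rewrite mulrC -ltr_pdivrMr//; lra.
Qed.

Variables (t : R) (pt : p^-1 < t) (t1 : t < 1) (alphat : alpha < D * (1 - t)).

Let t0 : 0 < t. Proof. by rewrite (lt_trans _ pt)// invr_gt0. Qed.

Lemma dual_weight_bound : exists2 C : R, 0 < C & forall d : R, 0 < d ->
  (\int[mu]_(x in cube 0%R d) ((`|x| `^ (- alpha)) `^ (1 - t)^-1)%:E <=
   (C * d `^ (D - alpha / (1 - t)))%:E)%E.
Proof.
have ti : 0 < 1 - t by rewrite subr_gt0.
have h : - D < - (alpha / (1 - t)) by rewrite ltrN2 ltr_pdivrMr.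
have [C C0 hC] := integral_cube_powR n0 h.
exists C; first exact: C0.
move=> d d0; apply: le_trans (hC d d0).
rewrite le_eqVlt; apply/orP; left; apply/eqP; apply: eq_integral => x _.
by rewrite -powRrM mulNr.
Qed.

Variables (Cf Cg : R) (Cf0 : 0 < Cf) (Cg0 : 0 < Cg).
Hypothesis hCf : forall d : R, 0 < d ->
  (\int[mu]_(x in cube 0%R d) ((`|x| `^ (- alpha)) `^ (1 - t)^-1)%:E <=
   (Cf * d `^ (D - alpha / (1 - t)))%:E)%E.
Hypothesis hCg : forall d : R, 0 < d ->
  (\int[mu]_(x in cube 0%R d) (`|x| `^ (gam * q))%:E <= (Cg * d `^ (D + gam * q))%:E)%E.

Section fixed_function.
Variable f : V -> R.
Hypothesis mf : measurable_fun [set: V] f.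

Let g (x : V) : R := `|x| `^ alpha * `|f x|.
Let phi (x : V) : \bar R := (g x `^ t^-1)%:E.
(** It controls the averages of g^(1/t), as Hoelder's inequality against a weight requires, and its
    L^p norm is still bounded by that of g because t p > 1. *)
Let m (x : V) : \bar R := (maximal phi x `^ t)%E.

Let g0 x : 0 <= g x. Proof. by rewrite mulr_ge0// powR_ge0. Qed.
Let mg : measurable_fun [set: V] g.
Proof.
apply: measurable_funM; first exact: measurable_fun_powR (@measurable_rV_norm R n).
exact: measurableT_comp.
Qed.
Let phi0 x : (0 <= phi x)%E. Proof. by rewrite lee_fin powR_ge0. Qed.
Let mphi : measurable_fun [set: V] phi.
Proof. by apply/measurable_EFinP; exact: measurable_fun_powR. Qed.
Let m0 x : (0 <= m x)%E. Proof. exact: poweR_ge0. Qed.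
Let mm : measurable_fun [set: V] m.
Proof. by apply: measurable_fun_poweR; exact: measurable_maximal. Qed.

Let cube_phi c z (rho : R) : 0 < rho -> `|c - z| <= rho ->
  ((\int[mu]_(y in cube c rho) phi y) `^ t <= ((16 `^ D * rho `^ D) `^ t)%:E * m z)%E.
Proof.
move=> rho0 cz.
have rho20 : 0 < 2 * rho by lra.
(* The cube lies in the one of centre z and radius 2 rho, and 8 (2 rho) = 16 rho. *)
have h : (\int[mu]_(y in cube c rho) phi y <= (16 `^ D * rho `^ D)%:E * maximal phi z)%E.
  apply: (@le_trans _ _ (\int[mu]_(y in cube z (2 * rho)) phi y)%E).
    apply: ge0_subset_integral => //; try exact: measurable_cube.
    - exact: measurable_funTS.
    - by apply: cube_sub; rewrite distrC; lra.
  apply: (le_trans (cube_le_maximal z mphi phi0 rho20)).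
  apply: lee_wpmul2r; first exact: maximal_ge0.
  rewrite lee_fin -powRM ?(ltW rho0)// powR_mulrn ?mulr_ge0 ?(ltW rho0)//.
  by rewrite (_ : 8 * (2 * rho) = 16 * rho)//; ring.
rewrite -poweR_EFin -poweRM; last 2 first.
- by rewrite lee_fin mulr_ge0 ?powR_ge0.
- exact: maximal_ge0.
by apply: le_poweR => //; [exact: ltW|exact: integral_ge0].
Qed.

(** F is the weight set against g: 1 for cubes away from the origin, |x|^(- alpha) for cubes centred
    at it. *)
Let hoelder_cube c z (rho W : R) (F : V -> R) : 0 < rho -> `|c - z| <= rho ->
  measurable_fun [set: V] F -> (forall x, 0 <= F x) -> 0 <= W ->
  (\int[mu]_(x in cube c rho) (F x `^ (1 - t)^-1)%:E <= W%:E)%E ->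
  (\int[mu]_(x in cube c rho) (F x * g x)%:E <=
    (W `^ (1 - t) * (16 `^ D * rho `^ D) `^ t)%:E * m z)%E.
Proof.
move=> rho0 cz mF F0 W0 hW.
have ti1 : 1 < t^-1 by rewrite invf_gt1.
apply: (le_trans (hoelder_set (measurable_cube c rho) ti1 mF mg F0 g0)).
have -> : t^-1 / (t^-1 - 1) = (1 - t)^-1.
  by field; rewrite !gt_eqF// subr_gt0.
rewrite invrK EFinM -muleA; apply: lee_pmul => //.
- exact: poweR_ge0.
- exact: poweR_ge0.
- rewrite -poweR_EFin; apply: le_poweR => //; first by rewrite subr_ge0 ltW.
  by apply: integral_ge0 => x _; rewrite lee_fin powR_ge0.
- exact: cube_phi.
Qed.

Let K1 : R := 16 `^ D.
Let K10 : 0 < K1. Proof. exact: powR_gt0. Qed.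

Let near_avg c z (rho : R) : 0 < rho -> `|c - z| <= rho ->
  (\int[mu]_(x in cube c rho) (g x)%:E <= (K1 * rho `^ D)%:E * m z)%E.
Proof.
move=> rho0 cz.
have := @hoelder_cube c z rho ((2 * rho) `^ D) (cst 1) rho0 cz.
move=> /(_ (measurable_cst _) (fun=> ler01) (powR_ge0 _ _)).
under eq_integral do rewrite /= powR1.
rewrite integral_cst ?mul1e; last exact: measurable_cube.
have -> : (\int[mu]_(x in cube c rho) (cst 1 x * g x)%:E =
   \int[mu]_(x in cube c rho) (g x)%:E)%E by apply: eq_integral => x _; rewrite mul1r.
move=> h; apply: le_trans (h _) _.
  rewrite [leLHS](_ : _ = ((2 * rho) ^+ n)%:E); last exact: lebesgue_cube (ltW rho0).
  by rewrite lee_fin powR_mulrn// mulr_ge0// ltW.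
apply: lee_wpmul2r => //; rewrite lee_fin /K1 !powRM ?powR_ge0 ?(ltW rho0)//.
have le16 : (2 `^ D) `^ (1 - t) * (16 `^ D) `^ t <= 16 `^ D :> R.
  apply: (@le_trans _ _ ((16 `^ D) `^ (1 - t) * (16 `^ D) `^ t)).
    apply: ler_wpM2r; first exact: powR_ge0.
    apply: le_powR; [by rewrite subr_ge0 ltW|exact: powR_ge0|].
    by apply: le_powR; [exact: ltW|lra|lra].
  by rewrite -powRD ?subrK ?powRr1 ?powR_ge0// oner_eq0.
have rE : (rho `^ D) `^ (1 - t) * (rho `^ D) `^ t = rho `^ D.
  by rewrite -powRD ?subrK ?powRr1 ?powR_ge0// oner_eq0.
rewrite -[in leRHS]rE.
set a := _ `^ (1 - t) in le16 *; set b := (16 `^ D) `^ t in le16 *.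
set u := (rho `^ D) `^ (1 - t); set v := (rho `^ D) `^ t.
have uv : 0 <= u * v by rewrite mulr_ge0 ?powR_ge0.
have -> : a * u * (b * v) = (a * b) * (u * v) by ring.
exact: ler_wpM2r.
Qed.

Let ae_fE (x : V) : x != 0 -> `|f x| = `|x| `^ (- alpha) * g x.
Proof.
move=> xN; rewrite /g mulrA -powRD; last by rewrite normr_eq0 xN implybT.
by rewrite addNr powRr0 mul1r.
Qed.

Let measurable_rV_powR (b : R) : measurable_fun [set: V] (fun x : V => `|x| `^ b).
Proof. exact: (measurable_fun_powR b (@measurable_rV_norm R n)). Qed.

Let far_avg z (d : R) : 0 < d -> `|z| <= d ->
  (\int[mu]_(x in cube 0%R d) (`|f x|)%:E <=
   (Cf `^ (1 - t) * (16 `^ D) `^ t * d `^ (D - alpha))%:E * m z)%E.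
Proof.
move=> d0 zd.
have zd' : `|0 - z| <= d by rewrite sub0r normrN.
have := hoelder_cube d0 zd' (measurable_rV_powR (- alpha)) (fun=> powR_ge0 _ _) _ (hCf d0).
move=> /(_ (mulr_ge0 (ltW Cf0) (powR_ge0 _ _))) h.
apply: (@le_trans _ _ (\int[mu]_(x in cube 0%R d) (`|x| `^ (- alpha) * g x)%:E)%E).
  rewrite [leLHS]integral_mkcond [leRHS]integral_mkcond.
  apply: ge0_ae_le_integral_nm => [x|x||].
  - by apply: erestrict_ge0 => y _; rewrite lee_fin.
  - by apply: erestrict_ge0 => y _; rewrite lee_fin mulr_ge0// powR_ge0.
  - apply/(measurable_restrictT _ _).1; first exact: measurable_cube.
    apply: measurable_funTS; apply/measurable_EFinP.
    by apply: measurable_funM => //; exact: measurable_rV_powR.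
  - apply: filterS (ae_rV_neq0 n0) => x xN.
    by rewrite !patchE; case: ifP => // _; rewrite -ae_fE.
apply: (le_trans h); rewrite le_eqVlt; apply/orP; left; apply/eqP; congr (_%:E * _)%E.
rewrite powRM ?powR_ge0 ?(ltW Cf0)// powRM ?powR_ge0//.
have t1N : 1 - t != 0 by rewrite gt_eqF// subr_gt0.
rewrite !powR_expR ?expR_gt0 ?powR_gt0// ?expRK.
by rewrite -!expRD; congr expR; field.
Qed.

Variable S0 : R.
Hypotheses (S00 : 0 <= S0) (hS : (\int[mu]_x (m x `^ p) <= S0%:E)%E).

(** A bound by m at every point of E is raised to the power p and integrated over E; this trades a
    pointwise value of m for its L^p norm. *)
Let avg_Lp (b : \bar R) (k mE : R) (E : set V) : measurable E -> mu E = mE%:E -> 0 < mE ->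
  0 <= k -> (0 <= b)%E -> (forall z, E z -> b <= k%:E * m z)%E ->
  (b `^ p * mE%:E <= (k `^ p)%:E * \int[mu]_(z in E) (m z `^ p))%E.
Proof.
move=> mmE muE mE0 k0 b0 h; rewrite -muE.
have mmp : measurable_fun [set: V] (fun z => m z `^ p)%E by exact: measurable_fun_poweR.
rewrite -(integral_scale_set mu (powR_ge0 k p) mmE mmp) => [|z]; last exact: poweR_ge0.
apply: integral_ge_cst => //; first exact: poweR_ge0.
move=> z Ez; rewrite -poweR_EFin -poweRM ?lee_fin//.
by apply: le_poweR => //; [exact: ltW|exact: h].
Qed.

Let avg_fin (b : \bar R) (k mE : R) (E : set V) : measurable E -> mu E = mE%:E -> 0 < mE ->
  0 <= k -> (0 <= b)%E -> (forall z, E z -> b <= k%:E * m z)%E ->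
  b \is a fin_num /\ fine b `^ p * mE <= k `^ p * S0.
Proof.
move=> mmE muE mE0 k0 b0 h.
have hI : (\int[mu]_(z in E) (m z `^ p) <= S0%:E)%E.
  apply: le_trans hS; apply: ge0_subset_integral => //.
  - exact: measurable_fun_poweR.
  - by move=> z _; exact: poweR_ge0.
have hb : (b `^ p * mE%:E <= (k `^ p * S0)%:E)%E.
  apply: (le_trans (avg_Lp mmE muE mE0 k0 b0 h)); rewrite EFinM.
  by apply: lee_wpmul2l => //; rewrite lee_fin powR_ge0.
have bfin : b \is a fin_num.
  rewrite ge0_fin_numE//; apply: (@lty_poweRy _ _ p); first by rewrite gt_eqF.
  apply: contraTT hb; rewrite -leNgt leye_eq => /eqP ->.
  by rewrite gt0_mulye ?lte_fin// -ltNge ltry.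
split => //; move: hb; rewrite -[in X in (X `^ _)%E](fineK bfin) poweR_EFin -EFinM.
by rewrite lee_fin.
Qed.

(** Hedberg's argument: since rho <= |x| / 2 the weight |y|^alpha is comparable to |x|^alpha on the
    cube, and the integral of g is bounded both through m x and through the L^p norm of m.
    Interpolating the two with weight p / q leaves rho^(D - sigma) rho^(alpha - gam), and gam <=
    alpha allows |x| in place of rho in the last factor. *)
Let near_bound (K2 : R) : 0 < K2 ->
  (forall c z (rho : R), 0 < rho -> `|c - z| <= rho ->
    (\int[mu]_(x in cube c rho) (g x)%:E <= (K2 * rho `^ D)%:E * m z)%E) ->
  forall x (rho : R), x != 0 -> 0 < rho -> rho <= `|x| / 2 ->
  (\int[mu]_(y in cube x rho) `|f y|%:E <=
   (2 `^ `|alpha| * K2 * `|x| `^ (- gam) * S0 `^ (p^-1 - q^-1))%:E * m x `^ (p / q) * (rho `^ (D - sigma))%:E)%E.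
Proof.
move=> K20 hK2 x rho xN rho0 rx.
have x0 : 0 < `|x| by rewrite normr_gt0.
have rx1 : rho <= `|x| by lra.
have mcube := measurable_cube x rho.
have le1 : (\int[mu]_(y in cube x rho) `|f y|%:E <=
   (2 `^ `|alpha| * `|x| `^ (- alpha))%:E * \int[mu]_(y in cube x rho) (g y)%:E)%E.
  have c0 : 0 <= 2 `^ `|alpha| * `|x| `^ (- alpha) by rewrite mulr_ge0 ?powR_ge0.
  rewrite -(integral_scale_set mu c0 mcube (h := EFin \o g)); last 2 first.
  - exact/measurable_EFinP.
  - by move=> y; rewrite lee_fin.
  apply: ge0_le_integral_nm => [y _|y]; first by rewrite lee_fin.
  rewrite /cube/= => yx.
  have h1 : `|x| <= `|y| + rho by rewrite -(subrK y x) addrC (le_trans (ler_normD _ _))// lerD2l.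
  have h2 : `|y| <= `|x| + rho.
    by rewrite -(subrK x y) addrC (le_trans (ler_normD _ _))// lerD2l distrC.
  have y0 : 0 < `|y| by lra.
  rewrite ae_fE -?normr_gt0// -EFinM lee_fin; apply: ler_wpM2r => //.
  rewrite -[in leRHS](normrN alpha); apply: powR_comparable => //; lra.
set b := (\int[mu]_(y in cube x rho) (g y)%:E)%E in le1.
have b0 : (0 <= b)%E by apply: integral_ge0 => y _; rewrite lee_fin.
have Kr0 : 0 < K2 * rho `^ D by rewrite mulr_gt0// powR_gt0.
have rho20 : 0 < (2 * rho) ^+ n by rewrite exprn_gt0//; lra.
have bm z : cube x rho z -> (b <= (K2 * rho `^ D)%:E * m z)%E by exact: hK2.
have [bfin hb] := avg_fin mcube (lebesgue_cube x (ltW rho0)) rho20 (ltW Kr0) b0 bm.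
(* The bound that comes from the L^p norm of m over the cube, without its value at x. *)
pose Y : R := K2 * rho `^ (D - D / p) * S0 `^ p^-1.
have Y0 : 0 <= Y by rewrite !mulr_ge0 ?powR_ge0 ?(ltW K20).
have bE : b = (fine b)%:E by rewrite fineK.
have fb0 : 0 <= fine b by exact: fine_ge0.
have bY : fine b <= Y.
  rewrite -(powRr1 fb0) -(mulfV (_ : p != 0)) ?gt_eqF// powRrM.
  have rD : rho `^ D <= (2 * rho) ^+ n.
    rewrite -powR_mulrn; last by lra.
    by apply: le_powR; [exact: ltW|lra|lra].
  have h : fine b `^ p <= (K2 * rho `^ D) `^ p * S0 * rho `^ (- D).
    rewrite powRN ler_pdivlMr ?powR_gt0//; apply: le_trans hb.
    by apply: ler_wpM2l => //; exact: powR_ge0.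
  apply: (le_trans (le_powR _ _ h)); [by rewrite invr_ge0 ltW|exact: powR_ge0|].
  rewrite !powRM ?mulr_ge0 ?powR_ge0 ?(ltW K20)// -!powRrM mulfV ?gt_eqF// powRr1 ?(ltW K20)//.
  rewrite le_eqVlt; apply/orP; left; apply/eqP; rewrite /Y.
  have -> : rho `^ (D - D / p) = rho `^ (D * 1) * rho `^ (- D / p).
    by rewrite -powRD ?(gt_eqF rho0) ?implybT//; congr (_ `^ _); field; rewrite gt_eqF.
  ring.
have pq0 : 0 < p / q by rewrite divr_gt0.
have pq1 : p / q <= 1 by rewrite ler_pdivrMr// mul1r.
have := interp_poweR pq0 pq1 fb0 Y0 _ bY.
rewrite -bE => /(_ _ (bm x _)); rewrite /cube/= subrr normr0 (ltW rho0) => /(_ isT) hb2.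
apply: (le_trans le1).
apply: (le_trans (lee_wpmul2l _ hb2)); first by rewrite lee_fin mulr_ge0 ?powR_ge0.
rewrite poweRM ?lee_fin ?(ltW Kr0)// poweR_EFin.
set M := (m x `^ (p / q))%E.
have M0 : (0 <= M)%E by exact: poweR_ge0.
rewrite [X in (_ * X <= _)%E](_ : _ = (((K2 * rho `^ D) `^ (p / q) * Y `^ (1 - p / q))%:E * M)%E); last first.
  by rewrite muleAC -EFinM.
rewrite muleA -EFinM [leRHS]muleAC -EFinM; apply: lee_wpmul2r => //.
rewrite lee_fin /Y.
rewrite !powRM ?mulr_ge0 ?powR_ge0 ?(ltW K20)//.
have -> : (S0 `^ p^-1) `^ (1 - p / q) = S0 `^ (p^-1 - q^-1).
  by rewrite -powRrM; congr (_ `^ _); field; rewrite !gt_eqF.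
set s := S0 `^ _; have s0 : 0 <= s by exact: powR_ge0.
have KE : K2 `^ (p / q) * K2 `^ (1 - p / q) = K2.
  by rewrite -powRD ?(gt_eqF K20) ?implybT// subrKC powRr1 ?(ltW K20).
(* The interpolated exponent is D - D/p + D/q, which the scaling relation identifies. *)
have rE : (rho `^ D) `^ (p / q) * (rho `^ (D - D / p)) `^ (1 - p / q) =
          rho `^ (D - sigma) * rho `^ (alpha - gam).
  rewrite !powR_expR ?expR_gt0 ?powR_gt0// ?expRK -!expRD; congr expR.
  have -> : sigma = alpha + D / p - gam - D / q by move: scal; lra.
  by field; rewrite !gt_eqF.
have xE : `|x| `^ (- gam) = `|x| `^ (- alpha) * `|x| `^ (alpha - gam).
  by rewrite -powRD ?(gt_eqF x0) ?implybT//; congr (_ `^ _); ring.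
have rx' : rho `^ (alpha - gam) <= `|x| `^ (alpha - gam).
  by apply: le_powR; [rewrite subr_ge0; exact: ga|exact: ltW|exact: rx1].
rewrite xE.
set A := 2 `^ _; set a := `|x| `^ (- alpha); set r1 := rho `^ (D - sigma) in rE *.
have ringE (c1 c2 k1 k2 y1 y2 y3 : R) :
  c1 * c2 * (k1 * y1 * (k2 * y2 * y3)) = c1 * c2 * (k1 * k2) * (y1 * y2) * y3 by ring.
rewrite ringE KE rE.
have cst0 : 0 <= A * a * K2 * r1 * s by rewrite !mulr_ge0 ?powR_ge0 ?(ltW K20).
have ringE1 (c1 c2 k y1 y2 y3 : R) : c1 * c2 * k * (y1 * y2) * y3 = c1 * c2 * k * y1 * y3 * y2 by ring.
have ringE2 (c1 c2 k y1 y2 y3 : R) : c1 * k * (c2 * y2) * y3 * y1 = c1 * c2 * k * y1 * y3 * y2 by ring.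
rewrite ringE1 ringE2.
exact: ler_wpM2l.
Qed.

(* Scales below |x|/2 are controlled by the maximal function at x itself; the
   larger ones do not see x, and are dominated by the sum over all dyadic scales
   (indexed by nat through the enumeration of int). *)
Let scale (i : nat) : option R := omap dyad (@pickle_inv int i).

Let far_mass (d : R) : R := fine (\int[mu]_(x in cube 0%R d) (`|f x|)%:E)%E.

(** The q-th power of what the majorant must reach on the cube of radius d. A sum over the scales
    dominates their supremum, and its weighted integral can be taken scale by scale. *)
Let far_term (i : nat) (x : V) : \bar R :=
  if scale i is Some d then
    ((d `^ (sigma - D) * far_mass d) `^ q * \1_(cube 0 d) x)%:E else 0%E.

Let scale_gt0 i d : scale i = Some d -> 0 < d.
Proof. by rewrite /scale; case: pickle_inv => //= k [<-]; exact: dyad_gt0. Qed.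

Let far_term0 i x : (0 <= far_term i x)%E.
Proof.
rewrite /far_term; case: scale => // d.
by rewrite lee_fin mulr_ge0// ?powR_ge0// indicE.
Qed.

Let measurable_far_term i : measurable_fun [set: V] (far_term i).
Proof.
rewrite /far_term; case: scale => [d|//].
apply/measurable_EFinP; apply: measurable_funM => //.
by apply: measurable_indic; exact: measurable_cube.
Qed.

(** A test cube inside the cube of centre 0 and radius d, of measure comparable to d^n. Its
    coordinates lie between 5 d / 8 and 7 d / 8, so the test cubes of distinct dyadic d are
    disjoint. *)
Let far_set (d : R) : set V := cube (const_mx (3 / 4 * d)) (d / 8).

Let far_set_coord (d : R) (z : V) : 0 < d -> far_set d z ->
  5 / 8 * d <= z ord0 (Ordinal n0) <= 7 / 8 * d.
Proof.
move=> d0; rewrite /far_set/cube/= => h.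
have := le_trans (rV_norm_coord _ (Ordinal n0)) h.
rewrite !mxE ler_norml => /andP[h1 h2]; apply/andP; split; lra.
Qed.

Let far_set_norm (d : R) (z : V) : 0 < d -> far_set d z -> `|z| <= d.
Proof.
move=> d0; rewrite /far_set/cube/= => h; apply/rV_norm_le; first exact: ltW.
move=> i; have := le_trans (rV_norm_coord _ i) h.
rewrite !mxE ler_norml => /andP[h1 h2]; rewrite ler_norml; apply/andP; split; lra.
Qed.

Let lebesgue_far_set (d : R) : 0 < d -> mu (far_set d) = ((d / 4) ^+ n)%:E.
Proof.
move=> d0; rewrite /far_set lebesgue_cube; last by lra.
by congr (_ ^+ _)%:E; field.
Qed.

(** The mass is bounded through m at every point of the test cube, hence by an L^p average of m over
    it. The power of d in front of the mass is the one that leaves no d on the right. *)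
Let far_mass_bound (K : R) : 0 < K ->
  (forall z (d : R), 0 < d -> `|z| <= d ->
    (\int[mu]_(x in cube 0%R d) (`|f x|)%:E <= (K * d `^ (D - alpha))%:E * m z)%E) ->
  forall d : R, 0 < d ->
  (\int[mu]_(x in cube 0%R d) (`|f x|)%:E)%E \is a fin_num /\
  (((d `^ (alpha - D + D / p) * far_mass d) `^ p)%:E <=
   (4 `^ D * K `^ p)%:E * \int[mu]_(z in far_set d) (m z `^ p))%E.
Proof.
move=> K0 hK d d0.
have mE : measurable (far_set d) by exact: measurable_cube.
have mE0 : 0 < (d / 4) ^+ n by rewrite exprn_gt0//; lra.
have k0 : 0 <= K * d `^ (D - alpha) by rewrite mulr_ge0 ?powR_ge0 ?(ltW K0).
have b0 : (0 <= \int[mu]_(x in cube 0%R d) (`|f x|)%:E)%E.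
  by apply: integral_ge0 => x _; rewrite lee_fin.
have hb z : far_set d z ->
    (\int[mu]_(x in cube 0%R d) (`|f x|)%:E <= (K * d `^ (D - alpha))%:E * m z)%E.
  by move=> zd; apply: hK => //; exact: far_set_norm.
have [bfin _] := avg_fin mE (lebesgue_far_set d0) mE0 k0 b0 hb.
split => //; have := avg_Lp mE (lebesgue_far_set d0) mE0 k0 b0 hb.
rewrite -[in X in (X `^ p)%E](fineK bfin) -/(far_mass d) poweR_EFin -EFinM => h.
have fm0 : 0 <= far_mass d by exact: fine_ge0.
set I := integral _ _ _ in h *.
have I0 : (0 <= I)%E by apply: integral_ge0 => z _; exact: poweR_ge0.
set e := d `^ ((alpha - D) * p).
have e0 : 0 < e by exact: powR_gt0.
have c0 : 0 < 4 `^ D * e by rewrite mulr_gt0 ?powR_gt0.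
have := lee_wpmul2l (_ : (0 <= (4 `^ D * e)%:E)%E) h; rewrite lee_fin (ltW c0) => /(_ isT).
rewrite muleA -!EFinM.
have -> : 4 `^ D * e * (far_mass d `^ p * (d / 4) ^+ n) =
    (d `^ (alpha - D + D / p) * far_mass d) `^ p.
  have d40 : 0 < d / 4 by lra.
  rewrite powRM ?powR_ge0// -powR_mulrn ?(ltW d40)//.
  rewrite [4 `^ D * e * _]mulrCA mulrC; congr (_ * _).
  have -> : d `^ (alpha - D + D / p) `^ p = e * d `^ D.
    rewrite -powRrM -powRD ?(gt_eqF d0) ?implybT//; congr (_ `^ _).
    by field; rewrite gt_eqF.
  have -> : d `^ D = 4 `^ D * (d / 4) `^ D.
    by rewrite -powRM ?(ltW d40)//; congr (_ `^ _); field.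
  by rewrite [RHS]mulrCA mulrA.
have -> // : 4 `^ D * e * (K * d `^ (D - alpha)) `^ p = 4 `^ D * K `^ p.
rewrite powRM ?powR_ge0 ?(ltW K0)// -powRrM -mulrA; congr (_ * _).
rewrite mulrCA -[RHS]mulr1; congr (_ * _).
by rewrite -powRD ?(gt_eqF d0) ?implybT// (_ : _ + _ = 0) ?powRr0//; ring.
Qed.

Let Kn : R := 2 `^ `|alpha| * K1.
Let Kf : R := 4 `^ D * (Cf `^ (1 - t) * (16 `^ D) `^ t) `^ p.
(** In [N_cube] the dyadic radius satisfies 3 rho <= d < 6 rho; this constant pays for exchanging d
    and rho in a power whose exponent D - sigma may have either sign. *)
Let c6 : R := 6 `^ `|D - sigma|.

Let Kn0 : 0 < Kn. Proof. by rewrite mulr_gt0// powR_gt0. Qed.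
Let c60 : 0 < c6. Proof. exact: powR_gt0. Qed.
Let c16 : 0 < Cf `^ (1 - t) * (16 `^ D) `^ t.
Proof. by rewrite mulr_gt0 ?powR_gt0. Qed.
Let Kf0 : 0 < Kf. Proof. by apply: mulr_gt0; apply: powR_gt0. Qed.

Let near (x : V) : \bar R :=
  ((Kn * `|x| `^ (- gam) * S0 `^ (p^-1 - q^-1))%:E * m x `^ (p / q))%E.
Let far (x : V) : \bar R := (c6%:E * (\sum_(i <oo) far_term i x) `^ q^-1)%E.
Let N (x : V) : \bar R := maxe (near x) (far x).

Let far_sum0 x : (0 <= \sum_(i <oo) far_term i x)%E.
Proof. by apply: nneseries_ge0 => i _ _; exact: far_term0. Qed.

Let near0 x : (0 <= near x)%E.
Proof.
by rewrite mule_ge0 ?poweR_ge0// lee_fin !mulr_ge0 ?powR_ge0 ?(ltW Kn0).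
Qed.

Let mfar_sum : measurable_fun [set: V] (fun x => \sum_(i <oo) far_term i x)%E.
Proof. by apply: ge0_emeasurable_sum => // i x _ _; exact: far_term0. Qed.

Let mN : measurable_fun [set: V] N.
Proof.
apply: measurable_maxe.
- apply: emeasurable_funM; last exact: measurable_fun_poweR.
  apply/measurable_EFinP; apply: measurable_funM => //.
  by apply: measurable_funM => //; exact: measurable_rV_powR.
- by apply: measurable_funeM; exact: measurable_fun_poweR.
Qed.

Let N_cube x (rho : R) : 0 < rho ->
  (\int[mu]_(y in cube x rho) `|f y|%:E <= N x * (rho `^ (D - sigma))%:E)%E.
Proof.
move=> rho0.
have rs : (0 <= (rho `^ (D - sigma))%:E)%E by rewrite lee_fin powR_ge0.
have [rx|rx] := leP rho (`|x| / 2).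
  have xN : x != 0 by rewrite -normr_gt0; lra.
  apply: (le_trans (near_bound K10 near_avg xN rho0 rx)).
  by apply: lee_wpmul2r => //; rewrite /N le_max lexx.
(* Since |x| < 2 rho, the cube is contained in the one of centre 0 and radius 3 rho, and d is the
   dyadic radius just above it. *)
have [k [k1 k2]] : exists k : int, dyad k < 3 * rho /\ 3 * rho <= 2 * dyad k.
  by apply: dyadic_int; lra.
pose d : R := dyad (k + 1); have dE : d = 2 * dyad k by exact: dyadS.
have d0 : 0 < d by exact: dyad_gt0.
have sc : scale (pickle (k + 1)) = Some d by rewrite /scale pickleK_inv.
have [bfin _] := far_mass_bound c16 far_avg d0.
apply: (@le_trans _ _ (\int[mu]_(y in cube 0%R d) `|f y|%:E)%E).
  apply: ge0_subset_integral => //; try exact: measurable_cube.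
  - by apply: measurable_funTS; apply/measurable_EFinP; exact: measurableT_comp.
  - by apply: cube_sub; rewrite sub0r normrN; lra.
rewrite -(fineK bfin) -/(far_mass d).
have fm0 : 0 <= far_mass d by apply: fine_ge0; apply: integral_ge0 => y _; rewrite lee_fin.
have xd : cube 0 d x by rewrite /cube/= sub0r normrN; lra.
apply: (@le_trans _ _ ((c6 * (d `^ (sigma - D) * far_mass d))%:E * (rho `^ (D - sigma))%:E)%E).
  rewrite -EFinM lee_fin.
  have : d `^ (D - sigma) <= c6 * rho `^ (D - sigma) by apply: powR_comparable; lra.
  move=> h; apply: (@le_trans _ _ (d `^ (sigma - D) * (d `^ (D - sigma) * far_mass d))).
    rewrite mulrA -powRD ?(gt_eqF d0) ?implybT// (_ : sigma - D + (D - sigma) = 0); last by ring.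
    by rewrite powRr0 mul1r.
  have ringE (y1 y2 y3 y4 : R) : y2 * (y1 * y4) * y3 = y1 * (y2 * y3 * y4) by ring.
  rewrite ringE; apply: ler_wpM2l; first exact: powR_ge0.
  exact: ler_wpM2r.
apply: lee_wpmul2r => //; rewrite /N le_max; apply/orP; right.
rewrite /far EFinM; apply: lee_wpmul2l; first by rewrite lee_fin (ltW c60).
have u0 : 0 <= d `^ (sigma - D) * far_mass d by rewrite mulr_ge0// powR_ge0.
set u := _ * _ in u0 *.
have -> : u%:E = ((u `^ q)%:E `^ q^-1)%E.
  by rewrite poweR_EFin -powRrM mulfV ?gt_eqF// powRr1.
apply: le_poweR; [by rewrite invr_ge0 ltW|by rewrite lee_fin powR_ge0|].
apply: (@le_trans _ _ (far_term (pickle (k + 1)) x)).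
  by rewrite /far_term sc indicE mem_set// mulr1.
apply: (le_trans _ (nneseries_lim_ge (pickle (k + 1)).+1 _)) => //.
by rewrite big_nat_recr//= leeDr// sume_ge0.
Qed.

Let far_sets (i : nat) : set V := if scale i is Some d then far_set d else set0.

Let measurable_far_sets i : measurable (far_sets i).
Proof. by rewrite /far_sets; case: scale => // d; exact: measurable_cube. Qed.

Let triv_far_sets : trivIset setT far_sets.
Proof.
apply/trivIsetP => i j _ _ ij; apply/seteqP; split => // z [].
rewrite /far_sets /scale.
have := @pickle_invK int i; case: pickle_inv => //= k pk.
have := @pickle_invK int j; case: pickle_inv => //= l pl.
move=> /(far_set_coord (dyad_gt0 k))/andP[a1 a2].
move=> /(far_set_coord (dyad_gt0 l))/andP[b1 b2].
have := dyad_gt0 (R := R) k; have := dyad_gt0 (R := R) l => l0 k0.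
have [kl|kl|kl] := ltgtP k l.
- by have := dyad_le2 (R := R) kl; lra.
- by have := dyad_le2 (R := R) kl; lra.
- by move/eqP: ij; apply; rewrite -pk -pl kl.
Qed.

Let qp1 : 0 <= q / p - 1.
Proof. by rewrite subr_ge0 ler_pdivlMr// mul1r. Qed.

(** With J the normalised mass, J^q = J^p (J^p)^(q/p - 1). The first factor is summable over i by
    disjointness of the test cubes; the second is bounded by a power of S0 since q >= p. *)
Let far_term_bound i : (\int[mu]_x ((`|x| `^ (gam * q))%:E * far_term i x) <=
  (Cg * Kf * (Kf * S0) `^ (q / p - 1))%:E * \int[mu]_(z in far_sets i) (m z `^ p))%E.
Proof.
rewrite /far_term /far_sets; case sc : scale => [d|]; last first.
  by rewrite integral_set0 mule0 integral0_eq// => x _; rewrite mule0.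
have d0 := scale_gt0 sc.
have [bfin hJ] := far_mass_bound c16 far_avg d0.
have fm0 : 0 <= far_mass d by apply: fine_ge0; apply: integral_ge0 => y _; rewrite lee_fin.
set c := (d `^ (sigma - D) * far_mass d) `^ q.
have c0 : 0 <= c by exact: powR_ge0.
set J := d `^ (alpha - D + D / p) * far_mass d in hJ.
have J0 : 0 <= J by rewrite mulr_ge0// powR_ge0.
have -> : (\int[mu]_x ((`|x| `^ (gam * q))%:E * (c * \1_(cube 0 d) x)%:E) =
   c%:E * \int[mu]_(x in cube 0%R d) (`|x| `^ (gam * q))%:E)%E.
  rewrite -(integral_scale_set mu c0 (measurable_cube 0 d)
    (h := fun x => (`|x| `^ (gam * q))%:E)); last 2 first.
  - by apply/measurable_EFinP; exact: measurable_rV_powR.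
  - by move=> x; rewrite lee_fin powR_ge0.
  rewrite [RHS]integral_mkcond; apply: eq_integral => x _.
  rewrite patchE indicE; case: ifP => _; last by rewrite mulr0 mule0.
  by rewrite mulr1 muleC.
apply: (@le_trans _ _ (c * (Cg * d `^ (D + gam * q)))%:E).
  by rewrite EFinM; apply: lee_wpmul2l; rewrite ?lee_fin//; exact: hCg.
(* By the scaling relation all powers of d are accounted for by J. *)
have JE : c * (Cg * d `^ (D + gam * q)) = Cg * J `^ q.
  rewrite mulrCA; congr (_ * _); rewrite /c /J !powRM ?powR_ge0//.
  rewrite mulrAC; congr (_ * _); rewrite -!powRrM -powRD ?(gt_eqF d0) ?implybT//.
  congr (_ `^ _); have -> : alpha = gam + D / q - D / p + sigma by move: scal; lra.
  by field; rewrite !gt_eqF.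
rewrite JE.
set I := integral _ _ _ in hJ *.
have I0 : (0 <= I)%E by apply: integral_ge0 => z _; exact: poweR_ge0.
have IS : (I <= S0%:E)%E.
  apply: le_trans hS; apply: ge0_subset_integral => //.
  - exact: measurable_cube.
  - exact: measurable_fun_poweR.
  - by move=> z _; exact: poweR_ge0.
have Ifin : I \is a fin_num by rewrite ge0_fin_numE// (le_lt_trans IS)// ltry.
move: hJ I0 IS; rewrite -(fineK Ifin) -!EFinM !lee_fin -/Kf; set I' := fine I => hJ I0 IS.
have -> : J `^ q = J `^ p * (J `^ p) `^ (q / p - 1).
  by rewrite mulr_powRB1 ?powR_ge0 ?divr_gt0// -powRrM mulrC divfK// gt_eqF.
rewrite -2!mulrA; apply: ler_wpM2l; first exact: ltW.
rewrite [leRHS]mulrAC; apply: ler_pM; [exact: powR_ge0|exact: powR_ge0|exact: hJ|].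
apply: le_powR; [exact: qp1|exact: powR_ge0|].
by apply: (le_trans hJ); apply: ler_wpM2l; [exact: ltW|exact: IS].
Qed.

Definition frac_const : R :=
  Kn `^ q + c6 `^ q * (Cg * Kf * Kf `^ (q / p - 1)).

Lemma fractional_maximal_fixed : exists N : V -> \bar R,
  [/\ measurable_fun [set: V] N, forall x, (0 <= N x)%E,
    forall x (rho : R), 0 < rho ->
      (\int[mu]_(y in cube x rho) `|f y|%:E <= N x * (rho `^ (D - sigma))%:E)%E &
    (\int[mu]_x (((`|x| `^ gam)%:E * N x) `^ q) <= (frac_const * S0 `^ (q / p))%:E)%E].
Proof.
exists N; split => //.
- by move=> x; rewrite /N le_max near0.
pose A1 x := ((Kn `^ q * S0 `^ (q / p - 1))%:E * m x `^ p)%E.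
pose A2 x := ((c6 `^ q)%:E * \sum_(i <oo) ((`|x| `^ (gam * q))%:E * far_term i x))%E.
have ft0 i (x : V) : (0 <= (`|x| `^ (gam * q))%:E * far_term i x)%E.
  by rewrite mule_ge0 ?far_term0// lee_fin powR_ge0.
have mft i : measurable_fun [set: V] (fun x => (`|x| `^ (gam * q))%:E * far_term i x)%E.
  apply: emeasurable_funM => //; apply/measurable_EFinP; exact: measurable_rV_powR.
have mfs : measurable_fun [set: V]
    (fun x => \sum_(i <oo) ((`|x| `^ (gam * q))%:E * far_term i x))%E.
  by apply: ge0_emeasurable_sum => // i x _ _.
have fs0 x : (0 <= \sum_(i <oo) ((`|x| `^ (gam * q))%:E * far_term i x))%E.
  by apply: nneseries_ge0 => i _ _.
have A10 x : (0 <= A1 x)%E.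
  by rewrite mule_ge0 ?poweR_ge0// lee_fin mulr_ge0 ?powR_ge0.
have A20 x : (0 <= A2 x)%E by rewrite mule_ge0// lee_fin powR_ge0.
have mA1 : measurable_fun [set: V] A1 by apply: measurable_funeM; exact: measurable_fun_poweR.
have mA2 : measurable_fun [set: V] A2 by exact: measurable_funeM.
(* The q-th power of the maximum is at most the sum of the q-th powers, so the near and far parts
   are integrated separately. *)
apply: (@le_trans _ _ (\int[mu]_x (A1 x + A2 x))%E).
  apply: ge0_le_integral_nm => x _; first exact: poweR_ge0.
  have [h|h] := leP (far x) (near x).
  - rewrite /N max_l//; apply: (@le_trans _ _ (A1 x)); last by rewrite leeDl.
    rewrite /near muleA -EFinM poweRM ?poweR_ge0//; last first.
      by rewrite lee_fin !mulr_ge0 ?powR_ge0 ?(ltW Kn0).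
    rewrite -poweRrM divfK ?gt_eqF// /A1 poweR_EFin; apply: lee_wpmul2r; first exact: poweR_ge0.
    rewrite lee_fin.
    have -> : Kn `^ q * S0 `^ (q / p - 1) = (Kn * S0 `^ (p^-1 - q^-1)) `^ q.
      rewrite powRM ?powR_ge0 ?(ltW Kn0)// -powRrM; congr (_ * _ `^ _).
      by field; rewrite !gt_eqF.
    apply: le_powR; [exact: ltW|by rewrite !mulr_ge0 ?powR_ge0 ?(ltW Kn0)|].
    have ringE (y1 y2 y3 y4 : R) : y1 * (y2 * y3 * y4) = (y1 * y3) * (y2 * y4) by ring.
    rewrite ringE; apply: ler_piMl; first by rewrite mulr_ge0 ?powR_ge0 ?(ltW Kn0).
    (* The product of the two opposite powers of |x| is 1 off the origin. At the origin it is 1 when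
       gam = 0 and 0 otherwise, since [powR] of 0 is 0 for every nonzero exponent. *)
    have [->|xN] := eqVneq x 0.
      have [->|gN] := eqVneq gam 0; first by rewrite oppr0 powRr0 mulr1.
      by rewrite normr0 powR0// mul0r.
    by rewrite -powRD ?normr_eq0 ?xN ?implybT// subrr powRr0.
  - rewrite /N max_r ?(ltW h)//; apply: (@le_trans _ _ (A2 x)); last by rewrite leeDr.
    rewrite /far poweRM ?lee_fin ?powR_ge0//; last first.
      by rewrite mule_ge0 ?poweR_ge0// lee_fin (ltW c60).
    rewrite poweRM ?poweR_ge0 ?lee_fin ?(ltW c60)// -poweRrM mulVf ?gt_eqF// poweRe1//.
    rewrite !poweR_EFin muleCA /A2; apply: lee_wpmul2l; first by rewrite lee_fin powR_ge0.
    by rewrite nneseriesZl// -powRrM.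
rewrite ge0_integralD// integral_scale; last 3 first.
- by rewrite mulr_ge0 ?powR_ge0.
- exact: measurable_fun_poweR.
- by move=> x; exact: poweR_ge0.
rewrite integral_scale ?powR_ge0// integral_nneseries//.
have SE : S0 `^ (q / p) = S0 * S0 `^ (q / p - 1).
  by rewrite mulr_powRB1// divr_gt0.
rewrite /frac_const mulrDl EFinD; apply: leeD.
  apply: (@le_trans _ _ ((Kn `^ q * S0 `^ (q / p - 1))%:E * S0%:E)%E).
    by apply: lee_wpmul2l => //; rewrite lee_fin mulr_ge0 ?powR_ge0.
  by rewrite -EFinM lee_fin SE -mulrA [_ * S0]mulrC.
rewrite -mulrA (EFinM (c6 `^ q)); apply: lee_wpmul2l; first by rewrite lee_fin powR_ge0.
apply: (@le_trans _ _ (\sum_(i <oo) ((Cg * Kf * (Kf * S0) `^ (q / p - 1))%:E *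
    \int[mu]_(z in far_sets i) (m z `^ p)))%E).
  apply: lee_nneseries => [i _ _|i _]; last exact: far_term_bound.
  by apply: integral_ge0 => x _.
have cc0 : 0 <= Cg * Kf * (Kf * S0) `^ (q / p - 1).
  by rewrite !mulr_ge0 ?powR_ge0 ?(ltW Cg0) ?(ltW Kf0).
rewrite nneseriesZl; last by move=> i _; apply: integral_ge0 => z _; exact: poweR_ge0.
(* The test cubes are disjoint, so the integrals of m^p over them add up to the integral over their
   union, at most S0. *)
rewrite -ge0_integral_bigcup//; last 2 first.
- by apply: measurable_funTS; exact: measurable_fun_poweR.
- by move=> z _; exact: poweR_ge0.
apply: (@le_trans _ _ ((Cg * Kf * (Kf * S0) `^ (q / p - 1))%:E * S0%:E)%E).
  apply: lee_wpmul2l; first by rewrite lee_fin.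
  apply: le_trans hS; apply: ge0_subset_integral => //.
  - exact: bigcup_measurable.
  - exact: measurable_fun_poweR.
  - by move=> z _; exact: poweR_ge0.
rewrite -EFinM lee_fin SE powRM ?(ltW Kf0)// le_eqVlt; apply/orP; left; apply/eqP; ring.
Qed.

End fixed_function.

End fractional_maximal.

Lemma fractional_maximal {R : realType} (n : nat) (p q alpha gam sigma : R) :
  (0 < n)%N -> 1 < p -> p <= q -> gam <= alpha ->
  alpha < n%:R - n%:R / p -> 0 < gam + n%:R / q ->
  gam + n%:R / q = alpha + n%:R / p - sigma ->
  exists2 C : R, 0 < C & forall f : 'rV[R]_n -> R, measurable_fun [set: 'rV[R]_n] f ->
  (\int[lebesgue_rV n]_x ((`|x| `^ alpha * `|f x|) `^ p)%:E < +oo)%E ->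
  exists N : 'rV[R]_n -> \bar R,
  [/\ measurable_fun [set: 'rV[R]_n] N, forall x, (0 <= N x)%E,
    forall x (rho : R), 0 < rho ->
      (\int[lebesgue_rV n]_(y in cube x rho) `|f y|%:E <= N x * (rho `^ (n%:R - sigma))%:E)%E &
    (\int[lebesgue_rV n]_x (((`|x| `^ gam)%:E * N x) `^ q) <=
     C%:E * (\int[lebesgue_rV n]_x ((`|x| `^ alpha * `|f x|) `^ p)%:E) `^ (q / p))%E].
Proof.
move=> n0 p1 pq ga alphaD gamD scal.
have p0 : 0 < p by exact: lt_trans p1.
have q0 : 0 < q by exact: lt_le_trans pq.
have [t [pt t1 alphat]] := exists_interior_exponent n0 p1 alphaD.
have t0 : 0 < t by rewrite (lt_trans _ pt)// invr_gt0.
have [Cf Cf0 hCf] := dual_weight_bound n0 t1 alphat.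
have hg : - n%:R < gam * q.
  rewrite -subr_gt0 opprK (_ : _ + _ = (gam + n%:R / q) * q); first exact: mulr_gt0.
  by field; rewrite gt_eqF.
have [Cg Cg0 hCg] := integral_cube_powR n0 hg.
have tp1 : 1 < t * p by rewrite -ltr_pdivrMr// mul1r.
have [Cm Cm0 hCm] := maximal_strong n tp1.
have fc0 : 0 < frac_const n p q alpha sigma t Cf Cg.
  rewrite /frac_const; apply: addr_gt0; first by rewrite powR_gt0// mulr_gt0 ?powR_gt0.
  by rewrite !mulr_gt0 ?powR_gt0// !mulr_gt0 ?powR_gt0// !mulr_gt0 ?powR_gt0.
exists (frac_const n p q alpha sigma t Cf Cg * Cm `^ (q / p)); first by rewrite mulr_gt0 ?powR_gt0.
move=> f mf.
set G := integral _ _ _ => Goo.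
have G0 : (0 <= G)%E by apply: integral_ge0 => x _; rewrite lee_fin powR_ge0.
have Gfin : G \is a fin_num by rewrite ge0_fin_numE.
pose phi (x : 'rV[R]_n) := ((`|x| `^ alpha * `|f x|) `^ t^-1)%:E.
have mphi : measurable_fun [set: 'rV[R]_n] phi.
  apply/measurable_EFinP/measurable_fun_powR/measurable_funM.
    exact: measurable_fun_powR (@measurable_rV_norm R n).
  exact: measurableT_comp.
have phi0 x : (0 <= phi x)%E by rewrite lee_fin powR_ge0.
have S00 : 0 <= Cm * fine G by rewrite mulr_ge0 ?(ltW Cm0) ?fine_ge0.
(* The maximal theorem at the exponent t p, applied to g^(1/t), whose power t p is g^p. *)
have hS : (\int[lebesgue_rV n]_x ((maximal phi x `^ t) `^ p) <= (Cm * fine G)%:E)%E.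
  under eq_integral do rewrite -poweRrM.
  apply: (le_trans (hCm _ mphi phi0)); rewrite EFinM fineK//.
  rewrite le_eqVlt; apply/orP; left; apply/eqP; congr (_ * _)%E.
  apply: eq_integral => x _; rewrite /phi poweR_EFin -powRrM; congr (_ `^ _)%:E.
  by field; rewrite gt_eqF.
have [N [mN N0 NQ NI]] := @fractional_maximal_fixed R n p q alpha gam sigma n0 p1 pq ga
  scal t pt t1 Cf Cg Cf0 Cg0 hCf hCg f mf (Cm * fine G) S00 hS.
exists N; split => //; apply: (le_trans NI).
rewrite -{2}(fineK Gfin) poweR_EFin -EFinM powRM ?(ltW Cm0) ?fine_ge0// lee_fin.
by rewrite mulrA.
Qed.

(** * Gaussian kernels *)

Section inversion.
Context {R : realType}.
Local Notation leb := (@lebesgue_measure R).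

Lemma near_neq0 (x : R) : 0 < x -> \forall y \near x, y != 0.
Proof. by move=> x0; near=> y; apply: lt0r_neq0; near: y; exact: lt_nbhsr. Unshelve. all: by end_near. Qed.

Let F (c x : R) : R := c * x^-1.

Let is_derive_F c x : x != 0 -> is_derive x (1 : R) (F c) (- (c / x ^+ 2)).
Proof.
move=> x0; have dV : is_derive x (1 : R) (fun y : R => y^-1) (- (x ^- 2) *: 1).
  exact: is_deriveV.
have := @is_deriveZ _ _ _ (fun y : R => y^-1) c x (1 : R) _ dV.
by move=> h; apply: (is_derive_eq h); rewrite /GRing.scale/= mulr1 mulrN.
Qed.

Let derive_F c x : x != 0 -> derive1 (F c) x = - (c / x ^+ 2).
Proof. by move=> x0; have h := is_derive_F c x0; rewrite derive1E derive_val. Qed.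

Let cont_inv_sqr c (x : R) : x != 0 -> {for x, continuous (fun y : R => c / y ^+ 2)}.
Proof.
move=> xN.
have h2 : {for x, continuous (fun y : R => (y ^+ 2)^-1)}.
  by apply: (@continuousV R R (fun y : R => y ^+ 2)); [rewrite expf_neq0|exact: exprn_continuous].
exact: (@continuousM R R (cst c) (fun y : R => (y ^+ 2)^-1) x (@cst_continuous _ _ c x) h2).
Qed.

Let cont_div c (x : R) : x != 0 -> {for x, continuous (fun y : R => c / y)}.
Proof.
move=> xN.
have h2 : {for x, continuous (fun y : R => y^-1)}.
  exact: (@continuousV R R (fun y : R => y) x xN (fun A => id)).
exact: (@continuousM R R (cst c) (fun y : R => y^-1) x (@cst_continuous _ _ c x) h2).
Qed.

Let cont_derive_F c x : 0 < x -> {for x, continuous (derive1 (F c))}.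
Proof.
move=> x0; have xN : x != 0 by rewrite gt_eqF.
suff h : derive1 (F c) y @[y --> x] --> - (c / x ^+ 2) by rewrite -(derive_F c xN) in h.
apply: (@cvg_trans _ (- (c / y ^+ 2) @[y --> x])).
  by apply: near_eq_cvg; near=> y; rewrite derive_F//; near: y; exact: near_neq0.
have h : {for x, continuous (fun y : R => c / y ^+ 2)} by exact: cont_inv_sqr.
exact: (@continuousN _ _ _ (fun y : R => c / y ^+ 2) x h).
Unshelve. all: by end_near. Qed.

(** Substitution is performed on the compact intervals S1 k. Both these and their images S2 k under
    t -> c / t increase to the half-line, so monotone convergence gives the two sides. *)
Lemma integral_inversion (c : R) (G : R -> R) : 0 < c ->
  {in `]0, +oo[, continuous G} -> (forall x, 0 < x -> 0 <= G x) ->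
  (\int[leb]_(t in `]0%R, +oo[) (G t)%:E =
   \int[leb]_(t in `]0%R, +oo[) (G (c / t) * (c / t ^+ 2))%:E)%E.
Proof.
move=> c0 cG G0.
pose a (k : nat) : R := k.+1%:R^-1.
pose b (k : nat) : R := k.+1%:R.
have a0 k : 0 < a k by rewrite invr_gt0.
have b1 k : 1 <= b k by rewrite ler1n.
have a1 k : a k <= 1 by rewrite invf_le1 ?ler1n ?ltr0n.
pose S1 k := `[a k, b k]%classic.
pose S2 k := `[c * (b k)^-1, c * (a k)^-1]%classic.
have FE x : F c x = c / x by [].
have key k : (\int[leb]_(t in S2 k) (G t)%:E =
    \int[leb]_(t in S1 k) (G (c / t) * (c / t ^+ 2))%:E)%E.
  rewrite /S2 -!FE (@integration_by_substitution_decreasing _ (F c))//.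
  - apply: eq_integral => x /set_mem/=; rewrite in_itv/= => /andP[x1 x2].
    have x0 : x != 0 by rewrite gt_eqF// (lt_le_trans (a0 k)).
    rewrite (_ : _ x = G (F c x) * - derive1 (F c) x)//.
    by rewrite derive_F// opprK.
  - by rewrite (le_trans (a1 k)).
  - move=> x y; rewrite !in_itv/= => /andP[x1 x2] /andP[y1 y2] xy.
    by rewrite /F ltr_pM2l// ltf_pV2// posrE (lt_le_trans (a0 k)).
  - move=> x; rewrite in_itv/= => /andP[x1 x2]; apply: cont_derive_F.
    exact: lt_trans (a0 k) x1.
  - by apply: (cvgP (derive1 (F c) (a k))); apply: cvg_at_right_filter; exact: cont_derive_F.
  - apply: (cvgP (derive1 (F c) (b k))); apply: cvg_at_left_filter; apply: cont_derive_F.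
    exact: lt_le_trans ltr01 (b1 k).
  - have cF x : 0 < x -> {for x, continuous (F c)}.
      move=> x0; apply: differentiable_continuous; apply/derivable1_diffP.
      by have := is_derive_F c (lt0r_neq0 x0) => h; exact: ex_derive.
    split.
    + move=> x; rewrite in_itv/= => /andP[x1 x2].
      have x0 : x != 0 by rewrite gt_eqF// (lt_trans (a0 k)).
      by have := is_derive_F c x0 => h; exact: ex_derive.
    + by apply: cvg_at_right_filter; exact: cF.
    + by apply: cvg_at_left_filter; apply: cF; exact: lt_le_trans ltr01 (b1 k).
  - apply: continuous_in_subspaceT => x /set_mem/=; rewrite in_itv/= => /andP[x1 x2].
    apply: cG; rewrite in_itv/= andbT (lt_le_trans _ x1)// /F mulr_gt0// invr_gt0.
    exact: lt_le_trans ltr01 (b1 k).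
have E1 : `]0, +oo[%classic = \bigcup_k S1 k.
  apply/seteqP; split => x /=; rewrite /S1/= in_itv/= ?andbT.
    move=> x0; have [k hk] : exists k : nat, Num.max x x^-1 < k%:R.
      by exists (Num.bound (Num.max x x^-1)); apply: le_lt_trans (archi_boundP _);
        [rewrite lexx|rewrite le_max (ltW x0)].
    exists k => //=; rewrite in_itv/=; move: hk; rewrite gt_max => /andP[h1 h2].
    have kk : k%:R <= b k by rewrite ler_nat.
    apply/andP; split; last by rewrite (le_trans (ltW h1)).
    rewrite /a -[leRHS]invrK lef_pV2 ?posrE ?invr_gt0//.
    by rewrite (le_trans (ltW h2)).
  by move=> [k _]/=; rewrite in_itv/= => /andP[h _]; exact: lt_le_trans (a0 k) h.
have E2 : `]0, +oo[%classic = \bigcup_k S2 k.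
  apply/seteqP; split => x; rewrite /S2/= in_itv/= ?andbT.
    move=> x0; have : (\bigcup_k S1 k) (c / x).
      by rewrite -E1/= in_itv/= andbT divr_gt0.
    move=> [k _]; rewrite /S1/= in_itv/= => /andP[h1 h2]; exists k => //=.
    have bk := lt_le_trans ltr01 (b1 k).
    rewrite in_itv/=; apply/andP; split.
      by rewrite ler_pdivrMr// mulrC -ler_pdivrMr.
    by rewrite ler_pdivlMr// mulrC -ler_pdivlMr.
  move=> [k _]/=; rewrite in_itv/= => /andP[h _]; apply: lt_le_trans h.
  by rewrite mulr_gt0// invr_gt0 (lt_le_trans ltr01).
have bnd : {homo b : i j / (i <= j)%N >-> i <= j} by move=> i j ij; rewrite ler_nat.
have and : {homo a : i j / (i <= j)%N >-> j <= i}.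
  by move=> i j ij; rewrite /a lef_pV2 ?posrE// bnd.
have nd1 : nondecreasing_seq S1.
  move=> i j ij; apply/subsetPset => x; rewrite /S1/= !in_itv/= => /andP[h1 h2].
  by rewrite (le_trans _ h1) ?and// (le_trans h2) ?bnd.
have nd2 : nondecreasing_seq S2.
  move=> i j ij; apply/subsetPset => x; rewrite /S2/= !in_itv/= => /andP[h1 h2].
  apply/andP; split.
    rewrite (le_trans _ h1)// ler_pM2l// lef_pV2 ?posrE ?(lt_le_trans ltr01)// bnd//.
  by rewrite (le_trans h2)// ler_pM2l// lef_pV2 ?posrE// and.
have cG2 : {in `]0, +oo[, continuous (fun t : R => G (c / t) * (c / t ^+ 2))}.
  move=> x; rewrite in_itv/= andbT => x0; have xN : x != 0 by rewrite gt_eqF.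
  apply: (@continuousM R R (fun t : R => G (c / t)) (fun t : R => c / t ^+ 2)); last exact: cont_inv_sqr.
  apply: (@continuous_comp _ _ _ (fun t : R => c / t) G); first exact: cont_div.
  by apply: cG; rewrite in_itv/= andbT divr_gt0.
have mcont (h : R -> R) : {in `]0, +oo[, continuous h} ->
    measurable_fun (`]0, +oo[%classic : set R) (EFin \o h).
  move=> ch; apply/measurable_EFinP; apply: open_continuous_measurable_fun => //.
  by move=> x /set_mem; exact: ch.
have sub1 k : S1 k `<=` `]0, +oo[%classic by rewrite E1; exact: bigcup_sup.
have sub2 k : S2 k `<=` `]0, +oo[%classic by rewrite E2; exact: bigcup_sup.
have limS (S : (set (measurableTypeR R))^nat) (h : measurableTypeR R -> R) : nondecreasing_seq S ->
    (forall k, measurable (S k)) -> (forall k, measurable_fun (S k) (EFin \o h)) ->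
    (forall k x, S k x -> 0 <= h x) ->
    (\int[leb]_(x in S i) (h x)%:E)%E @[i --> \oo] --> (\int[leb]_(x in \bigcup_i S i) (h x)%:E)%E.
  move=> ndS mS mh h0.
  apply: (@ge0_nondecreasing_set_cvg_integral _ _ _ S (EFin \o h) leb) => //.
have c1 := limS S2 G nd2 (fun=> measurable_itv _)
  (fun k => measurable_funS (measurable_itv _) (@sub2 k) (mcont _ cG)).
have c2 := limS S1 (fun t : R => G (c / t) * (c / t ^+ 2)) nd1 (fun=> measurable_itv _)
  (fun k => measurable_funS (measurable_itv _) (@sub1 k) (mcont _ cG2)).
have {}c1 : (\int[leb]_(t in S1 i) (G (c / t) * (c / t ^+ 2))%:E)%E @[i --> \oo] -->
    (\int[leb]_(x in \bigcup_i S2 i) (G x)%:E)%E.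
  under eq_fun do rewrite -key.
  by apply: c1 => k x /sub2/=; rewrite in_itv/= andbT; exact: G0.
rewrite {1}E2 E1; refine (cvg_unique (@ereal_hausdorff R) c1 (c2 _)) => k x /sub1/=.
rewrite in_itv/= andbT => x0.
by rewrite mulr_ge0 ?G0 ?divr_gt0// ltW// divr_gt0// exprn_gt0.
Qed.

End inversion.

Section euclidean_norm.
Context {R : realType} {n : nat}.
Implicit Types x y z w : 'rV[R]_n.

Lemma enorm_ge0 x : 0 <= enorm x. Proof. exact: sqrtr_ge0. Qed.

Lemma enorm_sqr x : enorm x ^+ 2 = \sum_(i < n) x ord0 i ^+ 2.
Proof. by rewrite sqr_sqrtr// sumr_ge0// => i _; rewrite sqr_ge0. Qed.

Lemma enormZ (c : R) x : enorm (c *: x) = `|c| * enorm x.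
Proof.
rewrite /enorm; under eq_bigr do rewrite mxE exprMn.
by rewrite -mulr_sumr sqrtrM ?sqr_ge0// sqrtr_sqr.
Qed.

Lemma enormN x : enorm (- x) = enorm x.
Proof. by rewrite -scaleN1r enormZ normrN1 mul1r. Qed.

Lemma enorm_coord x i : `|x ord0 i| <= enorm x.
Proof.
rewrite -(@ler_pXn2r _ 2)// ?nnegrE ?enorm_ge0// real_normK ?num_real// enorm_sqr.
by rewrite (bigD1 i)//= lerDl sumr_ge0// => j _; rewrite sqr_ge0.
Qed.

Lemma norm_le_enorm x : `|x| <= enorm x.
Proof. by apply/(rV_norm_le _ (enorm_ge0 x)) => i; exact: enorm_coord. Qed.

Lemma enorm_le_norm x : enorm x <= n%:R * `|x|.
Proof.
rewrite -(@ler_pXn2r _ 2)// ?nnegrE ?enorm_ge0 ?mulr_ge0// enorm_sqr exprMn.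
apply: (@le_trans _ _ (\sum_(i < n) `|x| ^+ 2)).
  apply: ler_sum => i _; rewrite -[leLHS]real_normK ?num_real//.
  by rewrite ler_pXn2r ?nnegrE// rV_norm_coord.
rewrite sumr_const card_ord -[leLHS]mulr_natl ler_wpM2r ?sqr_ge0//.
by rewrite -natrX ler_nat; case: (n) => // k; rewrite expnS expn1 leq_pmulr.
Qed.

Lemma enormD_sqr x y : enorm (x + y) ^+ 2 <= 2 * enorm x ^+ 2 + 2 * enorm y ^+ 2.
Proof.
rewrite !enorm_sqr !mulr_sumr -big_split/=; apply: ler_sum => i _; rewrite mxE.
by have := sqr_ge0 (x ord0 i - y ord0 i); rewrite sqrrB sqrrD !mulr_natl mulr2n; lra.
Qed.

Lemma enorm_sqrB x y : `|enorm (x + y) ^+ 2 - enorm x ^+ 2| <=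
  n%:R * (enorm y * (enorm x + enorm (x + y))).
Proof.
rewrite !enorm_sqr -sumrB; apply: (le_trans (ler_norm_sum _ _ _)).
rewrite -[n in n%:R]card_ord mulr_natl -sumr_const; apply: ler_sum => i _.
rewrite (_ : _ - _ = y ord0 i * (x ord0 i + (x + y) ord0 i)); last by rewrite !mxE; ring.
rewrite normrM ler_pM// ?enorm_coord//.
by rewrite (le_trans (ler_normD _ _))// lerD// enorm_coord.
Qed.

End euclidean_norm.

Section heat_kernel.
Context {R : realType} {n : nat}.
Local Notation mu := (@lebesgue_rV R n).
Implicit Types (x y z w : 'rV[R]_n) (t s : R).

Lemma heat_kernel_ge0 t x : 0 <= heat_kernel t x.
Proof. by rewrite mulr_ge0 ?powR_ge0 ?expR_ge0. Qed.

Lemma heat_kernelN t x : heat_kernel t (- x) = heat_kernel t x.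
Proof. by rewrite /heat_kernel enormN. Qed.

Lemma measurable_heat_kernel d (T : measurableType d) (f : T -> R) (g : T -> 'rV[R]_n) :
  measurable_fun setT f -> measurable_fun setT g ->
  measurable_fun setT (fun a => heat_kernel (f a) (g a)).
Proof.
move=> mf mg; apply: measurable_funM.
  by apply: measurable_fun_powR; apply: measurable_funM.
apply: measurableT_comp => //; apply: measurableT_comp => //.
apply: measurable_funM.
  by apply: measurable_funX; apply: measurableT_comp => //; exact: measurable_enorm.
(* The inverse is written with [powR] of a square, whose base is nonnegative; at 0 both forms
   vanish. *)
rewrite (_ : (fun _ => _) = (fun a => (4 * f a) * ((4 * f a) ^+ 2) `^ (- 1))).
  apply: measurable_funM; first exact: measurable_funM.
  by apply: measurable_fun_powR; apply: measurable_funX; exact: measurable_funM.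
apply/funext => a; set v := 4 * f a.
have [->|v0] := eqVneq v 0; first by rewrite invr0 mul0r.
by rewrite powR_inv1 ?sqr_ge0//; field.
Qed.

Lemma integral_gauss_rV (k : nat) :
  (\int[@lebesgue_rV R k]_x (expR (- enorm x ^+ 2))%:E = (Num.sqrt pi ^+ k)%:E)%E.
Proof.
have mg (m : nat) : measurable_fun setT (fun x : 'rV[R]_m => (expR (- enorm x ^+ 2))%:E).
  apply/measurable_EFinP; apply: measurableT_comp => //; apply: measurableT_comp => //.
  by apply: measurable_funX; exact: measurable_enorm.
elim: k => [|k IH].
  rewrite integral_dirac//; last exact: mg.
  by rewrite diracE mem_set// mul1e enorm_sqr big_ord0 oppr0 expR0.
rewrite integral_rV_cons//.
have inner (t : R) : (\int[@lebesgue_rV R k]_v (expR (- enorm (rV_cons (t, v)) ^+ 2))%:E =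
    (Num.sqrt pi ^+ k)%:E * (gauss_fun t)%:E)%E.
  rewrite -IH muleC -integral_scale ?gauss_fun_ge0//; last exact: mg.
  apply: eq_integral => v _; rewrite /gauss_fun -EFinM -expRD !enorm_sqr big_ord_recl rV_consE0/= opprD.
  by do 4 congr (_ _); apply: eq_bigr => i _; rewrite rV_consES.
under eq_integral do rewrite inner.
rewrite integral_scale ?exprn_ge0 ?sqrtr_ge0//.
- by rewrite integralT_gauss exprSr EFinM.
- by apply/measurable_EFinP; exact: measurable_gauss_fun.
- by move=> t; rewrite lee_fin gauss_fun_ge0.
Qed.

Lemma powR_sqrt_half (a : R) : 0 < a -> a `^ (- (n%:R / 2)) = (Num.sqrt a ^+ n)^-1.
Proof.
move=> a0; rewrite -powR_mulrn ?sqrtr_ge0// -powRN -powR12_sqrt ?(ltW a0)//.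
by rewrite -powRrM; congr (_ `^ _); lra.
Qed.

Lemma integral_heat_kernel t w : 0 < t ->
  (\int[mu]_z (heat_kernel t (w + z))%:E = 1)%E.
Proof.
move=> t0.
have m1 : measurable_fun setT (fun z : 'rV[R]_n => (heat_kernel t z)%:E).
  by apply/measurable_EFinP; apply: measurable_heat_kernel => //; exact: measurable_id.
have h0 z : (0 <= (heat_kernel t z)%:E)%E by rewrite lee_fin heat_kernel_ge0.
have -> : (\int[mu]_z (heat_kernel t (w + z))%:E = \int[mu]_z (heat_kernel t z)%:E)%E.
  have := integral_rV_affine w ltr01 m1 h0; rewrite expr1n invr1 mul1e => <-.
  by apply: eq_integral => z _; rewrite scale1r.
pose c := Num.sqrt (4 * t).
have c0 : 0 < c by rewrite sqrtr_gt0 mulr_gt0.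
rewrite (eq_integral (fun z => ((4 * pi * t) `^ (- (n%:R / 2)))%:E *
    (expR (- enorm (0 + c^-1 *: z) ^+ 2))%:E)%E); last first.
  move=> z _; rewrite -EFinM /heat_kernel add0r enormZ exprMn real_normK ?num_real//.
  have c2 : c ^+ 2 = 4 * t by rewrite sqr_sqrtr// mulr_ge0// ltW.
  by rewrite exprVn c2; congr (_ * expR (- _))%:E; rewrite mulrC.
have mg : measurable_fun setT (fun x : 'rV[R]_n => (expR (- enorm x ^+ 2))%:E).
  apply/measurable_EFinP; apply: measurableT_comp => //; apply: measurableT_comp => //.
  by apply: measurable_funX; exact: measurable_enorm.
rewrite integral_scale ?powR_ge0//; last first.
  apply: (@measurableT_comp _ _ _ _ _ _ (fun x : 'rV[R]_n => (expR (- enorm x ^+ 2))%:E)) => //.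
  by apply: measurable_rVD => //; apply: measurable_rVZ => //; exact: measurable_id.
rewrite (integral_rV_affine 0 (c := c^-1) (f := fun x => (expR (- enorm x ^+ 2))%:E)) ?invr_gt0//.
  rewrite integral_gauss_rV -!EFinM exprVn invrK -exprMn -sqrtrM ?mulr_ge0 ?(ltW t0)//.
  rewrite powR_sqrt_half ?mulr_gt0 ?pi_gt0// (_ : 4 * t * pi = 4 * pi * t); last by ring.
  by rewrite mulVf// expf_neq0// gt_eqF// sqrtr_gt0 !mulr_gt0// pi_gt0.
Qed.

(** Completing the square in z. The new time is harmonic: the inverse of s t / (s + t) is 1/s +
    1/t. *)
Lemma heat_kernel_prod s t w z : 0 < s -> 0 < t ->
  heat_kernel s z * heat_kernel t (w + z) =
  heat_kernel (s + t) w * heat_kernel (s * t / (s + t)) ((s / (s + t)) *: w + z).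
Proof.
move=> s0 t0; have st0 : 0 < s + t by rewrite addr_gt0.
have sN := lt0r_neq0 s0; have tN := lt0r_neq0 t0; have stN := lt0r_neq0 st0.
have p0 := pi_gt0 R.
rewrite /heat_kernel mulrACA [RHS]mulrACA -!expRD -!powRM; first last.
- by rewrite !mulr_ge0 ?(ltW p0) ?(ltW t0).
- by rewrite !mulr_ge0 ?(ltW p0) ?(ltW s0).
- by rewrite !mulr_ge0 ?invr_ge0 ?(ltW p0) ?(ltW s0) ?(ltW t0) ?(ltW st0).
- by rewrite !mulr_ge0 ?(ltW p0) ?(ltW st0).
congr (_ `^ _ * expR _); first by field.
rewrite -!opprD; congr (- _); rewrite !enorm_sqr !mulr_suml -!big_split/=.
by apply: eq_bigr => i _; rewrite !mxE; field; rewrite ?sN ?tN ?stN.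
Qed.

Lemma heat_kernel_semigroup s t w : 0 < s -> 0 < t ->
  (\int[mu]_z (heat_kernel s z * heat_kernel t (w + z))%:E = (heat_kernel (s + t) w)%:E)%E.
Proof.
move=> s0 t0; have st0 : 0 < s + t by rewrite addr_gt0.
under eq_integral do rewrite heat_kernel_prod// EFinM.
rewrite integral_scale ?heat_kernel_ge0//.
- by rewrite integral_heat_kernel ?mule1// !mulr_gt0// invr_gt0.
- apply/measurable_EFinP; apply: measurable_heat_kernel => //.
  by apply: measurable_rVD => //; exact: measurable_id.
- by move=> z; rewrite lee_fin heat_kernel_ge0.
Qed.

End heat_kernel.

(** * Gaussians against measures of polynomial growth *)

Section gaussian_tents.
Context {R : realType}.

(** The inequality v / b <= exp(v / b), raised to the power b. *)
Lemma powR_le_expR (b v : R) : 0 < b -> 0 <= v -> v `^ b <= b `^ b * expR v.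
Proof.
move=> b0 v0; rewrite -{1}[v](mulVKf (lt0r_neq0 b0)) mulrC -[v in expR v](mulfVK (lt0r_neq0 b0)).
have vb : 0 <= v / b by rewrite divr_ge0// ltW.
rewrite mulrC powRM ?(ltW b0)//; last by rewrite mulrC.
rewrite ler_wpM2l ?powR_ge0// expRM.
rewrite [b^-1 * v]mulrC; apply: le_powR; rewrite ?(ltW b0)//.
by apply: le_trans (expR_ge1Dx _); rewrite lerDr.
Qed.

Lemma expRN_le_powR (b v : R) : 0 < b -> 0 < v -> expR (- v) <= b `^ b * v `^ (- b).
Proof.
move=> b0 v0; rewrite powRN expRN ler_pdivlMr ?powR_gt0// mulrC ler_pdivrMr ?expR_gt0//.
by rewrite powR_le_expR// ltW.
Qed.

Definition tent_const (c e : R) : R :=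
  1 + ((e + 1) / 2) `^ ((e + 1) / 2) * c `^ ((e + 1) / 2) * shell_const e (e + 1).

Lemma tent_const_gt0 c e : 0 < tent_const c e.
Proof.
have s0 : 0 < shell_const e (e + 1) by rewrite shell_const_gt0// lt_eqF// ltrDl.
by rewrite /tent_const ltr_pwDl//; apply: mulr_ge0; [rewrite mulr_ge0 ?powR_ge0|exact: ltW].
Qed.

(** For N <= sqrt t the Gaussian is at most 1 and the growth hypothesis applies at radius sqrt t.
    Beyond, it is below a multiple of (N / sqrt t)^(- (e + 1)), which beats the growth r^e by one
    power in the sum over shells. These are the two summands of [tent_const]. *)
Lemma gaussian_tent d (T : measurableType d) (mu : {measure set T -> \bar R})
    (N : T -> R) (w : T -> \bar R) (K c e t : R) :
  measurable_fun setT N -> (forall x, 0 <= N x) ->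
  measurable_fun setT w -> (forall x, 0 <= w x)%E ->
  0 < c -> 0 < e -> 0 <= K -> 0 < t ->
  (forall r, 0 < r -> (\int[mu]_(x in [set x | (N x <= r)%R]) w x <= (K * r `^ e)%:E)%E) ->
  (\int[mu]_x (w x * (expR (- (N x ^+ 2 / (c * t))))%:E) <=
   (tent_const c e * K * t `^ (e / 2))%:E)%E.
Proof.
move=> mN N0 mw w0 c0 e0 K0 t0 HK.
set b := (e + 1) / 2.
have b0 : 0 < b by rewrite divr_gt0// addr_gt0.
pose rho := Num.sqrt t; have rho0 : 0 < rho by rewrite sqrtr_gt0.
have rhoE a : rho `^ a = t `^ (a / 2).
  by rewrite /rho -powR12_sqrt ?(ltW t0)// -powRrM mulrC.
have mS : measurable [set x | N x <= rho].
  by rewrite -[X in measurable X]setTI; apply: measurable_fun_le.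
have mg : measurable_fun setT (fun x => (expR (- (N x ^+ 2 / (c * t))))%:E).
  apply/measurable_EFinP; apply: measurableT_comp => //; apply: measurableT_comp => //.
  by apply: measurable_funM => //; exact: measurable_funX.
have mF : measurable_fun setT (fun x => w x * (expR (- (N x ^+ 2 / (c * t))))%:E)%E.
  exact: emeasurable_funM.
rewrite -(setUv [set x | N x <= rho]) ge0_integral_setU//; last 4 first.
- exact: measurableC.
- by rewrite setUv.
- by move=> x _; rewrite mule_ge0// lee_fin expR_ge0.
- by apply/disj_setPCl.
rewrite (_ : _ * K * _ = K * t `^ (e / 2) +
   b `^ b * c `^ b * shell_const e (e + 1) * K * t `^ (e / 2)); last by rewrite /tent_const -/b; ring.
rewrite EFinD; apply: leeD.
  rewrite -rhoE; apply: le_trans (HK _ rho0); apply: ge0_le_integral_nm => x _.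
    by rewrite mule_ge0// lee_fin expR_ge0.
  rewrite -[leRHS]mule1 lee_wpmul2l// lee_fin -expR0 ler_expR oppr_le0.
  by rewrite divr_ge0 ?sqr_ge0// mulr_ge0// ltW.
have SC : ~` [set x | N x <= rho] = [set x | rho < N x].
  by apply/seteqP; split => x /=; rewrite ltNge => /negP.
have mSC : measurable [set x | rho < N x] by rewrite -SC; exact: measurableC.
rewrite SC.
pose A := (b `^ b * c `^ b * t `^ b).
have A0 : 0 <= A by rewrite !mulr_ge0 ?powR_ge0.
apply: (@le_trans _ _ (\int[mu]_(x in [set x | (rho < N x)%R]) (A%:E * (w x * (N x `^ (- (e + 1)))%:E)))%E).
  apply: ge0_le_integral_nm => x /= Nx; first by rewrite mule_ge0// lee_fin expR_ge0.
  have Nx0 : 0 < N x by exact: lt_trans Nx.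
  rewrite muleCA lee_wpmul2l// -EFinM lee_fin.
  apply: (le_trans (expRN_le_powR b0 _)); first by rewrite divr_gt0 ?exprn_gt0 ?mulr_gt0.
  have ct0 : 0 < c * t by rewrite mulr_gt0.
  have -> : (N x ^+ 2 / (c * t)) `^ (- b) = c `^ b * t `^ b * N x `^ (- (e + 1)).
    rewrite powRM ?sqr_ge0 ?invr_ge0 ?(ltW ct0)// -powR_inv1 ?(ltW ct0)//.
    rewrite -[in LHS](powRrM (c * t)) mulN1r opprK powRM ?(ltW c0) ?(ltW t0)// mulrC.
    rewrite -powR_mulrn ?(ltW Nx0)// -powRrM (_ : 2%:R * - b = - (e + 1))// /b; lra.
  by rewrite /A !mulrA.
rewrite integral_scale_set//; first last.
- by move=> x; rewrite mule_ge0// lee_fin powR_ge0.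
- by apply: emeasurable_funM => //; apply/measurable_EFinP; exact: measurable_fun_powR.
apply: (le_trans (lee_wpmul2l _ (@shell_outer _ _ _ mu N w mN mw w0 K e (e + 1) rho rho0 _ K0 HK))).
- by rewrite lee_fin.
- by rewrite ltrDl.
rewrite -EFinM lee_fin rhoE /A.
rewrite (_ : _ * (_ * _ * _) = b `^ b * c `^ b * shell_const e (e + 1) * K * (t `^ b * t `^ ((e - (e + 1)) / 2))); last by ring.
rewrite -powRD; last by rewrite (gt_eqF t0) implybT.
by rewrite (_ : b + _ = e / 2)// /b; lra.
Qed.

End gaussian_tents.

Section heat_tent.
Context {R : realType} {n : nat}.
Local Notation mu := (@lebesgue_rV R n).

(** With the sup norm in the exponent, the level sets of the Gaussian are cubes, to which the
    majorant refers. *)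
Lemma heat_kernel_le_sup t (x : 'rV[R]_n) : 0 < t ->
  heat_kernel t x <= t `^ (- (n%:R / 2)) * expR (- (`|x| ^+ 2 / (4 * t))).
Proof.
move=> t0; apply: ler_pM; rewrite ?powR_ge0 ?expR_ge0//.
  have p0 := pi_gt0 R; rewrite powRM ?mulr_ge0 ?(ltW p0) ?(ltW t0)//.
  rewrite -[leRHS]mul1r ler_wpM2r ?powR_ge0// powRN invf_le1 ?powR_gt0 ?mulr_gt0//.
  rewrite -[leLHS](powRr0 (4 * pi)) ler_powR ?divr_ge0//.
  by have := pi_ge2 R; lra.
by rewrite ler_expR lerN2 ler_wpM2r ?invr_ge0 ?mulr_ge0 ?(ltW t0)// ler_pXn2r ?nnegrE ?norm_le_enorm// enorm_ge0.
Qed.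

Lemma heat_tent (f : 'rV[R]_n -> R) (x : 'rV[R]_n) (K sigma t : R) :
  measurable_fun setT f -> sigma < n%:R -> 0 <= K -> 0 < t ->
  (forall rho, 0 < rho ->
    (\int[mu]_(y in cube x rho) `|f y|%:E <= (K * rho `^ (n%:R - sigma))%:E)%E) ->
  (\int[mu]_y (`|f y| * heat_kernel t (x - y))%:E <=
   (tent_const 4 (n%:R - sigma) * K * t `^ (- (sigma / 2)))%:E)%E.
Proof.
move=> mf sn K0 t0 HK.
have mN : measurable_fun setT (fun y : 'rV[R]_n => `|x - y|).
  apply: (measurableT_comp (@measurable_rV_norm R n)); exact: measurable_rVB.
have mw : measurable_fun setT (fun y => `|f y|%:E).
  by apply/measurable_EFinP; exact: measurableT_comp.
apply: (@le_trans _ _ (\int[mu]_y ((t `^ (- (n%:R / 2)))%:E *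
   (`|f y|%:E * (expR (- (`|x - y| ^+ 2 / (4 * t))))%:E)))%E).
  apply: ge0_le_integral_nm => y _; first by rewrite lee_fin mulr_ge0 ?heat_kernel_ge0.
  by rewrite muleCA -!EFinM lee_fin ler_wpM2l// heat_kernel_le_sup.
rewrite integral_scale ?powR_ge0//; last first.
  apply: emeasurable_funM => //; apply/measurable_EFinP; apply: measurableT_comp => //.
  by apply: measurableT_comp => //; apply: measurable_funM => //; exact: measurable_funX.
have e0 : 0 < n%:R - sigma by rewrite subr_gt0.
have := @gaussian_tent _ _ _ mu (fun y => `|x - y|) (fun y => `|f y|%:E) K 4 (n%:R - sigma) t
  mN (fun=> normr_ge0 _) mw (fun=> _) _ e0 K0 t0 HK.
move=> /(_ (fun y => normr_ge0 (f y)) (ltr0n R 4)) h.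
apply: (le_trans (lee_wpmul2l _ h)); first by rewrite lee_fin powR_ge0.
rewrite -EFinM lee_fin mulrC -!mulrA -powRD; last by rewrite (gt_eqF t0) implybT.
by rewrite (_ : (n%:R - sigma) / 2 - n%:R / 2 = - (sigma / 2))//; lra.
Qed.

End heat_tent.

Section heat_difference.
Context {R : realType} {n : nat}.
Local Notation mu := (@lebesgue_rV R n).
Implicit Types (x y z w : 'rV[R]_n) (t s : R).

Lemma expRN_dist (a b : R) :
  `|expR (- a) - expR (- b)| <= `|a - b| * (expR (- a) + expR (- b)).
Proof.
wlog ab : a b / a <= b => [h|].
  have [/h//|/ltW/h] := leP a b.
  by rewrite distrC [`|b - a|]distrC [expR (- b) + _]addrC.
rewrite ger0_norm ?subr_ge0 ?ler_expR ?lerN2// distrC ger0_norm ?subr_ge0//.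
apply: (@le_trans _ _ ((b - a) * expR (- a))); last first.
  by rewrite ler_wpM2l ?subr_ge0// lerDl expR_ge0.
rewrite (_ : expR (- b) = expR (- a) * expR (- (b - a))); last by rewrite -expRD; congr expR; lra.
rewrite -{1}[expR (- a)]mulr1 -mulrBr mulrC ler_wpM2r ?expR_ge0//.
by have := expR_ge1Dx (- (b - a)); lra.
Qed.

(** Bounding a difference of exponentials by the difference of the exponents costs a factor of order
    (|w| + |w + z|) / sqrt t. Widening the Gaussian from t to 4 t absorbs the growth in w, and the
    exponential of |z|^2 / t absorbs the shift. *)
Lemma heat_kernel_difference t w z : 0 < t ->
  `|heat_kernel t (w + z) - heat_kernel t w| <=
  24 * n%:R * 4 `^ (n%:R / 2) * (enorm z / Num.sqrt t) *
  expR (2 * (enorm z ^+ 2 / t)) * heat_kernel (4 * t) w.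
Proof.
move=> t0; rewrite /heat_kernel -mulrBr normrM ger0_norm ?powR_ge0//.
have p0 := pi_gt0 R.
have -> : (4 * pi * t) `^ (- (n%:R / 2)) = 4 `^ (n%:R / 2) * (4 * pi * (4 * t)) `^ (- (n%:R / 2)).
  rewrite [4 * pi * (4 * t)]mulrCA [in RHS]powRM ?mulr_ge0 ?(ltW p0) ?(ltW t0)//.
  by rewrite mulrA [4 `^ (- _)]powRN mulfV ?mul1r// gt_eqF// powR_gt0.
set P := (_ * (4 * t)) `^ _; have P0 : 0 <= P by exact: powR_ge0.
set Q := 4 `^ (n%:R / 2); have Q0 : 0 <= Q by exact: powR_ge0.
set A := enorm w ^+ 2 / t; set B := enorm z ^+ 2 / t; set A' := enorm (w + z) ^+ 2 / t.
set S := Num.sqrt t; have S0 : 0 < S by rewrite sqrtr_gt0.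
have St : S ^+ 2 = t by rewrite sqr_sqrtr// ltW.
have A0 : 0 <= A by rewrite divr_ge0 ?sqr_ge0// ltW.
have B0 : 0 <= B by rewrite divr_ge0 ?sqr_ge0// ltW.
have A'0 : 0 <= A' by rewrite divr_ge0 ?sqr_ge0// ltW.
have e4 v : v / (4 * t) = v / t / 4 by rewrite invfM mulrA mulrAC.
have e16 v : v / (4 * (4 * t)) = v / t / 16.
  by rewrite (_ : 4 * (4 * t) = 16 * t) ?invfM ?mulrA ?[_ / 16 / t]mulrAC//; ring.
rewrite !e4 e16 -/A -/B -/A'.
have halves (a b : R) : 2 * (a / t) + 2 * (b / t) = (2 * a + 2 * b) / t by ring.
have hA' : A' <= 2 * A + 2 * B.
  rewrite /A' /A /B halves; apply: ler_wpM2r; first by rewrite invr_ge0 ltW.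
  exact: enormD_sqr.
have hA : A <= 2 * A' + 2 * B.
  rewrite /A' /A /B halves; apply: ler_wpM2r; first by rewrite invr_ge0 ltW.
  have -> : enorm w = enorm ((w + z) + (- z)) by rewrite addrK.
  by rewrite -(enormN z) enormD_sqr.
have hd : `|A' / 4 - A / 4| <= n%:R * (enorm z / S) * ((enorm w / S + enorm (w + z) / S) / 4).
  rewrite -mulrBl normrM [`|4^-1|]ger0_norm// [leRHS]mulrA ler_wpM2r//.
  rewrite /A' /A -mulrBl normrM [`|t^-1|]ger0_norm ?invr_ge0 ?(ltW t0)//.
  rewrite -mulrDl -[leRHS]mulrA [_ / S * (_ / S)]mulrACA -invfM -expr2 St mulrA.
  by apply: ler_wpM2r; [rewrite invr_ge0 ltW|exact: enorm_sqrB].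
have sq (v : 'rV[R]_n) : enorm v / S <= 1 + enorm v ^+ 2 / t.
  rewrite -St -expr_div_n; have := sqr_ge0 (enorm v / S - 1).
  by have := sqr_ge0 (enorm v / S); rewrite sqrrB expr1n mulr1 mulr2n; lra.
(* The share exp(A / 16) is affordable: times the factor exp(- A / 8) below it gives exp(- A / 16),
   the Gaussian at time 4 t. *)
have hsum : (enorm w / S + enorm (w + z) / S) <= 48 * (expR (A / 16) * expR B).
  have h1 := sq w; have h2 := sq (w + z); rewrite -/A in h1; rewrite -/A' in h2.
  apply: (@le_trans _ _ (48 * ((1 + A / 16) * (1 + B)))).
    have AB := mulr_ge0 A0 B0.
    by rewrite (_ : 48 * _ = 48 + 3 * A + 48 * B + 3 * (A * B)); [lra|field].
  rewrite ler_wpM2l// ler_pM ?expR_ge1Dx// ?addr_ge0// divr_ge0//.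
have hexp : expR (- (A' / 4)) + expR (- (A / 4)) <= 2 * (expR (- (A / 8)) * expR B).
  have -> : 2 * (expR (- (A / 8)) * expR B) = expR (- (A / 8) + B) + expR (- (A / 8) + B).
    by rewrite expRD; ring.
  by apply: lerD; rewrite ler_expR; lra.
have E1 : expR (- (A / 16 )) = expR (A / 16) * expR (- (A / 8)).
  by rewrite -expRD; congr expR; lra.
have E2 : expR (2 * B) = expR B * expR B by rewrite -expRD; congr expR; lra.
have nz : 0 <= n%:R * (enorm z / S) by rewrite mulr_ge0// divr_ge0 ?enorm_ge0 ?(ltW S0).
have main : `|expR (- (A' / 4)) - expR (- (A / 4))| <=
    n%:R * (enorm z / S) * ((48 * (expR (A / 16) * expR B)) / 4) * (2 * (expR (- (A / 8)) * expR B)).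
  apply: (le_trans (expRN_dist _ _)); apply: ler_pM => //.
  by apply: (le_trans hd); rewrite ler_wpM2l// ler_wpM2r.
rewrite E1 E2; apply: (le_trans (ler_wpM2l (mulr_ge0 Q0 P0) main)).
by rewrite le_eqVlt; apply/orP; left; apply/eqP; field; rewrite gt_eqF.
Qed.

End heat_difference.

(** * Riesz potentials as integrals of the heat semigroup *)

Section gamma.
Context {R : realType}.
Local Notation leb := (@lebesgue_measure R).

Lemma measurable_powR_itv (a : R) : measurable_fun setT (fun t : R => t `^ a).
Proof. by apply: measurable_fun_powR; exact: measurable_id. Qed.

(** The content is finiteness, since [Gamma] is a real-valued integral and would otherwise be a
    default value: t^(z - 1) is integrable at 0, and on ]1, +oo[ the exponential is below a multiple
    of t^(- (z + 1)). *)
Lemma GammaE (z : R) : 0 < z ->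
  (\int[leb]_(t in `]0%R, +oo[) (t `^ (z - 1) * expR (- t))%:E = (Gamma z)%:E)%E.
Proof.
move=> z0; rewrite /Gamma /Rintegral fineK// ge0_fin_numE; last first.
  by apply: integral_ge0 => t _; rewrite lee_fin mulr_ge0 ?powR_ge0 ?expR_ge0.
have -> : `]0%R, +oo[%classic = `]0%R, 1] `|` `]1%R, +oo[ :> set R.
  by rewrite -itv_bndbnd_setU ?bnd_simp.
rewrite ge0_integral_setU//=; last 3 first.
- apply/measurable_EFinP; apply: measurable_funTS; apply: measurable_funM.
    exact: measurable_powR_itv.
  by apply: measurableT_comp => //; exact: measurableT_comp.
- by move=> t _; rewrite lee_fin mulr_ge0 ?powR_ge0 ?expR_ge0.
- apply/disj_setPS => t [] /=; rewrite !in_itv/= andbT => /andP[_ t1] t1'.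
  by move: (le_lt_trans t1 t1'); rewrite ltxx.
have z1 : 0 < z + 1 by rewrite addr_gt0.
apply: lte_add_pinfty.
  have h : (\int[leb]_(t in `]0%R, 1%R]) (t `^ (z - 1) * expR (- t))%:E <=
      \int[leb]_(t in `]0%R, 1%R]) (t `^ (z - 1))%:E)%E.
    apply: ge0_le_integral_nm => t /=; rewrite in_itv/= => /andP[t0 _].
      by rewrite lee_fin mulr_ge0 ?powR_ge0 ?expR_ge0.
    by rewrite lee_fin -[leRHS]mulr1 ler_wpM2l ?powR_ge0// -expR0 ler_expR oppr_le0 ltW.
  apply: (le_lt_trans h).
  by apply: (le_lt_trans (integral_powR_low z0 ltr01)); rewrite ltry.
have h : (\int[leb]_(t in `]1%R, +oo[) (t `^ (z - 1) * expR (- t))%:E <= \int[leb]_(t in `]1%R, +oo[)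
    (((z + 1) `^ (z + 1))%:E * (t `^ (- 1 - 1))%:E))%E.
  apply: ge0_le_integral_nm => t /=; rewrite in_itv/= andbT => t1.
    by rewrite lee_fin mulr_ge0 ?powR_ge0 ?expR_ge0.
  have t0 : 0 < t by exact: lt_trans ltr01 t1.
  rewrite -EFinM lee_fin; apply: (le_trans (ler_wpM2l (powR_ge0 _ _) (expRN_le_powR z1 t0))).
  rewrite mulrCA ler_wpM2l ?powR_ge0// -powRD; last by rewrite (gt_eqF t0) implybT.
  by rewrite (_ : z - 1 - (z + 1) = - 1 - 1)//; lra.
apply: (le_lt_trans h).
rewrite integral_scale_set ?powR_ge0//; first last.
- by move=> t; rewrite lee_fin powR_ge0.
- by apply/measurable_EFinP; exact: measurable_powR_itv.
rewrite lte_mul_pinfty ?lee_fin ?powR_ge0//.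
by apply: (le_lt_trans (integral_powR_high ltr01 ltr01)); rewrite ltry.
Qed.

Lemma Gamma_ge0 (z : R) : 0 <= Gamma z.
Proof. by apply: Rintegral_ge0 => t _; rewrite mulr_ge0 ?powR_ge0 ?expR_ge0. Qed.

End gamma.

Section riesz.
Context {R : realType} {n : nat}.
Local Notation mu := (@lebesgue_rV R n).
Local Notation leb := (@lebesgue_measure R).
Implicit Types (x y z w : 'rV[R]_n) (s t : R) (f : 'rV[R]_n -> R).

(** [riesz_const] without the inverse of Gamma(s / 2), the factor that also stands in front of the
    heat representation. *)
Definition riesz_gamma s : R := Gamma ((n%:R - s) / 2) / (2 `^ s * pi `^ (n%:R / 2)).

Lemma riesz_gamma_ge0 s : 0 <= riesz_gamma s.
Proof. by rewrite divr_ge0 ?Gamma_ge0 ?mulr_ge0 ?powR_ge0. Qed.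

Lemma riesz_constE s : @riesz_const R n s = (Gamma (s / 2))^-1 * riesz_gamma s.
Proof. by rewrite /riesz_const /riesz_gamma invfM mulrA mulrC. Qed.

(** The inversion t -> c / t with c = |w|^2 / 4 turns the Gaussian into exp(- t) and leaves the
    Gamma integral at (n - s) / 2. *)
Lemma integral_heat_kernel_time s w : 0 < s -> s < n%:R -> 0 < enorm w ->
  (\int[leb]_(t in `]0%R, +oo[) (t `^ (s / 2 - 1) * heat_kernel t w)%:E =
   (riesz_gamma s * enorm w `^ (s - n%:R))%:E)%E.
Proof.
move=> s0 sn w0; set rho := enorm w in w0 *.
pose c := rho ^+ 2 / 4; have c0 : 0 < c by rewrite divr_gt0// exprn_gt0.
pose k := (4 * pi) `^ (- (n%:R / 2)) : R; have p0 := pi_gt0 R.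
(* The integrand as an exponential of [ln t] and [c / t], whose continuity on the half-line follows
   by composition. *)
pose G t := k * expR (((s - n%:R) / 2 - 1) * ln t - c / t).
have GE t : 0 < t -> t `^ (s / 2 - 1) * heat_kernel t w = G t.
  move=> t0; rewrite /heat_kernel -/rho powRM ?mulr_ge0 ?(ltW p0) ?(ltW t0)// -/k.
  rewrite !powR_expR// /G mulrCA -mulrA; congr (_ * _).
  rewrite mulrC -!expRD; congr expR.
  have -> : rho ^+ 2 / (4 * t) = c / t by rewrite /c invfM mulrA.
  by ring.
transitivity (\int[leb]_(t in `]0%R, +oo[) (G t)%:E)%E.
  by apply: eq_integral => t /set_mem/=; rewrite in_itv/= andbT => t0; rewrite GE.
rewrite (integral_inversion c0); first last.
- by move=> t t0; rewrite mulr_ge0 ?powR_ge0 ?expR_ge0.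
- move=> t; rewrite in_itv/= andbT => t0; have tN := lt0r_neq0 t0.
  apply: (@continuousM R R (cst k) _ t); first exact: cst_continuous.
  apply: continuous_comp; last exact: continuous_expR.
  apply: (@continuousB _ _ _ (fun t : R => ((s - n%:R) / 2 - 1) * ln t) (fun t : R => c / t)).
    apply: (@continuousM R R (cst _) (@ln R) t); first exact: cst_continuous.
    exact: continuous_ln.
  apply: (@continuousM R R (cst c) (fun t : R => t^-1) t); first exact: cst_continuous.
  exact: (@continuousV R R (fun y : R => y) t tN (fun A => id)).
pose a := k * c `^ ((s - n%:R) / 2).
transitivity (\int[leb]_(t in `]0%R, +oo[) (a%:E * (t `^ ((n%:R - s) / 2 - 1) * expR (- t))%:E))%E; last first.
  rewrite integral_scale_set ?mulr_ge0 ?powR_ge0//; first last.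
  - by move=> t; rewrite lee_fin mulr_ge0 ?powR_ge0 ?expR_ge0.
  - apply/measurable_EFinP; apply: measurable_funM; first exact: measurable_powR_itv.
    by apply: measurableT_comp => //; exact: measurableT_comp.
  rewrite GammaE ?divr_gt0 ?subr_gt0// -EFinM; congr EFin.
  rewrite /riesz_gamma mulrC -!mulrA; congr (_ * _).
  rewrite /a /k /c !powR_expR ?mulr_gt0 ?divr_gt0 ?exprn_gt0//.
  rewrite lnM ?posrE// ln_div ?posrE ?exprn_gt0// lnXn//.
  rewrite -[in RHS]expRD -expRN -!expRD; congr expR.
  have -> : (4 : R) = 2 ^+ 2 by rewrite -natrX.
  rewrite lnXn// -[ln 2 *+ 2]mulr_natl -[ln rho *+ 2]mulr_natl.
  move: (ln 2) (ln rho) (ln pi) => l2 lr lp; by field.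
apply: eq_integral => t /set_mem/=; rewrite in_itv/= andbT => t0; rewrite -EFinM; congr EFin.
rewrite /G /a -2!(mulrA k); congr (_ * _); have tN := lt0r_neq0 t0; have cN := lt0r_neq0 c0.
clearbody c.
have -> : c / (c / t) = t by field; rewrite cN tN.
rewrite !powR_expR// -[c / t ^+ 2]lnK ?posrE ?divr_gt0 ?exprn_gt0//.
rewrite !ln_div ?posrE ?exprn_gt0// lnXn// -!expRD; congr expR.
rewrite -[ln t *+ 2]mulr_natl; move: (ln t) (ln c) => lt lc; by field.
Qed.

(* The indicator is needed because the library has t `^ a = 1 for t < 0. *)
Definition tpow (a t : R) : R := t `^ a * \1_(`]0, +oo[%classic) t.

Lemma tpow_ge0 a t : 0 <= tpow a t. Proof. by rewrite mulr_ge0 ?powR_ge0. Qed.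

Lemma measurable_tpow a : measurable_fun setT (tpow a).
Proof. by apply: measurable_funM; [exact: measurable_powR_itv|exact: measurable_indic]. Qed.

Lemma tpowE a t : 0 < t -> tpow a t = t `^ a.
Proof. by move=> t0; rewrite /tpow indicE mem_set ?mulr1//= in_itv/= t0. Qed.

Lemma integral_tpow a (g : R -> R) :
  (\int[leb]_(t in `]0%R, +oo[) (t `^ a * g t)%:E = \int[leb]_t (tpow a t * g t)%:E)%E.
Proof.
rewrite integral_mkcond; apply: eq_integral => t _; rewrite patchE /tpow indicE.
by case: ifPn => _; rewrite ?mulr1// mulr0 mul0r.
Qed.

Lemma measurable_heat_integrand f : measurable_fun setT f ->
  measurable_fun setT (fun z : (R * 'rV[R]_n) * 'rV[R]_n =>
    f z.2 * heat_kernel z.1.1 (z.1.2 - z.2)).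
Proof.
move=> mf; apply: measurable_funM; first exact: measurableT_comp mf measurable_snd.
apply: measurable_heat_kernel; first exact: measurableT_comp measurable_fst measurable_fst.
apply: measurable_rVB; last exact: measurable_snd.
exact: measurableT_comp measurable_snd measurable_fst.
Qed.

Lemma measurable_heat f : measurable_fun setT f ->
  measurable_fun setT (fun z : R * 'rV[R]_n => heat (distribution_of f) z.1 z.2).
Proof.
move=> mf; have mi := measurable_heat_integrand mf.
apply: (@measurableT_comp _ _ _ _ _ _ fine) => //.
(* The integral is the difference of those of the positive and negative parts, to which Tonelli
   applies without integrability of f against the kernel. *)
pose g (z : R * 'rV[R]_n) y : \bar R := (f y * heat_kernel z.1 (z.2 - y))%:E.
rewrite (_ : (fun _ => _) = (fun z : (R * 'rV[R]_n)%type => \int[mu]_y (g z)^\+ y - \int[mu]_y (g z)^\- y)%E); last first.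
  by apply/funext => z; rewrite -integralE.
apply: emeasurable_funB.
- apply: (@tonelli_measurable _ _ _ _ _ mu (fun a y => (g a)^\+ y)%E); last by [].
  under eq_fun do rewrite funeposE.
  by apply: measurable_maxe => //; exact/measurable_EFinP.
- apply: (@tonelli_measurable _ _ _ _ _ mu (fun a y => (g a)^\- y)%E); last by [].
  under eq_fun do rewrite funenegE.
  by apply: measurable_maxe => //; apply: measurableT_comp => //; exact/measurable_EFinP.
Qed.

Lemma heat_abs_le f t x : measurable_fun setT f ->
  (`|heat (distribution_of f) t x|%:E <= \int[mu]_y (`|f y| * heat_kernel t (x - y))%:E)%E.
Proof.
move=> mf.
have mi : measurable_fun setT (fun y => (f y * heat_kernel t (x - y))%:E).
  apply/measurable_EFinP; apply: measurable_funM => //; apply: measurable_heat_kernel => //.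
  exact: measurable_rVB.
have -> : (\int[mu]_y (`|f y| * heat_kernel t (x - y))%:E =
    \int[mu]_y `|(f y * heat_kernel t (x - y))%:E|)%E.
  by apply: eq_integral => y _; rewrite abse_EFin normrM [`|heat_kernel _ _|]ger0_norm ?heat_kernel_ge0.
apply: le_trans (le_abse_integral mu measurableT mi).
(* If the integral is infinite, [fine] makes the heat flow 0 and the bound holds trivially. *)
rewrite heat_distribution_of /Rintegral; case: (\int[mu]_y _)%E => [r| |]//=.
- by rewrite normr0 leey.
- by rewrite normr0 leey.
Qed.

(** Where the Riesz integral converges absolutely, Fubini and [integral_heat_kernel_time] identify
    it with the heat representation, which is the definition elsewhere. From here on only the latter
    is used. *)
Lemma neg_laplacian_powE s f x : (0 < n)%N -> 0 < s -> s < n%:R -> measurable_fun setT f ->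
  neg_laplacian_pow s f x = ((Gamma (s / 2))^-1%:E *
    \int[leb]_(t in `]0%R, +oo[) (t `^ (s / 2 - 1) * heat (distribution_of f) t x)%:E)%E.
Proof.
move=> n0 s0 sn mf; rewrite /neg_laplacian_pow; case: asboolP => // ri.
rewrite riesz_constE EFinM -muleA; congr (_ * _)%E.
pose Phi (t : R) y := (tpow (s / 2 - 1) t * (f y * heat_kernel t (x - y)))%:E.
have mPhi : measurable_fun setT (fun z : R * 'rV[R]_n => Phi z.1 z.2).
  apply/measurable_EFinP; apply: measurable_funM.
    exact: measurableT_comp (measurable_tpow _) measurable_fst.
  apply: measurable_funM; first exact: measurableT_comp mf measurable_snd.
  apply: measurable_heat_kernel; first exact: measurable_fst.
  by apply: measurable_rVB => //; exact: measurable_snd.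
have xy : {ae mu, forall y, 0 < enorm (x - y)}.
  have := ae_rV_affine (- x) ltr01 (@ae_rV_neq0 R n n0).
  apply: filterS => y; rewrite scale1r addrC => xy.
  by rewrite -enormN opprB (lt_le_trans _ (norm_le_enorm _))// normr_gt0.
have riE y : 0 < enorm (x - y) -> riesz_integrand s f x y = f y * enorm (x - y) `^ (s - n%:R).
  by move=> _; rewrite /riesz_integrand -powRN opprB.
have itime y : 0 < enorm (x - y) ->
    (\int[leb]_t (tpow (s / 2 - 1) t * heat_kernel t (x - y))%:E =
     (riesz_gamma s * enorm (x - y) `^ (s - n%:R))%:E)%E.
  by move=> h; rewrite -integral_tpow integral_heat_kernel_time.
have th0 y t : 0 <= tpow (s / 2 - 1) t * heat_kernel t (x - y).
  by rewrite mulr_ge0 ?tpow_ge0 ?heat_kernel_ge0.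
have mth y : measurable_fun setT (fun t => (tpow (s / 2 - 1) t * heat_kernel t (x - y))%:E).
  apply/measurable_EFinP; apply: measurable_funM; first exact: measurable_tpow.
  exact: measurable_heat_kernel.
have PhiE t y : Phi t y = ((f y)%:E * (tpow (s / 2 - 1) t * heat_kernel t (x - y))%:E)%E.
  by rewrite /Phi -EFinM mulrCA.
have iPhi : (leb \x mu)%E.-integrable setT (fun a : R * 'rV[R]_n => Phi a.1 a.2).
  apply/integrable21ltyP => //.
  have mri := measurable_int _ ri.
  have mg : measurable_fun setT (fun y => (riesz_gamma s)%:E * `|(riesz_integrand s f x y)%:E|)%E.
    by apply: emeasurable_funM => //; exact: measurableT_comp.
  have h : (\int[mu]_y \int[leb]_t `|Phi t y| <=
      \int[mu]_y ((riesz_gamma s)%:E * `|(riesz_integrand s f x y)%:E|))%E.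
    apply: ge0_ae_le_integral_nm => //.
    - by move=> y; exact: integral_ge0.
    - by move=> y; rewrite mule_ge0// lee_fin riesz_gamma_ge0.
    apply: filterS xy => y xy.
    under eq_integral => t _.
      rewrite PhiE abseM !abse_EFin (ger0_norm (th0 _ _)); over.
    rewrite integral_scale//; last 2 first.
    - exact: mth.
    - by move=> t; rewrite lee_fin.
    rewrite itime//.
    rewrite riE// abse_EFin normrM (ger0_norm (powR_ge0 _ _)) -!EFinM lee_fin.
    by rewrite mulrCA.
  apply: (le_lt_trans h); rewrite integral_scale ?riesz_gamma_ge0//; last exact: measurableT_comp.
  rewrite lte_mul_pinfty ?lee_fin ?riesz_gamma_ge0//.
  by case/integrableP: ri.
transitivity (\int[mu]_y \int[leb]_t Phi t y)%E.
  rewrite -integralZl//; apply: ae_eq_integral => //.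
  - by apply: measurable_funeM; exact: measurable_int ri.
  - exact: (measurable_fubini_G iPhi).
  - apply: filterS xy => y xy _; rewrite riE//.
    under [RHS]eq_integral do rewrite PhiE.
    rewrite integralZl//; first by rewrite itime// -!EFinM mulrCA.
    apply/integrableP; split; first exact: mth.
    under eq_integral do rewrite abse_EFin (ger0_norm (th0 _ _)).
    by rewrite itime// ltry.
rewrite -(Fubini iPhi) integral_tpow; apply: ae_eq_integral => //.
- exact: (measurable_fubini_F iPhi).
- apply/measurable_EFinP; apply: measurable_funM; first exact: measurable_tpow.
  exact: (measurableT_comp (measurable_heat mf) (pair2_measurable x)).
have := ae_integrable1 iPhi; apply: filterS => t it _.
(* For t <= 0 the weight [tpow] vanishes, and so do both sides. *)
have [t0|t0] := ltP 0 t; last first.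
  have tp0 : tpow (s / 2 - 1) t = 0.
    by rewrite /tpow indicE memNset ?mulr0//= in_itv/= andbT; apply/negP; rewrite -leNgt.
  rewrite tp0 mul0r; under eq_integral do rewrite /Phi tp0 mul0r.
  exact: integral0.
have tp : 0 < tpow (s / 2 - 1) t by rewrite tpowE// powR_gt0.
(* Dividing by the positive weight gives integrability in y at this time, so [fine] inside [heat]
   loses nothing. *)
have ifh : mu.-integrable setT (fun y => (f y * heat_kernel t (x - y))%:E).
  have := integrableZl measurableT (tpow (s / 2 - 1) t)^-1 it.
  apply: eq_integrable => // y _ /=; rewrite /Phi -EFinM; congr EFin.
  by rewrite mulKf// gt_eqF.
transitivity ((tpow (s / 2 - 1) t)%:E * \int[mu]_y (f y * heat_kernel t (x - y))%:E)%E.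
  by rewrite -integralZl//; apply: eq_integral => y _; rewrite /Phi EFinM.
rewrite [RHS]EFinM heat_distribution_of /Rintegral fineK//.
exact: integrable_fin_num ifh.
Qed.

End riesz.

(** * Optimisation over the splitting time and pointwise bounds *)

Section optimisation.
Context {R : realType}.

(** The two terms balance at T = (B / K)^(1 / (a + b)), and the dyadic time just below loses at most
    2^b. If K or B is 0, k is sent to +oo or to -oo. Only dyadic times are tested, so that the
    hypothesis may come from countably many almost everywhere statements. *)
Lemma dyadic_optimisation (v : \bar R) (K B a b : R) :
  0 < a -> 0 < b -> 0 <= K -> 0 <= B ->
  (forall k : int, (v <= (dyad k `^ a * K + dyad k `^ (- b) * B)%:E)%E) ->
  (v <= ((1 + 2 `^ b) * (K `^ (b / (a + b)) * B `^ (a / (a + b))))%:E)%E.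
Proof.
move=> a0 b0 K0 B0 h; have ab0 : 0 < a + b by rewrite addr_gt0.
have abN := lt0r_neq0 ab0; have aN := lt0r_neq0 a0; have bN := lt0r_neq0 b0.
have root c (y : R) : 0 < c -> 0 < y -> (y `^ c^-1) `^ c = y.
  by move=> c0 y0; rewrite -powRrM mulVf ?gt_eqF// powRr1// ltW.
have small : (forall e, 0 < e -> (v <= e%:E)%E) -> (v <= 0)%E.
  by move=> hv; apply/lee_addgt0Pr => e e0; rewrite add0e; exact: hv.
have [K_eq0|Kp] := eqVneq K 0.
  rewrite K_eq0 powR0 ?mulf_neq0 ?invr_neq0// mul0r mulr0; apply: small => e e0.
  have [B_eq0|Bp] := eqVneq B 0.
    by apply: (le_trans (h 0)); rewrite K_eq0 B_eq0 !mulr0 addr0 lee_fin ltW.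
  have Bpos : 0 < B by rewrite lt_neqAle eq_sym Bp.
  have y0 : 0 < (B / e) `^ b^-1 by rewrite powR_gt0// divr_gt0.
  have [k [_ k2]] := dyadic_int y0.
  apply: (le_trans (h (k + 1))); rewrite K_eq0 mulr0 add0r lee_fin powRN dyadS.
  rewrite mulrC ler_pdivrMr ?powR_gt0 ?mulr_gt0 ?dyad_gt0// mulrC -ler_pdivrMr//.
  by rewrite -(root b (B / e)) ?divr_gt0// le_powR ?(ltW y0) ?(ltW b0).
have Kpos : 0 < K by rewrite lt_neqAle eq_sym Kp.
have [B_eq0|Bp] := eqVneq B 0.
  rewrite B_eq0 [0 `^ _]powR0 ?mulf_neq0 ?invr_neq0// !mulr0; apply: small => e e0.
  have y0 : 0 < (e / K) `^ a^-1 by rewrite powR_gt0// divr_gt0.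
  have [k [k1 _]] := dyadic_int y0.
  apply: (le_trans (h k)); rewrite B_eq0 mulr0 addr0 lee_fin -ler_pdivlMr//.
  by rewrite -(root a (e / K)) ?divr_gt0// le_powR ?(ltW (dyad_gt0 _)) ?(ltW a0) ?(ltW k1).
have Bpos : 0 < B by rewrite lt_neqAle eq_sym Bp.
pose T := (B / K) `^ (a + b)^-1.
have T0 : 0 < T by rewrite powR_gt0// divr_gt0.
have [k [k1 k2]] := dyadic_int T0.
apply: (le_trans (h k)); rewrite lee_fin mulrDl mul1r.
have E1 : T `^ a * K = K `^ (b / (a + b)) * B `^ (a / (a + b)).
  rewrite /T -powRrM powR_expR ?divr_gt0// ln_div ?posrE// !powR_expR//.
  rewrite -[X in _ * X = _](lnK Kpos) -!expRD; congr expR; field.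
  by rewrite ?abN.
have E2 : T `^ (- b) * B = K `^ (b / (a + b)) * B `^ (a / (a + b)).
  rewrite /T -powRrM powR_expR ?divr_gt0// ln_div ?posrE// !powR_expR//.
  rewrite -[X in _ * X = _](lnK Bpos) -!expRD; congr expR; field.
  by rewrite ?abN.
apply: lerD.
  by rewrite -E1 ler_wpM2r// le_powR ?(ltW a0) ?(ltW (dyad_gt0 _)) ?(ltW k1).
have dk : 0 < dyad k :> R by exact: dyad_gt0.
rewrite -E2 mulrA ler_wpM2r// !powRN.
have Tb : 0 < T `^ b by exact: powR_gt0.
have db : 0 < dyad k `^ b by exact: powR_gt0.
rewrite (ler_pdivlMr _ _ Tb) [X in X <= _]mulrC (ler_pdivrMr _ _ db).
by rewrite -powRM ?(ltW dk)// le_powR ?(ltW T0) ?(ltW b0).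
Qed.

End optimisation.

Section besov.
Context {R : realType} {n : nat}.
Local Notation mu := (@lebesgue_rV R n).
Local Notation leb := (@lebesgue_measure R).

(** [Lnorm] at the exponent +oo is an essential supremum only when the whole space has positive
    measure. *)
Lemma lebesgue_rV_setT_gt0 : (0 < mu setT)%E.
Proof.
apply: (@lt_le_trans _ _ (mu (cube 0 1))).
  by rewrite [ltRHS](_ : _ = ((2 * 1) ^+ n)%:E) ?lebesgue_cube// lte_fin exprn_gt0// mulr1.
by apply: le_measure; rewrite ?inE//; exact: measurable_cube.
Qed.

Lemma besov_heat_le (delta B t : R) (T : ('rV[R]_n -> R) -> R) : 0 < t ->
  (besov_norm delta T <= B%:E)%E ->
  {ae mu, forall x, `|heat T t x| <= B * t `^ (- (delta / 2))}.
Proof.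
move=> t0 hB.
have h : ((t `^ (delta / 2))%:E * Lnorm mu +oo%E (EFin \o heat T t) <= B%:E)%E.
  by apply: le_trans hB; apply: ereal_sup_ubound; exists t.
have {}h : (Lnorm mu +oo%E (EFin \o heat T t) <= (B * t `^ (- (delta / 2)))%:E)%E.
  have tp : 0 < t `^ (delta / 2) by rewrite powR_gt0.
  rewrite powRN EFinM lee_pdivlMr//.
  by rewrite muleC.
move: h; rewrite unlock /= lebesgue_rV_setT_gt0 => h.
have := ess_sup_ge mu (abse \o (EFin \o heat T t)); apply: filterS => x hx.
by rewrite -lee_fin; exact: le_trans hx h.
Qed.

Lemma besov_norm_ge0 (dl : R) (T : ('rV[R]_n -> R) -> R) : (0 <= besov_norm dl T)%E.
Proof.
apply: le_ereal_sup_tmp.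
exists ((1 `^ (dl / 2))%:E * Lnorm mu +oo%E (EFin \o heat T 1))%E.
  by exists 1 => //=; exact: ltr01.
by rewrite mule_ge0 ?lee_fin ?powR_ge0// Lnorm_ge0.
Qed.

Lemma besov_bound_ge0 (dl B : R) (T : ('rV[R]_n -> R) -> R) :
  (besov_norm dl T <= B%:E)%E -> 0 <= B.
Proof. by move=> h; rewrite -lee_fin; exact: le_trans (besov_norm_ge0 dl T) h. Qed.

Lemma besov_norm_finite (dl : R) (T : ('rV[R]_n -> R) -> R) :
  (besov_norm dl T < +oo)%E -> exists2 B : R, 0 <= B & besov_norm dl T = B%:E.
Proof.
move=> h; exists (fine (besov_norm dl T)); first by rewrite fine_ge0// besov_norm_ge0.
by rewrite fineK// ge0_fin_numE// besov_norm_ge0.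
Qed.

(* For each t the bound holds off a null set of x depending on t; Tonelli on the
   exceptional set makes it hold, for almost every x, at almost every t. *)
Lemma integral_heat_tail (s dl B : R) (f : 'rV[R]_n -> R) :
  measurable_fun setT f -> s < dl -> (besov_norm dl (distribution_of f) <= B%:E)%E ->
  {ae mu, forall x, forall T, 0 < T ->
    (\int[leb]_(t in `]T, +oo[) (t `^ (s / 2 - 1) * `|heat (distribution_of f) t x|)%:E <=
     (shell_const 1 (1 + (dl - s) / 2) * B * T `^ (- ((dl - s) / 2)))%:E)%E}.
Proof.
move=> mf sd hB.
have B0 := besov_bound_ge0 hB.
pose bad (t : R) (x : 'rV[R]_n) : R :=
  ((0 < t) && (B * t `^ (- (dl / 2)) < `|heat (distribution_of f) t x|))%:R.
have mH := measurable_heat mf.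
have mbad : measurable_fun setT (fun a : R * 'rV[R]_n => (bad a.1 a.2)%:E).
  apply/measurable_EFinP.
  pose S1 := [set a : R * 'rV[R]_n | 0 < a.1].
  pose S2 := [set a : R * 'rV[R]_n | `|heat (distribution_of f) a.1 a.2| <= B * a.1 `^ (- (dl / 2))].
  rewrite (_ : (fun _ => _) = \1_(S1 `&` ~` S2)); last first.
    apply/funext => a; rewrite indicE /bad; congr (_ %:R); congr nat_of_bool.
    apply/idP/idP => [/andP[h1 h2]|/set_mem[h1 h2]].
      by apply/mem_set; split => //=; apply/negP; rewrite -ltNge.
    by rewrite h1/= ltNge; apply/negP.
  apply: measurable_indic; apply: measurableI.
    rewrite (_ : S1 = ~` [set a : R * 'rV[R]_n | a.1 <= 0]).
      apply: measurableC; rewrite -[X in measurable X]setTI.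
      exact: measurable_fun_le.
    by apply/seteqP; split => a /=; rewrite /S1/= ltNge => /negP.
  apply: measurableC; rewrite -[X in measurable X]setTI.
  apply: measurable_fun_le => //; first exact: measurableT_comp.
  apply: measurable_funM => //.
  exact: (measurable_fun_powR _ measurable_fst).
have bad0 t x : (0 <= (bad t x)%:E)%E by rewrite lee_fin /bad.
have int0 : (\int[mu]_x \int[leb]_t (bad t x)%:E = 0)%E.
  rewrite -(tonelli_swap leb mu mbad bad0).
  rewrite integral0_eq// => t _.
  have [t0|t0] := ltP 0 t; last first.
    by apply: integral0_eq => x _; rewrite /bad ltNge t0.
  apply/eqP; rewrite eq_le integral_ge0 ?andbT//.
  rewrite -(integral0 mu setT); apply: ge0_ae_le_integral_nm => //.
  have := besov_heat_le t0 hB; apply: filterS => x hx.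
  by rewrite /bad t0/= ltNge hx.
have mG : measurable_fun setT (fun x => \int[leb]_t (bad t x)%:E)%E.
  apply: (@tonelli_measurable _ _ _ _ _ leb (fun x t => (bad t x)%:E)) => //.
  exact: (measurableT_comp mbad (@measurable_swap _ _ _ _)).
have aeG : {ae mu, forall x, (\int[leb]_t (bad t x)%:E = 0)%E}.
  have e : (\int[mu]_x `|\int[leb]_t (bad t x)%:E| = 0)%E.
    rewrite -int0; apply: eq_integral => x _; rewrite gee0_abs//; exact: integral_ge0.
  by have := (ae_eq_integral_abs mu measurableT mG).1 e; apply: filterS => x; exact.
apply: filterS aeG => x hx T T0.
have mbx : measurable_fun setT (fun t => (bad t x)%:E).
  exact: (measurableT_comp mbad (pair2_measurable x)).
have aet : {ae leb, forall t, bad t x = 0}.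
  have e : (\int[leb]_t `|(bad t x)%:E| = 0)%E.
    by rewrite -hx; apply: eq_integral => t _; rewrite gee0_abs.
  by have := (ae_eq_integral_abs leb measurableT mbx).1 e; apply: filterS => t /(_ I)/= [].
have d0 : 0 < (dl - s) / 2 by rewrite divr_gt0// subr_gt0.
pose g t := ((B * t `^ (- ((dl - s) / 2) - 1))%:E : \bar R).
apply: (@le_trans _ _ (\int[leb]_(t in `]T, +oo[) g t)%E).
  rewrite integral_mkcond [leRHS]integral_mkcond; apply: ge0_ae_le_integral_nm.
  - move=> t; apply: erestrict_ge0 => {}t _; by rewrite lee_fin mulr_ge0 ?powR_ge0.
  - move=> t; apply: erestrict_ge0 => {}t _; by rewrite lee_fin mulr_ge0 ?powR_ge0.
  - apply/(measurable_restrictT _ _).1 => //; apply: measurable_funTS; apply/measurable_EFinP.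
    by apply: measurable_funM => //; exact: measurable_powR_itv.
  apply: (negligibleS _ aet) => t /=; apply: contra_not => ht; rewrite !patchE; case: ifPn => // /set_mem/=.
  rewrite in_itv/= andbT => Tt; have t0 : 0 < t by exact: lt_trans Tt.
  have hle : `|heat (distribution_of f) t x| <= B * t `^ (- (dl / 2)).
    rewrite leNgt; apply/negP => hlt; move: ht; rewrite /bad t0 hlt => /eqP.
    by rewrite oner_eq0.
  rewrite lee_fin.
  apply: (le_trans (ler_wpM2l (powR_ge0 _ _) hle)).
  rewrite mulrCA -powRD; last by rewrite (gt_eqF t0) implybT.
  by rewrite (_ : s / 2 - 1 - dl / 2 = - ((dl - s) / 2) - 1)//; lra.
under eq_integral do rewrite /g EFinM.
rewrite integral_scale_set//; first last.
- by move=> t; rewrite lee_fin powR_ge0.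
- by apply/measurable_EFinP; exact: measurable_powR_itv.
rewrite [_ * B]mulrC -mulrA EFinM lee_wpmul2l ?lee_fin//.
exact: integral_powR_high.
Qed.

End besov.

Section pointwise.
Context {R : realType} {n : nat}.
Local Notation mu := (@lebesgue_rV R n).
Local Notation leb := (@lebesgue_measure R).
Implicit Types (f : 'rV[R]_n -> R) (x : 'rV[R]_n).

Definition cube_bounded f x (K e : R) : Prop := forall rho : R, 0 < rho ->
  (\int[mu]_(y in cube x rho) `|f y|%:E <= (K * rho `^ e)%:E)%E.

Lemma heat_cube_le f x (K sigma t : R) :
  measurable_fun setT f -> sigma < n%:R -> 0 <= K -> 0 < t ->
  cube_bounded f x K (n%:R - sigma) ->
  `|heat (distribution_of f) t x| <= tent_const 4 (n%:R - sigma) * K * t `^ (- (sigma / 2)).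
Proof.
move=> mf sn K0 t0 h; rewrite -lee_fin; apply: (le_trans (heat_abs_le t x mf)).
exact: heat_tent.
Qed.

Lemma integral_heat_low f x (K sigma s T : R) :
  measurable_fun setT f -> sigma < n%:R -> sigma < s -> 0 <= K -> 0 < T ->
  cube_bounded f x K (n%:R - sigma) ->
  (\int[leb]_(t in `]0%R, T]) (t `^ (s / 2 - 1) * `|heat (distribution_of f) t x|)%:E <=
   (tent_const 4 (n%:R - sigma) * shell_const 1 (1 - (s - sigma) / 2) * K *
    T `^ ((s - sigma) / 2))%:E)%E.
Proof.
move=> mf sn ss K0 T0 h; have a0 : 0 < (s - sigma) / 2 by rewrite divr_gt0// subr_gt0.
have c0 := tent_const_gt0 4 (n%:R - sigma).
apply: (@le_trans _ _ (\int[leb]_(t in `]0%R, T])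
   ((tent_const 4 (n%:R - sigma) * K)%:E * (t `^ ((s - sigma) / 2 - 1))%:E))%E).
  apply: ge0_le_integral_nm => t /=; rewrite in_itv/= => /andP[t0 _].
    by rewrite lee_fin mulr_ge0 ?powR_ge0.
  rewrite -EFinM lee_fin.
  apply: (le_trans (ler_wpM2l (powR_ge0 _ _) (heat_cube_le mf sn K0 t0 h))).
  rewrite mulrCA -powRD; last by rewrite (gt_eqF t0) implybT.
  by rewrite (_ : s / 2 - 1 - sigma / 2 = (s - sigma) / 2 - 1)//; lra.
rewrite integral_scale_set ?mulr_ge0 ?(ltW c0)//; first last.
- by move=> t; rewrite lee_fin powR_ge0.
- by apply/measurable_EFinP; exact: measurable_powR_itv.
apply: (le_trans (lee_wpmul2l _ (integral_powR_low a0 T0))).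
  by rewrite lee_fin mulr_ge0// ltW.
by rewrite -EFinM lee_fin le_eqVlt; apply/orP; left; apply/eqP; ring.
Qed.

Lemma integral_heat_high f x (K sigma s T : R) :
  measurable_fun setT f -> sigma < n%:R -> s < sigma -> 0 <= K -> 0 < T ->
  cube_bounded f x K (n%:R - sigma) ->
  (\int[leb]_(t in `]T, +oo[) (t `^ (s / 2 - 1) * `|heat (distribution_of f) t x|)%:E <=
   (tent_const 4 (n%:R - sigma) * shell_const 1 (1 + (sigma - s) / 2) * K *
    T `^ (- ((sigma - s) / 2)))%:E)%E.
Proof.
move=> mf sn ss K0 T0 h; have a0 : 0 < (sigma - s) / 2 by rewrite divr_gt0// subr_gt0.
have c0 := tent_const_gt0 4 (n%:R - sigma).
apply: (@le_trans _ _ (\int[leb]_(t in `]T, +oo[)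
   ((tent_const 4 (n%:R - sigma) * K)%:E * (t `^ (- ((sigma - s) / 2) - 1))%:E))%E).
  apply: ge0_le_integral_nm => t /=; rewrite in_itv/= andbT => Tt.
    by rewrite lee_fin mulr_ge0 ?powR_ge0.
  have t0 : 0 < t by exact: lt_trans Tt.
  rewrite -EFinM lee_fin.
  apply: (le_trans (ler_wpM2l (powR_ge0 _ _) (heat_cube_le mf sn K0 t0 h))).
  rewrite mulrCA -powRD; last by rewrite (gt_eqF t0) implybT.
  by rewrite (_ : s / 2 - 1 - sigma / 2 = - ((sigma - s) / 2) - 1)//; lra.
rewrite integral_scale_set ?mulr_ge0 ?(ltW c0)//; first last.
- by move=> t; rewrite lee_fin powR_ge0.
- by apply/measurable_EFinP; exact: measurable_powR_itv.
apply: (le_trans (lee_wpmul2l _ (integral_powR_high a0 T0))).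
  by rewrite lee_fin mulr_ge0// ltW.
by rewrite -EFinM lee_fin le_eqVlt; apply/orP; left; apply/eqP; ring.
Qed.

Lemma integral_split_le (g : R -> R) (T A B : R) : 0 < T ->
  measurable_fun setT g ->
  (\int[leb]_(t in `]0%R, T]) `|g t|%:E <= A%:E)%E ->
  (\int[leb]_(t in `]T, +oo[) `|g t|%:E <= B%:E)%E ->
  (`|\int[leb]_(t in `]0%R, +oo[) (g t)%:E| <= (A + B)%:E)%E.
Proof.
move=> T0 mg hA hB.
have mgE (S : set (measurableTypeR R)) : measurable_fun S (fun t => (g t)%:E).
  by apply/measurable_EFinP; exact: measurable_funTS.
apply: (le_trans (le_abse_integral _ _ (mgE _))) => //.
have -> : `]0%R, +oo[%classic = `]0%R, T] `|` `]T, +oo[ :> set R.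
  by rewrite -itv_bndbnd_setU ?bnd_simp// ltW.
rewrite ge0_integral_setU//=; first by rewrite EFinD; exact: leeD.
- by apply/measurable_EFinP; apply: measurable_funTS; exact: measurableT_comp.
- apply/disj_setPS => t [] /=; rewrite !in_itv/= andbT => /andP[_ t1] t1'.
  by move: (le_lt_trans t1 t1'); rewrite ltxx.
Qed.

Lemma neg_laplacian_split f x (s T A B : R) : (0 < n)%N -> 0 < s -> s < n%:R ->
  measurable_fun setT f -> 0 < T ->
  (\int[leb]_(t in `]0%R, T]) (t `^ (s / 2 - 1) * `|heat (distribution_of f) t x|)%:E <= A%:E)%E ->
  (\int[leb]_(t in `]T, +oo[) (t `^ (s / 2 - 1) * `|heat (distribution_of f) t x|)%:E <= B%:E)%E ->
  (`|neg_laplacian_pow s f x| <= ((Gamma (s / 2))^-1 * (A + B))%:E)%E.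
Proof.
move=> n0 s0 sn mf T0 hA hB; rewrite neg_laplacian_powE// abseM abse_EFin.
rewrite ger0_norm ?invr_ge0 ?Gamma_ge0// EFinM lee_wpmul2l ?lee_fin ?invr_ge0 ?Gamma_ge0//.
apply: (integral_split_le (g := fun t => t `^ (s / 2 - 1) * heat (distribution_of f) t x) T0).
- apply: measurable_funM; first exact: measurable_powR_itv.
  exact: (measurableT_comp (measurable_heat mf) (pair2_measurable x)).
- apply: le_trans hA; rewrite le_eqVlt; apply/orP; left; apply/eqP; apply: eq_integral => t _.
  by rewrite normrM (ger0_norm (powR_ge0 _ _)).
- apply: le_trans hB; rewrite le_eqVlt; apply/orP; left; apply/eqP; apply: eq_integral => t _.
  by rewrite normrM (ger0_norm (powR_ge0 _ _)).
Qed.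

(** K is quantified inside the almost everywhere statement, so that it may later be the value N(x)
    of the majorant; the exceptional set comes from the Besov tail alone. *)
Lemma neg_laplacian_besov_le (s sigma dl : R) : (0 < n)%N -> 0 < s -> s < n%:R ->
  sigma < s -> s < dl -> exists2 C : R, 0 < C & forall f (B : R), measurable_fun setT f ->
  (besov_norm dl (distribution_of f) <= B%:E)%E ->
  {ae mu, forall x, forall K, 0 <= K -> cube_bounded f x K (n%:R - sigma) ->
   (`|neg_laplacian_pow s f x| <= (C * (K `^ ((dl - s) / (dl - sigma)) *
      B `^ ((s - sigma) / (dl - sigma))))%:E)%E}.
Proof.
move=> n0 s0 sn ss sd.
pose a := (s - sigma) / 2; pose b := (dl - s) / 2.
have a0 : 0 < a by rewrite divr_gt0// subr_gt0.
have b0 : 0 < b by rewrite divr_gt0// subr_gt0.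
have abE : a + b = (dl - sigma) / 2 by rewrite /a /b -mulrDl addrC subrKA.
have dN : dl - sigma != 0 by rewrite gt_eqF// subr_gt0 (lt_trans ss).
have Eb : (dl - s) / (dl - sigma) = b / (a + b) by rewrite abE /b; field.
have Ea : (s - sigma) / (dl - sigma) = a / (a + b) by rewrite abE /a; field.
pose c1 := tent_const 4 (n%:R - sigma) * shell_const 1 (1 - (s - sigma) / 2).
pose c2 := shell_const 1 (1 + (dl - s) / 2) : R.
have c10 : 0 < c1.
  by rewrite mulr_gt0 ?tent_const_gt0// shell_const_gt0// gt_eqF// gtrBl.
have c20 : 0 < c2 by rewrite shell_const_gt0// lt_eqF// ltrDl.
pose G := (Gamma (s / 2))^-1 : R; have G0 : 0 <= G by rewrite invr_ge0 Gamma_ge0.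
(* G is known here to be nonnegative; adding 1 makes c positive. *)
pose c := G * Num.max c1 c2 + 1.
have c0 : 0 < c by rewrite ltr_wpDl// mulr_ge0// le_max (ltW c10).
have cc1 : G * c1 <= c by rewrite ler_wpDr// ler_wpM2l// le_max lexx.
have cc2 : G * c2 <= c by rewrite ler_wpDr// ler_wpM2l// le_max lexx orbT.
exists ((1 + 2 `^ b) * c).
  by rewrite mulr_gt0// ltr_wpDr// powR_ge0.
move=> f B mf hB; have B0 := besov_bound_ge0 hB.
have := integral_heat_tail mf sd hB; apply: filterS => x tail K K0 hK.
have := @dyadic_optimisation R `|neg_laplacian_pow s f x|%E (c * K) (c * B) a b a0 b0.
rewrite !mulr_ge0 ?(ltW c0)// => /(_ isT isT) h.
rewrite Ea Eb; apply: (le_trans (h _)).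
  move=> k; have T0 : 0 < dyad k :> R by exact: dyad_gt0.
  apply: (le_trans (neg_laplacian_split n0 s0 sn mf T0
     (integral_heat_low mf (lt_trans ss sn) ss K0 T0 hK) (tail _ T0))).
  rewrite lee_fin -/a -/b -/c1 -/c2 -/G mulrDr; apply: lerD.
    rewrite (_ : G * _ = G * c1 * (dyad k `^ a * K)); last by ring.
    by rewrite [leRHS]mulrCA ler_wpM2r ?mulr_ge0 ?powR_ge0.
  rewrite (_ : G * _ = G * c2 * (dyad k `^ (- b) * B)); last by ring.
  by rewrite [leRHS]mulrCA ler_wpM2r ?mulr_ge0 ?powR_ge0.
rewrite lee_fin !powRM ?(ltW c0)// mulrACA -powRD; last by rewrite (gt_eqF c0) implybT.
have -> : b / (a + b) + a / (a + b) = 1 by rewrite -mulrDl addrC divff// abE mulf_neq0// invr_neq0.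
by rewrite powRr1 ?(ltW c0)// -[leRHS]mulrA.
Qed.

(** The regularity s + ep controls the large times, as the Besov norm does for theta < 1. The
    symmetric choice around s makes both exponents 1/2. *)
Lemma neg_laplacian_two_le (s ep : R) : (0 < n)%N -> 0 < s -> s < n%:R ->
  0 < ep -> s + ep < n%:R -> exists2 C : R, 0 < C & forall f x (K1 K2 : R), measurable_fun setT f ->
  0 <= K1 -> 0 <= K2 -> cube_bounded f x K1 (n%:R - (s - ep)) ->
  cube_bounded f x K2 (n%:R - (s + ep)) ->
   (`|neg_laplacian_pow s f x| <= (C * (K1 `^ (2^-1) * K2 `^ (2^-1)))%:E)%E.
Proof.
move=> n0 s0 sn ep0 sen.
pose a := ep / 2; have a0 : 0 < a by rewrite divr_gt0.
have aE : a / (a + a) = 2^-1 by have aN := lt0r_neq0 a0; rewrite (_ : a + a = 2 * a); [field|ring].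
have a1 : (s - (s - ep)) / 2 = a by rewrite /a opprB addrC subrK.
have a2 : (s + ep - s) / 2 = a by rewrite /a addrAC subrr add0r.
have ss1 : s - ep < s by rewrite gtrBl.
have ss2 : s < s + ep by rewrite ltrDl.
pose c1 := tent_const 4 (n%:R - (s - ep)) * shell_const 1 (1 - a).
pose c2 := tent_const 4 (n%:R - (s + ep)) * shell_const 1 (1 + a).
have c10 : 0 < c1.
  by rewrite mulr_gt0 ?tent_const_gt0// shell_const_gt0// gt_eqF// gtrBl.
have c20 : 0 < c2 by rewrite mulr_gt0 ?tent_const_gt0// shell_const_gt0// lt_eqF// ltrDl.
pose G := (Gamma (s / 2))^-1 : R; have G0 : 0 <= G by rewrite invr_ge0 Gamma_ge0.
pose c := G * Num.max c1 c2 + 1.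
have c0 : 0 < c by rewrite ltr_wpDl// mulr_ge0// le_max (ltW c10).
have cc1 : G * c1 <= c by rewrite ler_wpDr// ler_wpM2l// le_max lexx.
have cc2 : G * c2 <= c by rewrite ler_wpDr// ler_wpM2l// le_max lexx orbT.
exists ((1 + 2 `^ a) * c).
  by rewrite mulr_gt0// ltr_wpDr// powR_ge0.
move=> f x K1 K2 mf K10 K20 h1 h2.
have := @dyadic_optimisation R `|neg_laplacian_pow s f x|%E (c * K1) (c * K2) a a a0 a0.
rewrite !mulr_ge0 ?(ltW c0)// aE => /(_ isT isT) h.
apply: (le_trans (h _)).
  move=> k; have T0 : 0 < dyad k :> R by exact: dyad_gt0.
  apply: (le_trans (neg_laplacian_split n0 s0 sn mf T0
     (integral_heat_low mf (lt_trans ss1 sn) ss1 K10 T0 h1)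
     (integral_heat_high mf sen ss2 K20 T0 h2))).
  rewrite lee_fin a1 a2 -/c1 -/c2 -/G mulrDr; apply: lerD.
    rewrite (_ : G * _ = G * c1 * (dyad k `^ a * K1)); last by ring.
    by rewrite [leRHS]mulrCA ler_wpM2r ?mulr_ge0 ?powR_ge0.
  rewrite (_ : G * _ = G * c2 * (dyad k `^ (- a) * K2)); last by ring.
  by rewrite [leRHS]mulrCA ler_wpM2r ?mulr_ge0 ?powR_ge0.
rewrite lee_fin !powRM ?(ltW c0)// mulrACA -powRD; last by rewrite (gt_eqF c0) implybT.
have -> : 2^-1 + 2^-1 = 1 :> R by lra.
by rewrite powRr1 ?(ltW c0)// -[leRHS]mulrA.
Qed.

End pointwise.

(** * Finite differences of translates *)

Section affine_integrable.
Context {R : realType} {n : nat}.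
Local Notation mu := (@lebesgue_rV R n).

Lemma measurable_rV_affine (a : 'rV[R]_n) (c : R) :
  measurable_fun setT (fun z : 'rV[R]_n => a + c *: z).
Proof. by apply: measurable_rVD => //; apply: measurable_rVZ => //; exact: measurable_id. Qed.

Lemma integrable_rV_affine (a : 'rV[R]_n) (c : R) (f : 'rV[R]_n -> \bar R) : 0 < c ->
  mu.-integrable setT f -> mu.-integrable setT (fun z => f (a + c *: z)).
Proof.
move=> c0 /integrableP[mf fi]; apply/integrableP; split.
  exact: (measurableT_comp mf (measurable_rV_affine a c)).
rewrite (integral_rV_affine a c0 (f := fun z => `|f z|%E))//; last exact: measurableT_comp.
by rewrite lte_mul_pinfty// lee_fin invr_ge0 exprn_ge0// ltW.
Qed.

Lemma integral_rV_affine_integrable (a : 'rV[R]_n) (c : R) (f : 'rV[R]_n -> \bar R) :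
  0 < c -> mu.-integrable setT f ->
  (\int[mu]_z f (a + c *: z)%R = (c ^- n)%:E * \int[mu]_z f z)%E.
Proof.
move=> c0 fi; have mf := measurable_int _ fi.
have c0' : (0 <= c ^- n) by rewrite invr_ge0 exprn_ge0// ltW.
rewrite integralE [in RHS]integralE.
have fp : ((fun z => f (a + c *: z)%R)^\+ = (fun z => f^\+ (a + c *: z)%R))%E
  by apply/funext => z; rewrite !funeposE.
have fn : ((fun z => f (a + c *: z)%R)^\- = (fun z => f^\- (a + c *: z)%R))%E
  by apply/funext => z; rewrite !funenegE.
have mp := measurable_funepos mf; have mn := measurable_funeneg mf.
rewrite fp fn (integral_rV_affine a c0 mp)// (integral_rV_affine a c0 mn)//.
have fpos : (\int[mu]_z f^\+ z)%E \is a fin_num by apply: integrable_pos_fin_num.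
have fneg : (\int[mu]_z f^\- z)%E \is a fin_num by apply: integrable_neg_fin_num.
by rewrite -(fineK fpos) -(fineK fneg) -!EFinM -!EFinB mulrBr.
Qed.

End affine_integrable.

Section finite_differences.
Context {R : realType} {n : nat}.
Local Notation mu := (@lebesgue_rV R n).
Implicit Types (x y z w : 'rV[R]_n) (t s : R) (g : 'rV[R]_n -> R).

Definition fdiff z m g := iter m (fun h w => h (w + z) - h w) g.

(** The signed binomial coefficients (-1)^(m - j) C(m, j), by Pascal's rule, which is the form that
    the induction in [fdiffE] produces. *)
Fixpoint fdiff_coef (m j : nat) : R :=
  if m is k.+1 then (if j is i.+1 then fdiff_coef k i else 0) - fdiff_coef k j
  else (j == 0)%:R.

Lemma fdiff_coef0 m : fdiff_coef m 0 = (-1) ^+ m.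
Proof. by elim: m => // m IH; rewrite /= IH sub0r exprS mulN1r. Qed.

Lemma fdiff_coef_gt m j : (m < j)%N -> fdiff_coef m j = 0.
Proof.
elim: m j => [|m IH] [|j]//= mj.
by rewrite !IH ?subr0// ltnW.
Qed.

Lemma fdiffE z m g w :
  fdiff z m g w = \sum_(j < m.+1) fdiff_coef m j * g (w + j%:R *: z).
Proof.
elim: m w => [|m IH] w.
  by rewrite big_ord1 /= mul1r scale0r addr0.
rewrite [LHS]/= -/(fdiff z m g) !IH.
transitivity (\sum_(j < m.+2) ((if nat_of_ord j is i.+1 then fdiff_coef m i else 0) - fdiff_coef m j)
    * g (w + j%:R *: z)); last by [].
under [RHS]eq_bigr do rewrite mulrBl.
rewrite sumrB; congr (_ - _).
  rewrite [RHS]big_ord_recl/= mul0r add0r; apply: eq_bigr => i _; congr (_ * g _).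
  by rewrite /bump /= -addrA add1n -natr1 scalerDl scale1r [_ + z]addrC.
by rewrite [RHS]big_ord_recr/= fdiff_coef_gt// mul0r addr0.
Qed.

Lemma measurable_fdiff d (T : measurableType d) (f : T -> 'rV[R]_n) (h : T -> 'rV[R]_n) m g :
  measurable_fun setT f -> measurable_fun setT h -> measurable_fun setT g ->
  measurable_fun setT (fun a => fdiff (f a) m g (h a)).
Proof.
move=> mf mh mg; rewrite (_ : (fun _ => _) =
    (fun a => \sum_(j < m.+1) fdiff_coef m j * g (h a + j%:R *: f a))); last first.
  by apply/funext => a; rewrite fdiffE.
apply: measurable_sum => j; apply: measurable_funM => //.
by apply: measurableT_comp => //; apply: measurable_rVD => //; exact: measurable_rVZ.
Qed.

Lemma integrable_heat_kernel_prod s t w : 0 < s -> 0 < t ->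
  mu.-integrable setT (fun y => (heat_kernel s y * heat_kernel t (w + y))%:E).
Proof.
move=> s0 t0; apply/integrableP; split.
  apply/measurable_EFinP; apply: measurable_funM; apply: measurable_heat_kernel => //.
  exact: measurable_rVD.
under eq_integral => y _.
  rewrite gee0_abs; last by rewrite lee_fin mulr_ge0 ?heat_kernel_ge0.
  over.
by rewrite heat_kernel_semigroup// ltry.
Qed.

(** Differences in w commute with convolution by h_s, so this reduces to the semigroup law.
    Integrability is carried through the induction because splitting the integral of a difference
    requires it. *)
Lemma heat_kernel_fdiff s t z m w : 0 < s -> 0 < t ->
  mu.-integrable setT (fun y => (heat_kernel s y * fdiff z m (heat_kernel t) (w + y))%:E) /\
  (\int[mu]_y (heat_kernel s y * fdiff z m (heat_kernel t) (w + y))%:E =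
   (fdiff z m (heat_kernel (s + t)) w)%:E)%E.
Proof.
move=> s0 t0; elim: m w => [|m IH] w.
  by split; [exact: integrable_heat_kernel_prod|exact: heat_kernel_semigroup].
have [i1 e1] := IH (w + z); have [i2 e2] := IH w.
have E : (fun y => (heat_kernel s y * fdiff z m.+1 (heat_kernel t) (w + y))%:E) =
    ((fun y => (heat_kernel s y * fdiff z m (heat_kernel t) (w + z + y))%:E) \-
     (fun y => (heat_kernel s y * fdiff z m (heat_kernel t) (w + y))%:E))%E.
  by apply/funext => y /=; rewrite -EFinB -mulrBr addrAC.
rewrite E; split; first exact: integrableB.
by rewrite integralB// e1 e2.
Qed.

Lemma heat_kernel_le4 t w : 0 < t ->
  heat_kernel t w <= 4 `^ (n%:R / 2) * heat_kernel (4 * t) w.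
Proof.
move=> t0; rewrite /heat_kernel mulrA; apply: ler_pM; rewrite ?powR_ge0 ?expR_ge0//.
  have p0 := pi_gt0 R.
  rewrite [4 * pi * (4 * t)]mulrCA [in leRHS]powRM ?mulr_ge0 ?(ltW p0) ?(ltW t0)//.
  by rewrite mulrA [4 `^ (- _)]powRN mulfV ?mul1r// gt_eqF// powR_gt0.
rewrite ler_expR lerN2; apply: ler_wpM2l; first exact: sqr_ge0.
by rewrite lef_pV2 ?posrE ?mulr_gt0// ler_pM2l// ler_peMl ?(ltW t0)// ler1n.
Qed.

(* Each difference is spent on one factor of h_t = h_(t/2) * h_(t/2), so that only
   the first order estimate is needed. *)
Lemma fdiff_heat_kernel_le m : exists C kappa : R, [/\ 0 < C, 0 < kappa &
  forall t w z, 0 < t -> `|fdiff z m (heat_kernel t) w| <=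
   C * (enorm z / Num.sqrt t) ^+ m * expR (kappa * (enorm z ^+ 2 / t)) * heat_kernel (4 * t) w].
Proof.
elim: m => [|m [C [kappa [C0 k0 IH]]]].
  exists (4 `^ (n%:R / 2)), 1; split => [||t w z t0]; [exact: powR_gt0|exact: ltr01|].
  rewrite /= expr0 mulr1 ger0_norm ?heat_kernel_ge0// mul1r.
  apply: (le_trans (heat_kernel_le4 w t0)); rewrite ler_wpM2r ?heat_kernel_ge0//.
  rewrite ler_peMr ?powR_ge0// -expR0 ler_expR divr_ge0 ?sqr_ge0// ltW//.
pose C1 := 24 * n%:R * 4 `^ (n%:R / 2) + 1 : R.
have C10 : 0 < C1 by rewrite ltr_wpDl// !mulr_ge0// powR_ge0.
exists (C1 * C * Num.sqrt 2 ^+ m.+1), (2 * kappa + 4); split.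
- by rewrite !mulr_gt0// exprn_gt0// sqrtr_gt0.
- by rewrite addr_gt0// mulr_gt0.
move=> t w z t0; set h := t / 2.
have h0 : 0 < h by rewrite divr_gt0.
have th : t = h + h by rewrite /h; lra.
have [i1 e1] := heat_kernel_fdiff z m (w + z) h0 h0.
have [i2 e2] := heat_kernel_fdiff z m w h0 h0.
rewrite -th in e1 e2.
(* Substituting y - z for y moves the translation by z onto the undifferenced factor, which
   therefore receives the outermost difference. *)
pose k y := (heat_kernel h (y - z) * fdiff z m (heat_kernel h) (w + y)).
have sh y : w + z + (- z + y) = w + y by rewrite addrA addrK.
have ik : mu.-integrable setT (EFin \o k).
  have := integrable_rV_affine (- z) ltr01 i1; apply: eq_integrable => // y _.
  by rewrite scale1r sh [- z + y]addrC.
have ek : (\int[mu]_y (k y)%:E = (fdiff z m (heat_kernel t) (w + z))%:E)%E.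
  rewrite -e1 -[RHS]mul1e; have := integral_rV_affine_integrable (- z) ltr01 i1.
  rewrite expr1n invr1 => <-; apply: eq_integral => y _.
  by rewrite scale1r sh [- z + y]addrC.
have D : ((fdiff z m.+1 (heat_kernel t) w)%:E = \int[mu]_y
    ((heat_kernel h (y + - z) - heat_kernel h y) * fdiff z m (heat_kernel h) (w + y))%:E)%E.
  rewrite [LHS]EFinB -ek -e2 -integralB//; apply: eq_integral => y _.
  by rewrite -EFinB -mulrBl.
pose A := C1 * (enorm z / Num.sqrt h) * expR (2 * (enorm z ^+ 2 / h)) *
  (C * (enorm z / Num.sqrt h) ^+ m * expR (kappa * (enorm z ^+ 2 / h))).
have A0 : 0 <= A.
  by rewrite !mulr_ge0 ?exprn_ge0 ?divr_ge0 ?enorm_ge0 ?sqrtr_ge0 ?expR_ge0 ?(ltW C10) ?(ltW C0).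
have h4 : 4 * t = 4 * h + 4 * h by rewrite th mulrDr.
have p4 : 0 < 4 * h by rewrite mulr_gt0.
suff : `|fdiff z m.+1 (heat_kernel t) w| <= A * heat_kernel (4 * t) w.
  move=> /le_trans; apply; rewrite ler_wpM2r ?heat_kernel_ge0//.
  rewrite /A; have sqh : Num.sqrt t = Num.sqrt 2 * Num.sqrt h.
    by rewrite -sqrtrM//; congr Num.sqrt; rewrite /h; lra.
  have s2 : 0 < Num.sqrt (2 : R) by rewrite sqrtr_gt0.
  have -> : enorm z / Num.sqrt h = Num.sqrt 2 * (enorm z / Num.sqrt t).
    by rewrite sqh; field; rewrite !gt_eqF// sqrtr_gt0.
  have -> : enorm z ^+ 2 / h = 2 * (enorm z ^+ 2 / t) by rewrite /h; field; rewrite gt_eqF.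
  set B := _ / t; set e := enorm z / _; set c := Num.sqrt 2.
  have -> : expR ((2 * kappa + 4) * B) = expR (2 * (2 * B)) * expR (kappa * (2 * B)).
    by rewrite -expRD; congr expR; ring.
  rewrite le_eqVlt; apply/orP; left; apply/eqP.
  by rewrite exprMn !exprS; ring.
rewrite -lee_fin -abse_EFin D.
apply: (le_trans (le_abse_integral _ _ _)) => //.
  apply/measurable_EFinP; apply: measurable_funM; last first.
    by apply: measurable_fdiff => //; [exact: measurable_rVD|exact: measurable_heat_kernel].
  apply: measurable_funB; apply: measurable_heat_kernel => //.
  exact: measurable_rVD.
apply: (@le_trans _ _ (\int[mu]_y (A%:E * (heat_kernel (4 * h) y * heat_kernel (4 * h) (w + y))%:E))%E).
  apply: ge0_le_integral_nm => y _//.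
  rewrite abse_EFin -EFinM lee_fin normrM.
  rewrite /A mulrACA; apply: ler_pM => //; last exact: IH.
  have := heat_kernel_difference y (- z) h0; rewrite enormN => /le_trans; apply.
  rewrite ler_wpM2r ?heat_kernel_ge0// ler_wpM2r ?expR_ge0// ler_wpM2r ?lerDl//.
  by rewrite divr_ge0 ?enorm_ge0 ?sqrtr_ge0.
rewrite integral_scale//; first by rewrite heat_kernel_semigroup// -h4 -EFinM.
  exact: measurable_int (integrable_heat_kernel_prod _ p4 p4).
by move=> y; rewrite lee_fin mulr_ge0 ?heat_kernel_ge0.
Qed.

End finite_differences.

(** * Gaussians as test functions *)

Section schwartz_gaussian.
Context {R : realType} {n : nat}.
Implicit Types (x y : 'rV[R]_n) (p g : 'rV[R]_n -> R).

(** A class of functions stable under partial derivatives: every iterated partial of a Gaussian is a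
    member of it times the same Gaussian. *)
Inductive polyfun : ('rV[R]_n -> R) -> Prop :=
| polyfun_cst c : polyfun (cst c)
| polyfun_coord j : polyfun (fun y : 'rV[R]_n => y ord0 j)
| polyfun_add p g : polyfun p -> polyfun g -> polyfun (p + g)
| polyfun_mul p g : polyfun p -> polyfun g -> polyfun (p * g).

Lemma differentiable_polyfun p : polyfun p -> forall x, differentiable p x.
Proof.
elim => [c|j|p1 p2 _ h1 _ h2|p1 p2 _ h1 _ h2] x.
- exact: differentiable_cst.
- exact: differentiable_coord.
- exact: differentiableD.
- exact: differentiableM.
Qed.

Lemma partial_coord (i j : 'I_n) :
  partial i (fun y : 'rV[R]_n => y ord0 j) = cst ((i == j)%:R).
Proof.
apply/funext => x; rewrite /partial /derive.
(* The difference quotient is constant for nonzero increments, hence the punctured neighbourhood: at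
   0 the inverse is a default value. *)
apply: cvg_lim => //; apply: (@cvg_trans _ (@cst R R (i == j)%:R @ 0^')); last exact: cvg_cst.
apply: near_eq_cvg; near=> h; rewrite /= !mxE addrK eqxx/=.
rewrite [j == i]eq_sym /GRing.scale/= mulrA mulVf ?mul1r//.
by near: h; exact: nbhs_dnbhs_neq.
Unshelve. all: by end_near. Qed.

Lemma partial_polyfun i p : polyfun p -> polyfun (partial i p).
Proof.
elim => [c|j|p1 p2 h1 d1 h2 d2|p1 p2 h1 d1 h2 d2].
- rewrite (_ : partial _ _ = cst 0); first exact: polyfun_cst.
  by apply/funext => x; exact: derive_cst.
- by rewrite partial_coord; exact: polyfun_cst.
- rewrite (_ : partial _ _ = partial i p1 + partial i p2); first exact: polyfun_add.
  by apply/funext => x; rewrite /partial deriveD//; apply: diff_derivable; exact: differentiable_polyfun.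
- rewrite (_ : partial _ _ = p1 * partial i p2 + p2 * partial i p1).
    by apply: polyfun_add; exact: polyfun_mul.
  by apply/funext => x; rewrite /partial deriveM//; apply: diff_derivable; exact: differentiable_polyfun.
Qed.

Lemma polyfun_growth p : polyfun p -> exists (C : R) (k : nat), 0 <= C /\
  forall y, `|p y| <= C * (1 + enorm y) ^+ k.
Proof.
have e1 y : 1 <= 1 + enorm y by rewrite lerDl enorm_ge0.
elim => [c|j|p1 p2 _ [C1 [k1 [c1 h1]]] _ [C2 [k2 [c2 h2]]]|p1 p2 _ [C1 [k1 [c1 h1]]] _ [C2 [k2 [c2 h2]]]].
- by exists `|c|, 0%N; split => // y; rewrite expr0 mulr1.
- exists 1, 1%N; split => // y; rewrite mul1r expr1.
  by apply: le_trans (enorm_coord y j) _; rewrite lerDr.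
- exists (C1 + C2), (k1 + k2)%N; split; first exact: addr_ge0.
  move=> y; apply: (le_trans (ler_normD _ _)); rewrite mulrDl; apply: lerD.
    by apply: (le_trans (h1 y)); rewrite ler_wpM2l// ler_weXn2l ?leq_addr.
  by apply: (le_trans (h2 y)); rewrite ler_wpM2l// ler_weXn2l ?leq_addl.
- exists (C1 * C2), (k1 + k2)%N; split; first exact: mulr_ge0.
  by move=> y; rewrite normrM exprD mulrACA ler_pM.
Qed.

Lemma differentiable_expR_comp g x : differentiable g x -> differentiable (expR \o g) x.
Proof.
move=> dg; apply: differentiable_comp => //; apply/derivable1_diffP.
exact: derivable_expR.
Qed.

Lemma partial_expR_comp i g x : differentiable g x ->
  partial i (expR \o g) x = expR (g x) * partial i g x.
Proof.
move=> dg; have dE : differentiable (@expR R) (g x) by apply/derivable1_diffP; exact: derivable_expR.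
rewrite /partial !deriveE//; last exact: differentiable_expR_comp.
by rewrite diff_comp//= diff1E//= derive1E (derive_val (is_derive := is_derive_expR (g x))) /GRing.scale/= mulrC.
Qed.

Section fixed_gaussian.
Variables (t : R) (x : 'rV[R]_n).
Hypothesis t0 : 0 < t.

Let a : R := (4 * pi * t) `^ (- (n%:R / 2)).
Let q : 'rV[R]_n -> R := fun y => - (enorm (x - y) ^+ 2 / (4 * t)).

Let heatE : (fun y => heat_kernel t (x - y)) = cst a * (expR \o q).
Proof. by []. Qed.

Let polyfun_sum (s : seq 'I_n) (F : 'I_n -> 'rV[R]_n -> R) :
  (forall i, polyfun (F i)) -> polyfun (fun y => \sum_(i <- s) F i y).
Proof.
move=> h; elim: s => [|i s IH].
  rewrite (_ : (fun _ => _) = cst 0); first exact: polyfun_cst.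
  by apply/funext => y; rewrite big_nil.
rewrite (_ : (fun _ => _) = F i + (fun y => \sum_(i <- s) F i y)); first exact: polyfun_add.
by apply/funext => y; rewrite big_cons.
Qed.

Let polyfun_q : polyfun q.
Proof.
pose c i : 'rV[R]_n -> R := cst (x ord0 i) + cst (-1) * (fun y => y ord0 i).
have pc i : polyfun (c i).
  apply: polyfun_add; first exact: polyfun_cst.
  by apply: polyfun_mul; [exact: polyfun_cst|exact: polyfun_coord].
rewrite (_ : q = cst (- (4 * t)^-1) * (fun y => \sum_(i <- index_enum 'I_n) (c i * c i) y)).
  apply: polyfun_mul; first exact: polyfun_cst.
  by apply: polyfun_sum => i; exact: polyfun_mul.
apply/funext => y; rewrite /q enorm_sqr mulrC -mulNr; congr (_ * _).
apply: eq_bigr => i _; rewrite !mxE expr2 /c; congr (_ * _); by rewrite /= mulN1r.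
Qed.

Let partials_heat l : exists2 p, polyfun p &
  partials l (fun y => heat_kernel t (x - y)) = p * (expR \o q).
Proof.
elim: l => [|i l [p hp E]]; first by exists (cst a); [exact: polyfun_cst|rewrite heatE].
exists (p * partial i q + partial i p).
  by apply: polyfun_add; [apply: polyfun_mul => //|]; exact: partial_polyfun.
rewrite /= -/(partials _ _) E; apply/funext => y.
have dp := differentiable_polyfun hp y; have dq := differentiable_polyfun polyfun_q y.
rewrite {1}/partial deriveM; [|exact: diff_derivable|]; last first.
  by apply: diff_derivable; exact: differentiable_expR_comp.
rewrite -/(partial i (expR \o q) y) -/(partial i p y) partial_expR_comp//.
rewrite (_ : ((p * partial i q + partial i p) * (expR \o q)) y =
  (p y * partial i q y + partial i p y) * expR (q y))//.
by rewrite /GRing.scale/=; ring.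
Qed.

Let gaussian_decay (m : nat) : exists M : R, forall y, (1 + enorm y) ^+ m * expR (q y) <= M.
Proof.
(* Chosen so that A + 2 |x - y|^2 dominates 1 + |y|, while |x - y|^2 / (4 t) differs from (A + 2 |x
   - y|^2) / (8 t) by the constant A / (8 t). *)
pose A := 2 + 2 * enorm x ^+ 2; have A0 : 0 <= A by rewrite addr_ge0// mulr_ge0// sqr_ge0.
(* The power is raised to m + 1 because [powR_le_expR] requires a positive exponent. *)
pose b : R := m.+1%:R; have b0 : 0 < b by rewrite ltr0n.
have t8 : 0 < 8 * t by rewrite mulr_gt0.
exists ((8 * t) ^+ m.+1 * (b `^ b * expR (A / (8 * t)))) => y.
pose u := enorm (x - y) ^+ 2.
have u0 : 0 <= u by exact: sqr_ge0.
have e0 := enorm_ge0 y.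
have he : 1 + enorm y <= A + 2 * u.
  have h1 : enorm y ^+ 2 <= 2 * enorm x ^+ 2 + 2 * u.
    by have := enormD_sqr x (- (x - y)); rewrite opprB addrC subrK -[enorm (y - x)]enormN opprB.
  have h2 := sqr_ge0 (enorm y - 1); rewrite sqrrB mulr1 expr1n in h2.
  by rewrite /A; move: h1 h2; set e2 := enorm y ^+ 2; rewrite mulr2n; lra.
have e1 : 1 <= 1 + enorm y by rewrite lerDl.
pose v := (A + 2 * u) / (8 * t).
have v0 : 0 <= v.
  by apply: divr_ge0; [apply: addr_ge0 => //; exact: mulr_ge0|exact: ltW].
have qE : expR (q y) = expR (- v) * expR (A / (8 * t)).
  by rewrite -expRD; congr expR; rewrite /q /v -/u; field; rewrite gt_eqF.
rewrite qE; apply: (@le_trans _ _ (((8 * t) * v) ^+ m.+1 * (expR (- v) * expR (A / (8 * t))))).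
  rewrite ler_wpM2r ?mulr_ge0 ?expR_ge0//; apply: (@le_trans _ _ ((1 + enorm y) ^+ m.+1)).
    by rewrite ler_weXn2l.
  have vE : 8 * t * v = A + 2 * u by rewrite /v mulrC divfK// gt_eqF.
  have e10 := le_trans ler01 e1.
  by rewrite vE; apply: lerXn2r => //; rewrite nnegrE//; exact: le_trans e10 he.
rewrite exprMn -mulrA ler_wpM2l ?exprn_ge0 ?(ltW t8)// mulrA ler_wpM2r ?expR_ge0//.
by rewrite expRN ler_pdivrMr ?expR_gt0// -powR_mulrn// powR_le_expR.
Qed.

(** It lets the integrability clause of [in_besov] be used with Gaussians, giving absolute
    convergence of the heat flow of u at every time and point. *)
Lemma schwartz_heat_kernel : schwartz (fun y => heat_kernel t (x - y)).
Proof.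
split=> [l y|k l]; have [p hp E] := partials_heat l; rewrite E.
  apply: differentiableM; first exact: differentiable_polyfun.
  by apply: differentiable_expR_comp; exact: differentiable_polyfun.
have [C [m [C0 hC]]] := polyfun_growth hp; have [M hM] := gaussian_decay (k + m).
exists (C * M) => y.
rewrite (_ : (p * (expR \o q)) y = p y * expR (q y))// normrM (ger0_norm (expR_ge0 _)).
apply: (@le_trans _ _ (C * ((1 + enorm y) ^+ (k + m) * expR (q y)))); last by rewrite ler_wpM2l.
rewrite exprD [leRHS](_ : _ = (1 + enorm y) ^+ k * (C * (1 + enorm y) ^+ m * expR (q y))); last by ring.
apply: ler_pM; rewrite ?exprn_ge0 ?enorm_ge0 ?mulr_ge0 ?expR_ge0//.
  by rewrite lerXn2r ?nnegrE ?addr_ge0 ?enorm_ge0// lerDr.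
by rewrite ler_wpM2r ?expR_ge0.
Qed.

End fixed_gaussian.
End schwartz_gaussian.

Section lincomb.
Context d (T : measurableType d) (R : realType) (mu : {measure set T -> \bar R}).

Lemma integral_lincomb (D : set T) (k : nat) (c : nat -> R) (g : nat -> T -> R) :
  measurable D -> (forall j, (j < k)%N -> mu.-integrable D (EFin \o g j)) ->
  mu.-integrable D (fun x => (\sum_(j < k) c j * g j x)%:E) /\
  (\int[mu]_(x in D) (\sum_(j < k) c j * g j x)%:E =
   (\sum_(j < k) c j * fine (\int[mu]_(x in D) (g j x)%:E))%:E)%E.
Proof.
move=> mD; elim: k => [|k IH] hg.
  rewrite big_ord0; split.
    by under eq_fun do rewrite big_ord0; exact: integrable0.
  by under eq_integral do rewrite big_ord0; rewrite integral0.
have [|i1 e1] := IH; first by move=> j jk; apply: hg; exact: ltnW.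
have i2 := integrableZl mD (c k) (hg k (ltnSn k)).
have E : (fun x => (\sum_(j < k.+1) c j * g j x)%:E) =
    ((fun x => (\sum_(j < k) c j * g j x)%:E) \+ (fun x => (c k)%:E * (EFin \o g k) x))%E.
  by apply/funext => x /=; rewrite big_ord_recr/= EFinD EFinM.
rewrite E; split; first exact: integrableD.
rewrite integralD// e1 big_ord_recr/= EFinD integralZl ?EFinM ?fineK//; last exact: hg.
exact: (integrable_fin_num mD (hg k (ltnSn k))).
Qed.

(* An undetermined integral is -oo, as oo - oo = -oo. *)
Lemma integrable_fin_integral (g : T -> R) : measurable_fun setT g ->
  (\int[mu]_x (g x)%:E)%E \is a fin_num -> mu.-integrable setT (EFin \o g).
Proof.
move=> mg hf; have mgE : measurable_fun setT (EFin \o g) by exact/measurable_EFinP.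
apply/integrableP; split => //.
rewrite (_ : (\int[mu]_x `|(EFin \o g) x|)%E = (\int[mu]_x (EFin \o g)^\+ x + \int[mu]_x (EFin \o g)^\- x)%E).
  have : (\int[mu]_x (EFin \o g) x)%E \is a fin_num by [].
  rewrite integralE.
  have p0 : (0 <= \int[mu]_x (EFin \o g)^\+ x)%E by apply: integral_ge0.
  have n0 : (0 <= \int[mu]_x (EFin \o g)^\- x)%E by apply: integral_ge0.
  move: p0 n0; case: (\int[mu]_x (EFin \o g)^\+ x)%E => [a| |]//;
  by case: (\int[mu]_x (EFin \o g)^\- x)%E => [b| |]// _ _ _; rewrite -EFinD ltry.
rewrite -ge0_integralD//; [|exact: measurable_funepos|exact: measurable_funeneg].
by apply: eq_integral => x _; have := congr1 (fun h => h x) (fune_abse (EFin \o g)).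
Qed.

End lincomb.

Section gamma_pos.
Context {R : realType}.

(** A zero integral would make the positive integrand vanish almost everywhere on ]0, 1]. Positivity
    matters when finiteness of u is read back on the time integral, since a zero prefactor would
    hide an infinite integral. *)
Lemma Gamma_gt0 (z : R) : 0 < z -> 0 < Gamma z.
Proof.
move=> z0; rewrite lt_neqAle Gamma_ge0 andbT eq_sym; apply/negP => /eqP G0.
have := GammaE z0; rewrite G0 => h.
have mf : measurable_fun (`]0%R, +oo[%classic : set R)
    (fun t : R => (t `^ (z - 1) * expR (- t))%:E).
  apply/measurable_EFinP; apply: measurable_funTS; apply: measurable_funM.
    exact: measurable_powR_itv.
  by apply: measurableT_comp => //; exact: measurableT_comp.
have e : (\int[@lebesgue_measure R]_(t in `]0%R, +oo[) `|(t `^ (z - 1) * expR (- t))%:E| = 0)%E.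
  transitivity (0%:E : \bar R) => //; rewrite -[RHS]h; apply: eq_integral => t _.
  by rewrite gee0_abs// lee_fin mulr_ge0 ?powR_ge0 ?expR_ge0.
have [N [mN N0 sub]] := (ae_eq_integral_abs lebesgue_measure (measurable_itv _) mf).1 e.
have : (@lebesgue_measure R `]0%R, 1%R] <= lebesgue_measure N)%E.
  apply: le_measure; rewrite ?inE//.
  move=> t /=; rewrite in_itv/= => /andP[t0 _]; apply: sub => /= ht.
  have := ht; rewrite in_itv/= andbT => /(_ t0) [] /eqP.
  by rewrite mulf_eq0 !gt_eqF ?expR_gt0 ?powR_gt0.
rewrite N0 lebesgue_measure_itv/= lte_fin ltr01 oppr0 adde0 lee_fin.
by rewrite leNgt ltr01.
Qed.

End gamma_pos.

(** * Gaussian averages of finite differences *)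

Section heat_dilations.
Context {R : realType} {n : nat}.
Local Notation mu := (@lebesgue_rV R n).
Local Notation leb := (@lebesgue_measure R).
Implicit Types (f u : 'rV[R]_n -> R) (x y z w : 'rV[R]_n).

Lemma heat_kernel_scale (c T : R) z : 0 < c -> 0 < T ->
  heat_kernel (c ^+ 2 * T) (c *: z) = c ^- n * heat_kernel T z.
Proof.
move=> c0 T0; rewrite /heat_kernel enormZ (ger0_norm (ltW c0)) [RHS]mulrA.
have p0 := pi_gt0 R; congr (_ * expR (- _)).
  rewrite !powR_sqrt_half ?mulr_gt0 ?exprn_gt0//.
  rewrite (_ : 4 * pi * (c ^+ 2 * T) = c ^+ 2 * (4 * pi * T)); last by ring.
  by rewrite sqrtrM ?sqr_ge0// sqrtr_sqr (ger0_norm (ltW c0)) exprMn invfM.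
by rewrite exprMn; field; rewrite !gt_eqF.
Qed.

(** Reduces a shifted kernel to one centred at the point x where the cube bound on f is available,
    at the price of a factor independent of w. *)
Lemma heat_kernel_shift_le (t : R) w z : 0 < t ->
  heat_kernel t (w + z) <=
  4 `^ (n%:R / 2) * expR (enorm z ^+ 2 / t) * heat_kernel (4 * t) w.
Proof.
move=> t0; rewrite /heat_kernel.
have p0 := pi_gt0 R.
rewrite [4 * pi * (4 * t)]mulrCA [in leRHS]powRM ?mulr_ge0 ?(ltW p0) ?(ltW t0)//.
rewrite [leRHS](_ : _ = (4 `^ (n%:R / 2) * 4 `^ (- (n%:R / 2))) * ((4 * pi * t) `^ (- (n%:R / 2)) *
  (expR (enorm z ^+ 2 / t) * expR (- (enorm w ^+ 2 / (4 * (4 * t))))))); last by ring.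
rewrite [4 `^ (- _)]powRN mulfV ?mul1r; last by rewrite gt_eqF// powR_gt0.
rewrite ler_wpM2l ?powR_ge0// -expRD ler_expR.
have h := enormD_sqr (w + z) (- z); rewrite addrK enormN in h.
have a0 : 0 <= enorm (w + z) ^+ 2 by exact: sqr_ge0.
have b0 : 0 <= enorm z ^+ 2 by exact: sqr_ge0.
move: h a0 b0; set a := enorm (w + z) ^+ 2; set b := enorm z ^+ 2; set c := enorm w ^+ 2.
move=> h a0 b0; rewrite -subr_ge0.
rewrite (_ : _ - _ = (16 * b + 4 * a - c) / (16 * t)); last by field; rewrite gt_eqF.
apply: divr_ge0; last by rewrite mulr_ge0// ltW.
lra.
Qed.

(** The dilation z -> j z turns h_T into h_(j^2 T), and the semigroup law adds the times. For j = 0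
    only the unit mass of h_T is used. *)
Lemma integral_heat_kernel_dilate (j : nat) (T t : R) w : 0 < T -> 0 < t ->
  (\int[mu]_z (heat_kernel T z * heat_kernel t (w + j%:R *: z))%:E =
   (heat_kernel (j%:R ^+ 2 * T + t) w)%:E)%E.
Proof.
move=> T0 t0; case: j => [|j].
  rewrite expr0n/= mul0r add0r.
  under eq_integral do rewrite scale0r addr0 mulrC EFinM.
  rewrite integral_scale ?heat_kernel_ge0//.
  - have e : (\int[mu]_z (heat_kernel T z)%:E = 1)%E.
      rewrite -(@integral_heat_kernel R n T 0 T0); apply: eq_integral => z _.
      by rewrite add0r.
    by rewrite e mule1.
  - by apply/measurable_EFinP; exact: measurable_heat_kernel.
  - by move=> z; rewrite lee_fin heat_kernel_ge0.
set c : R := j.+1%:R; have c0 : 0 < c by rewrite ltr0n.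
have cT0 : 0 < c ^+ 2 * T by rewrite mulr_gt0// exprn_gt0.
pose g z := (heat_kernel (c ^+ 2 * T) z * heat_kernel t (w + z))%:E.
have mg : measurable_fun setT g.
  apply/measurable_EFinP; apply: measurable_funM; apply: measurable_heat_kernel => //.
  exact: measurable_rVD.
have g0 z : (0 <= g z)%E by rewrite lee_fin mulr_ge0 ?heat_kernel_ge0.
have cn : 0 < c ^- n by rewrite invr_gt0 exprn_gt0.
have e1 : (\int[mu]_z g (0 + c *: z)%R = (c ^- n)%:E * (heat_kernel (c ^+ 2 * T + t) w)%:E)%E.
  by rewrite -(heat_kernel_semigroup w cT0 t0) (integral_rV_affine 0 c0 mg g0).
have e2 : (\int[mu]_z g (0 + c *: z)%R =
    (c ^- n)%:E * \int[mu]_z (heat_kernel T z * heat_kernel t (w + c *: z))%:E)%E.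
  rewrite -integral_scale ?(ltW cn)//; last 2 first.
  - apply/measurable_EFinP; apply: measurable_funM; apply: measurable_heat_kernel => //.
    exact: measurable_rV_affine.
  - by move=> z; rewrite lee_fin mulr_ge0 ?heat_kernel_ge0.
  by apply: eq_integral => z _; rewrite add0r /g heat_kernel_scale// -mulrA EFinM.
have := congr1 (fun v => ((c ^- n)^-1)%:E * v)%E (etrans (esym e2) e1).
by rewrite !muleA -EFinM mulVf ?gt_eqF// !mul1e.
Qed.

(** With v = |z|^2 / (16 T), h_T is a multiple of h_(4 T) exp(- 3 v). One exp(v) is spent on the
    power of |z| and two on the exponential factor, which t >= 8 kappa T bounds by exp(2 v). *)
Lemma gaussian_moment (m : nat) (kappa : R) : 0 < kappa -> (0 < m)%N ->
  exists2 C : R, 0 < C & forall T t, 0 < T -> 8 * kappa * T <= t ->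
  (\int[mu]_z (heat_kernel T z * ((enorm z / Num.sqrt t) ^+ m *
     expR (kappa * (enorm z ^+ 2 / t))))%:E <= (C * (T / t) `^ (m%:R / 2))%:E)%E.
Proof.
move=> k0 m0; pose b : R := m%:R / 2; have b0 : 0 < b by rewrite divr_gt0// ltr0n.
pose C := 16 `^ b * b `^ b * 4 `^ (n%:R / 2) : R.
exists C; first by rewrite !mulr_gt0// powR_gt0.
move=> T t T0 Tt; have t0 : 0 < t by apply: lt_le_trans Tt; rewrite !mulr_gt0.
have T4 : 0 < 4 * T by rewrite mulr_gt0.
apply: (@le_trans _ _ (\int[mu]_z ((C * (T / t) `^ b)%:E * (heat_kernel (4 * T) (0 + z))%:E))%E).
  apply: ge0_le_integral_nm => z _.
    have zt0 : 0 <= enorm z / Num.sqrt t by rewrite divr_ge0 ?enorm_ge0 ?sqrtr_ge0.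
    rewrite lee_fin; apply: mulr_ge0; first exact: heat_kernel_ge0.
    by apply: mulr_ge0; rewrite ?expR_ge0 ?exprn_ge0.
  rewrite -EFinM lee_fin add0r.
  pose v := enorm z ^+ 2 / (16 * T).
  have v0 : 0 <= v by rewrite divr_ge0 ?sqr_ge0// mulr_ge0// ltW.
  have e1 : expR (kappa * (enorm z ^+ 2 / t)) <= expR (2 * v).
    rewrite ler_expR /v -subr_ge0.
    rewrite (_ : _ - _ = enorm z ^+ 2 * (t - 8 * kappa * T) / (8 * T * t)).
      have tT0 : 0 <= 8 * T * t by rewrite !mulr_ge0// ltW.
      by apply: divr_ge0 => //; apply: mulr_ge0; rewrite ?sqr_ge0 ?subr_ge0.
    by field; rewrite !gt_eqF.
  have e2 : (enorm z / Num.sqrt t) ^+ m = 16 `^ b * (T / t) `^ b * v `^ b.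
    have Tt0 : 0 <= T / t by rewrite divr_ge0 ?(ltW t0) ?(ltW T0).
    have Tt16 : 0 <= 16 * (T / t) by exact: mulr_ge0.
    rewrite -powRM// -powRM//.
    rewrite (_ : 16 * (T / t) * v = (enorm z / Num.sqrt t) ^+ 2).
      have st0 : 0 <= enorm z / Num.sqrt t by rewrite divr_ge0 ?enorm_ge0 ?sqrtr_ge0.
      by rewrite -[_ ^+ 2]powR_mulrn// -powRrM /b mulrCA mulfV// mulr1 powR_mulrn.
    by rewrite expr_div_n (sqr_sqrtr (ltW t0)) /v; field; rewrite !gt_eqF.
  have e3 := powR_le_expR b0 v0.
  have e4 : heat_kernel T z = 4 `^ (n%:R / 2) * heat_kernel (4 * T) z * expR (- (3 * v)).
    rewrite /heat_kernel; have p0 := pi_gt0 R.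
    rewrite [4 * pi * (4 * T)]mulrCA [in RHS]powRM ?mulr_ge0 ?(ltW p0) ?(ltW T0)//.
    rewrite [RHS](_ : _ = (4 `^ (n%:R / 2) * 4 `^ (- (n%:R / 2))) * ((4 * pi * T) `^ (- (n%:R / 2)) *
      (expR (- (enorm z ^+ 2 / (4 * (4 * T)))) * expR (- (3 * v))))); last by ring.
    rewrite [4 `^ (- _)]powRN mulfV ?mul1r; last by rewrite gt_eqF// powR_gt0.
    by rewrite -expRD; congr (_ * expR _); rewrite /v; field; rewrite gt_eqF.
  rewrite e4 e2 /C; set P := heat_kernel (4 * T) z; set Q := 4 `^ (n%:R / 2).
  have P0 : 0 <= P by exact: heat_kernel_ge0.
  have Q0 : 0 <= Q by exact: powR_ge0.
  apply: (@le_trans _ _ (Q * P * expR (- (3 * v)) *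
     (16 `^ b * (T / t) `^ b * (b `^ b * expR v) * expR (2 * v)))).
    have A0 : 0 <= 16 `^ b * (T / t) `^ b by exact: mulr_ge0 (powR_ge0 _ _) (powR_ge0 _ _).
    apply: (ler_wpM2l (mulr_ge0 (mulr_ge0 Q0 P0) (expR_ge0 _))).
    apply: ler_pM; [exact: mulr_ge0 A0 (powR_ge0 _ _)|exact: expR_ge0|exact: (ler_wpM2l A0 e3)|exact: e1].
  have E : expR (- (3 * v)) * (expR v * expR (2 * v)) = 1.
    by rewrite -!expRD (_ : - (3 * v) + _ = 0) ?expR0//; ring.
  rewrite le_eqVlt; apply/orP; left; apply/eqP.
  rewrite [LHS](_ : _ = (16 `^ b * b `^ b * Q * (T / t) `^ b * P) *
    (expR (- (3 * v)) * (expR v * expR (2 * v)))); first by rewrite E mulr1.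
  ring.
rewrite integral_scale ?mulr_ge0 ?powR_ge0//; last 2 first.
- apply/measurable_EFinP; apply: measurable_heat_kernel => //; exact: measurable_rVD.
- by move=> z; rewrite lee_fin heat_kernel_ge0.
by rewrite integral_heat_kernel// mule1.
Qed.

End heat_dilations.

Section translation_differences.
Context {R : realType} {n : nat}.
Local Notation mu := (@lebesgue_rV R n).
Local Notation leb := (@lebesgue_measure R).
Implicit Types (f u : 'rV[R]_n -> R) (x y z w : 'rV[R]_n).

Definition fdiff_mass (m : nat) : R := \sum_(j < m.+1) `|@fdiff_coef R m j|.

Lemma fdiff_mass_ge0 m : 0 <= fdiff_mass m.
Proof. by apply: sumr_ge0. Qed.

Lemma measurable_heat_at f t : measurable_fun setT f ->
  measurable_fun setT (heat (distribution_of f) t).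
Proof. by move=> mf; exact: (measurableT_comp (measurable_heat mf) (pair1_measurable t)). Qed.

Lemma measurable_heat_fdiff f x m : measurable_fun setT f ->
  measurable_fun setT (fun a : 'rV[R]_n * R => fdiff a.1 m (heat (distribution_of f) a.2) x).
Proof.
move=> mf; under eq_fun do rewrite fdiffE.
apply: measurable_sum => j; apply: measurable_funM => //.
apply: (measurableT_comp (measurable_heat mf) (g := fun a : 'rV[R]_n * R => (a.2, x + j%:R *: a.1))).
apply/measurable_fun_pairP; split; first exact: measurable_snd.
by apply: measurable_rVD => //; apply: measurable_rVZ => //; exact: measurable_fst.
Qed.

Section cube_bound.
Variables (f : 'rV[R]_n -> R) (x : 'rV[R]_n) (K sigma : R).
Hypotheses (mf : measurable_fun setT f) (sn : sigma < n%:R) (sg0 : 0 <= sigma)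
  (K0 : 0 <= K) (hK : cube_bounded f x K (n%:R - sigma)).
Let tent := tent_const 4 (n%:R - sigma).
Let F t := heat (distribution_of f) t.

Let tent0 : 0 <= tent. Proof. exact: ltW (tent_const_gt0 _ _). Qed.

Let powR_neg_le (a b : R) : 0 < a -> a <= b -> b `^ (- (sigma / 2)) <= a `^ (- (sigma / 2)).
Proof.
move=> a0 ab; have b0 := lt_le_trans a0 ab.
rewrite !powRN lef_pV2 ?posrE ?powR_gt0//; apply: le_powR; rewrite ?(ltW a0)//.
by rewrite divr_ge0.
Qed.

Let integrable_shift t w : 0 < t ->
  mu.-integrable setT (EFin \o (fun y => f y * heat_kernel t (x - y + w))).
Proof.
move=> t0; apply/integrableP; split.
  apply/measurable_EFinP; apply: measurable_funM => //; apply: measurable_heat_kernel => //.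
  by apply: measurable_rVD => //; exact: measurable_rVB.
pose c := 4 `^ (n%:R / 2) * expR (enorm w ^+ 2 / t).
have c0 : 0 <= c by rewrite mulr_ge0 ?powR_ge0 ?expR_ge0.
have t4 : 0 < 4 * t by rewrite mulr_gt0.
have h : (\int[mu]_y `|(EFin \o (fun y => (f y * heat_kernel t (x - y + w))%R)) y| <=
    \int[mu]_y (c%:E * (`|f y| * heat_kernel (4 * t) (x - y))%:E))%E.
  apply: ge0_le_integral_nm => y _//=.
  rewrite -EFinM lee_fin normrM mulrCA ler_wpM2l// ger0_norm ?heat_kernel_ge0//.
  exact: heat_kernel_shift_le.
apply: (le_lt_trans h); rewrite integral_scale//; last 2 first.
- apply/measurable_EFinP; apply: measurable_funM; first exact: measurableT_comp.
  by apply: measurable_heat_kernel => //; exact: measurable_rVB.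
- by move=> y; rewrite lee_fin mulr_ge0 ?heat_kernel_ge0.
rewrite lte_mul_pinfty ?lee_fin//.
by apply: (le_lt_trans (heat_tent mf sn K0 t4 hK)); rewrite ltry.
Qed.

Let heat_shift t w : F t (x + w) = fine (\int[mu]_y (f y * heat_kernel t (x - y + w))%:E)%E.
Proof.
rewrite /F heat_distribution_of; apply: (congr1 fine).
by apply: eq_integral => y _; rewrite addrAC.
Qed.

(** The difference is transferred to the kernel, where the m-th order estimate holds; [heat_tent]
    bounds what remains at time 4 t, and sigma >= 0 allows t in place of 4 t. *)
Lemma heat_fdiff_le t z m (C kappa : R) : 0 < t -> 0 <= C ->
  (forall w, `|fdiff z m (heat_kernel t) w| <=
     C * (enorm z / Num.sqrt t) ^+ m * expR (kappa * (enorm z ^+ 2 / t)) * heat_kernel (4 * t) w) ->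
  `|fdiff z m (F t) x| <= C * (tent * K * t `^ (- (sigma / 2))) *
     ((enorm z / Num.sqrt t) ^+ m * expR (kappa * (enorm z ^+ 2 / t))).
Proof.
move=> t0 C0 hC.
have [i1 e1] := @integral_lincomb _ _ _ mu setT m.+1 (@fdiff_coef R m)
  (fun j y => f y * heat_kernel t (x - y + j%:R *: z)) measurableT
  (fun j _ => integrable_shift (j%:R *: z) t0).
have sE y : \sum_(j < m.+1) fdiff_coef m j * (f y * heat_kernel t (x - y + j%:R *: z)) =
    f y * fdiff z m (heat_kernel t) (x - y).
  by rewrite fdiffE mulr_sumr; apply: eq_bigr => j _; rewrite mulrCA.
have E : ((fdiff z m (F t) x)%:E = \int[mu]_y (f y * fdiff z m (heat_kernel t) (x - y))%:E)%E.
  rewrite fdiffE; under eq_bigr do rewrite heat_shift.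
  by rewrite -e1; apply: eq_integral => y _; rewrite sE.
have t4 : 0 < 4 * t by rewrite mulr_gt0.
set A := (enorm z / Num.sqrt t) ^+ m * expR (kappa * (enorm z ^+ 2 / t)).
have A0 : 0 <= A by rewrite mulr_ge0 ?expR_ge0// exprn_ge0// divr_ge0 ?enorm_ge0 ?sqrtr_ge0.
rewrite -lee_fin -abse_EFin E; apply: (le_trans (le_abse_integral _ _ _)) => //.
  apply/measurable_EFinP; apply: measurable_funM => //; apply: measurable_fdiff => //.
    exact: measurable_rVB.
  exact: measurable_heat_kernel.
apply: (@le_trans _ _ (\int[mu]_y ((C * A)%:E * (`|f y| * heat_kernel (4 * t) (x - y))%:E))%E).
  apply: ge0_le_integral_nm => y _//.
  rewrite abse_EFin -EFinM lee_fin normrM [leRHS]mulrCA ler_wpM2l//.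
  by apply: (le_trans (hC _)); rewrite /A !mulrA.
have CA0 : 0 <= C * A by exact: mulr_ge0.
rewrite integral_scale//; last 2 first.
- apply/measurable_EFinP; apply: measurable_funM; first exact: measurableT_comp.
  by apply: measurable_heat_kernel => //; exact: measurable_rVB.
- by move=> y; rewrite lee_fin mulr_ge0 ?heat_kernel_ge0.
apply: (le_trans (lee_wpmul2l _ (heat_tent mf sn K0 t4 hK))); first by rewrite lee_fin.
rewrite -EFinM lee_fin -/tent mulrAC; apply: ler_wpM2r => //; apply: ler_wpM2l => //.
apply: ler_wpM2l; first exact: mulr_ge0.
by apply: powR_neg_le => //; rewrite ler_peMl ?(ltW t0)// ler1n.
Qed.

(** No cancellation is used. Averaging each translated kernel against h_T gives the kernel at time
    j^2 T + t, centred at x again, and sigma >= 0 allows t in place of this larger time. *)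
Lemma integral_fdiff_heat_low (T t : R) m : 0 < T -> 0 < t ->
  (\int[mu]_z (heat_kernel T z * `|fdiff z m (F t) x|)%:E <=
   (fdiff_mass m * (tent * K * t `^ (- (sigma / 2))))%:E)%E.
Proof.
move=> T0 t0.
pose g (j : nat) z : \bar R := ((`|@fdiff_coef R m j|)%:E * (heat_kernel T z * `|F t (x + j%:R *: z)|)%:E)%E.
have mF := measurable_heat_at t mf.
have mFj (j : nat) : measurable_fun setT (fun z => F t (x + j%:R *: z)).
  exact: (measurableT_comp mF (measurable_rV_affine x j%:R)).
have mh (j : nat) : measurable_fun setT (fun z => (heat_kernel T z * `|F t (x + j%:R *: z)|)%:E).
  apply/measurable_EFinP; apply: measurable_funM; first exact: measurable_heat_kernel.
  exact: (measurableT_comp (@normr_measurable R setT) (mFj j)).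
have h0 (j : nat) z : (0 <= (heat_kernel T z * `|F t (x + j%:R *: z)|)%:E)%E.
  by rewrite lee_fin mulr_ge0 ?heat_kernel_ge0.
apply: (@le_trans _ _ (\int[mu]_z \sum_(j < m.+1) g j z)%E).
  apply: ge0_le_integral_nm => z _; first by rewrite lee_fin mulr_ge0 ?heat_kernel_ge0.
  rewrite /g; under eq_bigr do rewrite -EFinM.
  rewrite sumEFin lee_fin fdiffE; under [leRHS]eq_bigr do rewrite mulrCA.
  rewrite -mulr_sumr ler_wpM2l ?heat_kernel_ge0//.
  apply: (le_trans (ler_norm_sum _ _ _)); apply: ler_sum => j _; by rewrite normrM.
rewrite ge0_integral_sum//; last 2 first.
- by move=> j; apply: measurable_funeM; exact: mh.
- by move=> j z _; apply: mule_ge0; [rewrite lee_fin|exact: h0].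
rewrite /fdiff_mass mulr_suml -sumEFin; apply: lee_sum => j _.
rewrite /g integral_scale// EFinM lee_wpmul2l ?lee_fin//.
pose q z y : \bar R := (heat_kernel T z * (`|f y| * heat_kernel t (x - y + (j : nat)%:R *: z)))%:E.
have mq : measurable_fun setT (fun a : 'rV[R]_n * 'rV[R]_n => q a.1 a.2).
  apply/measurable_EFinP; apply: measurable_funM.
    by apply: measurable_heat_kernel => //; exact: measurable_fst.
  apply: measurable_funM.
    by apply: measurableT_comp => //; exact: measurableT_comp mf measurable_snd.
  apply: measurable_heat_kernel => //; apply: measurable_rVD.
    by apply: measurable_rVB => //; exact: measurable_snd.
  by apply: measurable_rVZ => //; exact: measurable_fst.
have q0 z y : (0 <= q z y)%E by rewrite lee_fin mulr_ge0 ?heat_kernel_ge0// mulr_ge0 ?heat_kernel_ge0.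
apply: (@le_trans _ _ (\int[mu]_z \int[mu]_y q z y)%E).
  apply: ge0_le_integral_nm => z _ //.
  rewrite /q; under eq_integral do rewrite EFinM.
  rewrite integral_scale ?heat_kernel_ge0//; last 2 first.
  - apply/measurable_EFinP; apply: measurable_funM; first exact: measurableT_comp.
    by apply: measurable_heat_kernel => //; apply: measurable_rVD => //; exact: measurable_rVB.
  - by move=> y; rewrite lee_fin mulr_ge0 ?heat_kernel_ge0.
  rewrite EFinM lee_wpmul2l ?lee_fin ?heat_kernel_ge0//.
  apply: (le_trans (heat_abs_le t _ mf)).
  by rewrite le_eqVlt; apply/orP; left; apply/eqP; apply: eq_integral => y _; rewrite addrAC.
rewrite (tonelli_swap mu mu mq q0).
set tau := (j : nat)%:R ^+ 2 * T + t.
have ttau : t <= tau by rewrite lerDr mulr_ge0 ?sqr_ge0// ltW.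
have tau0 : 0 < tau by exact: lt_le_trans ttau.
have -> : (\int[mu]_y \int[mu]_z q z y = \int[mu]_y (`|f y| * heat_kernel tau (x - y))%:E)%E.
  apply: eq_integral => y _; rewrite /q.
  under eq_integral do rewrite mulrCA EFinM.
  rewrite integral_scale//; last 2 first.
  - apply/measurable_EFinP; apply: measurable_funM; apply: measurable_heat_kernel => //.
    by apply: measurable_rVD => //; apply: measurable_rVZ => //; exact: measurable_cst.
  - by move=> z; rewrite lee_fin mulr_ge0 ?heat_kernel_ge0.
  by rewrite integral_heat_kernel_dilate.
apply: (le_trans (heat_tent mf sn K0 tau0 hK)).
by rewrite lee_fin -/tent ler_wpM2l ?mulr_ge0// powR_neg_le.
Qed.

End cube_bound.
End translation_differences.

(** * Potentials controlled by the Besov norm of u *)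

Section potential_pointwise.
Context {R : realType} {n : nat}.
Local Notation mu := (@lebesgue_rV R n).
Local Notation leb := (@lebesgue_measure R).
Implicit Types (f u : 'rV[R]_n -> R) (x y z w : 'rV[R]_n).

Lemma integral_tpow_ereal (a : R) (J : R -> \bar R) :
  (\int[leb]_t ((tpow a t)%:E * J t) = \int[leb]_(t in `]0%R, +oo[) ((t `^ a)%:E * J t))%E.
Proof.
rewrite [RHS]integral_mkcond; apply: eq_integral => t _; rewrite patchE /tpow indicE.
by case: ifPn => _; rewrite ?mulr1// mulr0 mul0e.
Qed.

(** At small times the translates are bounded one by one, which leaves t^((s - sigma) / 2 - 1),
    integrable at 0. At large times the m-th difference gains (T / t)^(m / 2), and s - sigma < m
    makes the tail converge. *)
Lemma integral_fdiff_time (s sigma : R) (m : nat) :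
  s < n%:R -> 0 <= sigma -> sigma < s -> s - sigma < m%:R ->
  exists2 C : R, 0 < C & forall f x (K T : R), measurable_fun setT f -> 0 <= K -> 0 < T ->
  cube_bounded f x K (n%:R - sigma) ->
  (\int[leb]_t ((tpow (s / 2 - 1) t)%:E *
     \int[mu]_z (heat_kernel T z * `|fdiff z m (heat (distribution_of f) t) x|)%:E) <=
   (C * K * T `^ ((s - sigma) / 2))%:E)%E.
Proof.
move=> sn sg0 ss sm; have sgn := lt_trans ss sn.
have m0 : (0 < m)%N by rewrite -(ltr0n R) (lt_trans _ sm)// subr_gt0.
have [C1 [kappa [C10 k0 H1]]] := @fdiff_heat_kernel_le R n m.
have [C2 C20 H2] := @gaussian_moment R n m kappa k0 m0.
pose tent := tent_const 4 (n%:R - sigma).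
have tent0 : 0 < tent := tent_const_gt0 _ _.
pose e := (s - sigma) / 2; have e0 : 0 < e by rewrite divr_gt0// subr_gt0.
pose b := (m%:R - (s - sigma)) / 2; have b0 : 0 < b by rewrite divr_gt0// subr_gt0.
pose a := 8 * kappa; have a0 : 0 < a by rewrite mulr_gt0.
pose k1 := fdiff_mass m * tent * shell_const 1 (1 - e) * a `^ e.
pose k2 := C1 * tent * C2 * shell_const 1 (1 + b) * a `^ (- b).
have sc1 : 0 < shell_const 1 (1 - e) by rewrite shell_const_gt0// gt_eqF// gtrBl.
have sc2 : 0 < shell_const 1 (1 + b) by rewrite shell_const_gt0// lt_eqF// ltrDl.
have k10 : 0 <= k1.
  apply: mulr_ge0; last exact: powR_ge0.
  by apply: mulr_ge0; [apply: mulr_ge0; [exact: fdiff_mass_ge0|exact: ltW]|exact: ltW].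
have k20 : 0 < k2.
  apply: mulr_gt0; last exact: powR_gt0.
  by apply: mulr_gt0 => //; apply: mulr_gt0 => //; exact: mulr_gt0.
exists (k1 + k2); first by rewrite ltr_wpDl.
move=> f x K T mf K0 T0 hK; rewrite integral_tpow_ereal.
pose J t := (\int[mu]_z (heat_kernel T z * `|fdiff z m (heat (distribution_of f) t) x|)%:E)%E.
rewrite -[X in (X <= _)%E]/(\int[leb]_(t in `]0%R, +oo[) ((t `^ (s / 2 - 1))%:E * J t))%E.
have mJ : measurable_fun setT J.
  apply: (@tonelli_measurable _ _ _ _ _ mu
    (fun t z => (heat_kernel T z * `|fdiff z m (heat (distribution_of f) t) x|)%:E)); last first.
    by move=> t z; rewrite lee_fin mulr_ge0 ?heat_kernel_ge0.
  apply/measurable_EFinP; apply: measurable_funM.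
    by apply: measurable_heat_kernel => //; exact: measurable_snd.
  apply: (measurableT_comp (@normr_measurable R setT)).
  exact: (measurableT_comp (measurable_heat_fdiff x m mf) (@measurable_swap _ _ _ _)).
have J0 t : (0 <= J t)%E.
  by apply: integral_ge0 => z _; rewrite lee_fin mulr_ge0 ?heat_kernel_ge0.
(* With a = 8 kappa this is the time from which [gaussian_moment] holds. *)
pose rho := a * T; have rho0 : 0 < rho by rewrite mulr_gt0.
have -> : `]0%R, +oo[%classic = `]0%R, rho] `|` `]rho, +oo[ :> set R.
  by rewrite -itv_bndbnd_setU ?bnd_simp// ltW.
rewrite ge0_integral_setU//=; last 3 first.
- apply: emeasurable_funM; last exact: measurable_funTS.
  by apply/measurable_EFinP; apply: measurable_funTS; exact: measurable_powR_itv.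
- by move=> t _; rewrite mule_ge0// lee_fin powR_ge0.
- apply/disj_setPS => t [] /=; rewrite !in_itv/= andbT => /andP[_ t1] t1'.
  by move: (le_lt_trans t1 t1'); rewrite ltxx.
rewrite 2!mulrDl EFinD; apply: leeD.
- apply: (@le_trans _ _ (\int[leb]_(t in `]0%R, rho])
     ((fdiff_mass m * tent * K)%:E * (t `^ (e - 1))%:E))%E).
    apply: ge0_le_integral_nm => t /=; rewrite in_itv/= => /andP[t0 _].
      by rewrite mule_ge0// lee_fin powR_ge0.
    apply: (le_trans (lee_wpmul2l _ (integral_fdiff_heat_low mf sgn sg0 K0 hK m T0 t0))).
      by rewrite lee_fin powR_ge0.
    rewrite -!EFinM lee_fin -/tent.
    rewrite [leLHS](_ : _ = fdiff_mass m * tent * K * (t `^ (s / 2 - 1) * t `^ (- (sigma / 2)))); last by ring.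
    rewrite -powRD; last by rewrite (gt_eqF t0) implybT.
    by rewrite (_ : s / 2 - 1 - sigma / 2 = e - 1)// /e; lra.
  have c0 : 0 <= fdiff_mass m * tent * K.
    by apply: mulr_ge0 => //; apply: mulr_ge0; [exact: fdiff_mass_ge0|exact: ltW].
  rewrite integral_scale_set//; first last.
  - by move=> t; rewrite lee_fin powR_ge0.
  - by apply/measurable_EFinP; exact: measurable_powR_itv.
  apply: (le_trans (lee_wpmul2l _ (integral_powR_low e0 rho0))); first by rewrite lee_fin.
  rewrite -EFinM lee_fin -/e /rho powRM ?(ltW a0) ?(ltW T0)// /k1.
  by rewrite le_eqVlt; apply/orP; left; apply/eqP; ring.
- pose c := C1 * tent * K * C2 * T `^ (m%:R / 2).
  have c0 : 0 <= c.
    apply: mulr_ge0; last exact: powR_ge0.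
    by apply: mulr_ge0; [apply: mulr_ge0 => //; apply: mulr_ge0|]; exact: ltW.
  apply: (@le_trans _ _ (\int[leb]_(t in `]rho, +oo[) (c%:E * (t `^ (- b - 1))%:E))%E).
    apply: ge0_le_integral_nm => t /=; rewrite in_itv/= andbT => Tt.
      by rewrite mule_ge0// lee_fin powR_ge0.
    have t0 : 0 < t by exact: lt_trans Tt.
    have hJ : (J t <= (C1 * (tent * K * t `^ (- (sigma / 2))) * (C2 * (T / t) `^ (m%:R / 2)))%:E)%E.
      pose A := C1 * (tent * K * t `^ (- (sigma / 2))).
      have A0 : 0 <= A.
        apply: mulr_ge0; first exact: ltW.
        by apply: mulr_ge0; [apply: mulr_ge0 => //; exact: ltW|exact: powR_ge0].
      have M0 z : 0 <= heat_kernel T z * ((enorm z / Num.sqrt t) ^+ m * expR (kappa * (enorm z ^+ 2 / t))).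
        apply: mulr_ge0; first exact: heat_kernel_ge0.
        by apply: mulr_ge0; [rewrite exprn_ge0// divr_ge0 ?enorm_ge0 ?sqrtr_ge0|exact: expR_ge0].
      apply: (@le_trans _ _ (\int[mu]_z (A%:E * (heat_kernel T z *
          ((enorm z / Num.sqrt t) ^+ m * expR (kappa * (enorm z ^+ 2 / t))))%:E))%E).
        apply: ge0_le_integral_nm => z _; first by rewrite lee_fin mulr_ge0 ?heat_kernel_ge0.
        rewrite -EFinM lee_fin [leRHS]mulrCA ler_wpM2l ?heat_kernel_ge0//.
        exact: (heat_fdiff_le mf sgn sg0 K0 hK t0 (ltW C10) (fun w => H1 t w z t0)).
      rewrite integral_scale//; last first.
        apply/measurable_EFinP; apply: measurable_funM; first exact: measurable_heat_kernel.
        apply: measurable_funM.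
          by apply: measurable_funX; apply: measurable_funM => //; exact: measurable_enorm.
        apply: measurableT_comp => //; apply: measurable_funM => //.
        by apply: measurable_funM => //; apply: measurable_funX; exact: measurable_enorm.
      by rewrite [leRHS]EFinM lee_wpmul2l ?lee_fin// H2// ltW.
    apply: (le_trans (lee_wpmul2l _ hJ)); first by rewrite lee_fin powR_ge0.
    rewrite -!EFinM lee_fin.
    have -> : (T / t) `^ (m%:R / 2) = T `^ (m%:R / 2) * t `^ (- (m%:R / 2)).
      rewrite powRM ?invr_ge0 ?(ltW T0) ?(ltW t0)//; congr (_ * _).
      by rewrite -powR_inv1 ?(ltW t0)// -powRrM mulN1r.
    rewrite [leLHS](_ : _ = c * (t `^ (s / 2 - 1) * t `^ (- (sigma / 2)) * t `^ (- (m%:R / 2)))); last by rewrite /c; ring.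
    rewrite -!powRD; try by rewrite (gt_eqF t0) implybT.
    by rewrite (_ : s / 2 - 1 - sigma / 2 - m%:R / 2 = - b - 1)// /b; lra.
  rewrite integral_scale_set//; first last.
  - by move=> t; rewrite lee_fin powR_ge0.
  - by apply/measurable_EFinP; exact: measurable_powR_itv.
  apply: (le_trans (lee_wpmul2l _ (integral_powR_high b0 rho0))); first by rewrite lee_fin.
  rewrite -EFinM lee_fin -/e /rho powRM ?(ltW a0) ?(ltW T0)// /k2 /c.
  have -> : T `^ e = T `^ (m%:R / 2) * T `^ (- b).
    rewrite -powRD; last by rewrite (gt_eqF T0) implybT.
    by congr (_ `^ _); rewrite /e /b; lra.
  by rewrite le_eqVlt; apply/orP; left; apply/eqP; ring.
Qed.

(* u is a potential only pointwise almost everywhere and the integral over t may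
   fail to be dominated, so Fubini cannot move the heat semigroup inside it; a
   finite combination of translates of u needs no such exchange. *)
Lemma integral_fdiff_potential f u x (s : R) (m : nat) (T : R) : (0 < n)%N -> 0 < s -> s < n%:R ->
  measurable_fun setT f -> measurable_fun setT u -> 0 < T ->
  {ae mu, forall y, (u y)%:E = neg_laplacian_pow s f y} ->
  (u x)%:E = neg_laplacian_pow s f x ->
  (\int[mu]_z (heat_kernel T z * `|fdiff z m u x|)%:E <=
   (Gamma (s / 2))^-1%:E * \int[leb]_t ((tpow (s / 2 - 1) t)%:E *
     \int[mu]_z (heat_kernel T z * `|fdiff z m (heat (distribution_of f) t) x|)%:E))%E.
Proof.
move=> n0 s0 sn mf mu_ T0 hu hx.
pose G := (Gamma (s / 2))^-1 : R.
have G0 : 0 < G by rewrite invr_gt0 Gamma_gt0// divr_gt0.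
pose F t := heat (distribution_of f) t.
pose Phi z t := ((tpow (s / 2 - 1) t * `|fdiff z m (F t) x|)%:E : \bar R).
have mPhi : measurable_fun setT (fun a : 'rV[R]_n * R => Phi a.1 a.2).
  apply/measurable_EFinP; apply: measurable_funM.
    exact: measurableT_comp (measurable_tpow _) measurable_snd.
  exact: (measurableT_comp (@normr_measurable R setT) (measurable_heat_fdiff x m mf)).
have Phi0 z t : (0 <= Phi z t)%E by rewrite lee_fin mulr_ge0 ?tpow_ge0.
have mI : measurable_fun setT (fun z => \int[leb]_t Phi z t)%E.
  exact: tonelli_measurable.
(* For j = 0 the equation is needed at the single point x, which is the hypothesis on x. For j >= 1
   it is pulled back along z -> x + j z, under which null sets have null preimages. *)
have aez : {ae mu, forall z, forall j : nat, (u (x + j%:R *: z))%:E = neg_laplacian_pow s f (x + j%:R *: z)}.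
  apply: ae_foralln => -[|j].
    by apply: nearW => z; rewrite scale0r addr0.
  exact: (ae_rV_affine x (ltr0Sn R j) hu).
have step : {ae mu, forall z, ((heat_kernel T z * `|fdiff z m u x|)%:E <=
    G%:E * ((heat_kernel T z)%:E * \int[leb]_t Phi z t))%E}.
  apply: filterS aez => z hz.
  pose g (j : nat) t := tpow (s / 2 - 1) t * F t (x + j%:R *: z).
  have mg j : measurable_fun setT (g j).
    apply: measurable_funM; first exact: measurable_tpow.
    exact: (measurableT_comp (measurable_heat mf) (pair2_measurable (x + j%:R *: z))).
  have gE j : ((u (x + j%:R *: z))%:E = G%:E * \int[leb]_t (g j t)%:E)%E.
    by rewrite hz neg_laplacian_powE// integral_tpow.
  (* The value of u at the translate is finite and the prefactor positive, so the time integral is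
     finite, and finiteness gives integrability. *)
  have gi j : leb.-integrable setT (EFin \o g j).
    apply: integrable_fin_integral; first exact: mg.
    have := gE j; case: (\int[leb]_t (g j t)%:E)%E => [r| |] //.
      by rewrite gt0_muley ?lte_fin.
    by rewrite gt0_muleNy ?lte_fin.
  have [i1 e1] := @integral_lincomb _ _ _ leb setT m.+1 (@fdiff_coef R m) g measurableT (fun j _ => gi j).
  have sE t : \sum_(j < m.+1) fdiff_coef m j * g j t = tpow (s / 2 - 1) t * fdiff z m (F t) x.
    by rewrite fdiffE mulr_sumr; apply: eq_bigr => j _; rewrite mulrCA.
  have E : ((fdiff z m u x)%:E = G%:E * \int[leb]_t (tpow (s / 2 - 1) t * fdiff z m (F t) x)%:E)%E.
    have -> : (\int[leb]_t (tpow (s / 2 - 1) t * fdiff z m (F t) x)%:E =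
      \int[leb]_t (\sum_(j < m.+1) fdiff_coef m j * g j t)%:E)%E.
      by apply: eq_integral => t _; rewrite sE.
    rewrite e1 -EFinM; congr EFin; rewrite fdiffE mulr_sumr; apply: eq_bigr => j _.
    rewrite mulrCA; congr (_ * _); apply: EFin_inj; rewrite EFinM gE fineK//.
    exact: (integrable_fin_num measurableT (gi j)).
  rewrite [leLHS]EFinM muleCA lee_wpmul2l ?lee_fin ?heat_kernel_ge0// -abse_EFin E abseM.
  rewrite abse_EFin (ger0_norm (ltW G0)) lee_wpmul2l ?lee_fin ?(ltW G0)//.
  apply: (le_trans (le_abse_integral _ _ _)) => //.
    have := measurable_int _ i1; congr measurable_fun; apply/funext => t; by rewrite sE.
  rewrite le_eqVlt; apply/orP; left; apply/eqP; apply: eq_integral => t _.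
  by rewrite abse_EFin normrM (ger0_norm (tpow_ge0 _ _)).
pose hI z : \bar R := ((heat_kernel T z)%:E * \int[leb]_t Phi z t)%E.
have mhI : measurable_fun setT hI.
  by apply: emeasurable_funM => //; apply/measurable_EFinP; exact: measurable_heat_kernel.
have hI0 z : (0 <= hI z)%E.
  by apply: mule_ge0; [rewrite lee_fin heat_kernel_ge0|exact: integral_ge0].
apply: (@le_trans _ _ (\int[mu]_z (G%:E * hI z))%E).
  apply: ge0_ae_le_integral_nm => //.
  - by move=> z; rewrite lee_fin mulr_ge0 ?heat_kernel_ge0.
  - by move=> z; rewrite mule_ge0// lee_fin ltW.
  - exact: measurable_funeM.
rewrite integral_scale ?(ltW G0)//; rewrite lee_wpmul2l ?lee_fin ?(ltW G0)//.
pose Psi z t := ((heat_kernel T z)%:E * Phi z t)%E.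
have mPsi : measurable_fun setT (fun a : 'rV[R]_n * R => Psi a.1 a.2).
  apply: emeasurable_funM => //; apply/measurable_EFinP.
  by apply: measurable_heat_kernel => //; exact: measurable_fst.
have Psi0 z t : (0 <= Psi z t)%E by rewrite mule_ge0// lee_fin heat_kernel_ge0.
rewrite le_eqVlt; apply/orP; left; apply/eqP.
transitivity (\int[mu]_z \int[leb]_t Psi z t)%E.
  apply: eq_integral => z _; rewrite /Psi integral_scale ?heat_kernel_ge0//.
  exact: (measurableT_comp mPhi (pair1_measurable z)).
rewrite (tonelli_swap mu leb mPsi Psi0); apply: eq_integral => t _.
rewrite /Psi /Phi -integral_scale ?tpow_ge0//; first last.
- by move=> z; rewrite lee_fin mulr_ge0 ?heat_kernel_ge0.
- apply/measurable_EFinP; apply: measurable_funM; first exact: measurable_heat_kernel.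
  apply: (measurableT_comp (@normr_measurable R setT)).
  exact: (measurableT_comp (measurable_heat_fdiff x m mf) (pair2_measurable t)).
by apply: eq_integral => z _; rewrite -!EFinM mulrCA.
Qed.

End potential_pointwise.

Section potential_besov.
Context {R : realType} {n : nat}.
Local Notation mu := (@lebesgue_rV R n).
Local Notation leb := (@lebesgue_measure R).
Implicit Types (f u : 'rV[R]_n -> R) (x y z w : 'rV[R]_n).

(** Substitute y = x + (j + 1) z: the dilation factors of the Gaussian and of Lebesgue measure
    cancel. *)
Lemma heat_dilate u x (T : R) (j : nat) : 0 < T ->
  (forall phi, schwartz phi -> mu.-integrable setT (fun y => (u y * phi y)%:E)) ->
  mu.-integrable setT (EFin \o (fun z => heat_kernel T z * u (x + j.+1%:R *: z))) /\
  (\int[mu]_z (heat_kernel T z * u (x + j.+1%:R *: z))%:E =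
   (heat (distribution_of u) (j.+1%:R ^+ 2 * T) x)%:E)%E.
Proof.
move=> T0 hu; set c : R := j.+1%:R; have c0 : 0 < c by rewrite ltr0n.
have cT0 : 0 < c ^+ 2 * T by rewrite mulr_gt0// exprn_gt0.
have cn : 0 < c ^- n by rewrite invr_gt0 exprn_gt0.
have iu := hu _ (schwartz_heat_kernel x cT0).
have E z : (heat_kernel T z * u (x + c *: z))%:E =
    ((c ^+ n)%:E * (u (x + c *: z) * heat_kernel (c ^+ 2 * T) (x - (x + c *: z)))%:E)%E.
  rewrite opprD addNKr heat_kernelN heat_kernel_scale// -EFinM; congr EFin.
  by field; rewrite expf_neq0// gt_eqF.
have ia := integrable_rV_affine x c0 iu.
split.
  have := integrableZl measurableT (c ^+ n) ia; apply: eq_integrable => // z _.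
  by rewrite /= E.
under eq_integral do rewrite E.
rewrite integralZl// (integral_rV_affine_integrable x c0 iu) muleA -EFinM mulfV ?mul1e; last first.
  by rewrite expf_neq0// gt_eqF.
by rewrite heat_distribution_of /Rintegral fineK//; exact: (integrable_fin_num measurableT iu).
Qed.

(** The term j = 0 of the averaged difference is (-1)^m u(x), because h_T has mass 1. Solving for it
    leaves the averaged difference and the heat flow at m positive times. *)
Lemma potential_le u x (ms B : R) (m : nat) (T A : R) :
  0 < T -> 0 <= B ->
  (forall phi, schwartz phi -> mu.-integrable setT (fun y => (u y * phi y)%:E)) ->
  (forall j : nat, `|heat (distribution_of u) (j.+1%:R ^+ 2 * T) x| <= B * T `^ (- (ms / 2))) ->
  (\int[mu]_z (heat_kernel T z * `|fdiff z m u x|)%:E <= A%:E)%E ->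
  `|u x| <= A + fdiff_mass (R := R) m * (B * T `^ (- (ms / 2))).
Proof.
move=> T0 B0 hu hB hA.
have e1h : (\int[mu]_z (heat_kernel T z)%:E = 1)%E.
  by rewrite -(@integral_heat_kernel R n T 0 T0); apply: eq_integral => z _; rewrite add0r.
have ih : mu.-integrable setT (EFin \o heat_kernel T).
  apply/integrableP; split; first by apply/measurable_EFinP; exact: measurable_heat_kernel.
  have -> : (\int[mu]_z `|(EFin \o heat_kernel T) z| = \int[mu]_z (heat_kernel T z)%:E)%E.
    by apply: eq_integral => z _; rewrite gee0_abs// lee_fin heat_kernel_ge0.
  by rewrite e1h ltry.
pose g (j : nat) z := heat_kernel T z * u (x + j%:R *: z).
pose I (j : nat) := if j is i.+1 then heat (distribution_of u) (i.+1%:R ^+ 2 * T) x else u x.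
have gI j : mu.-integrable setT (EFin \o g j) /\ (\int[mu]_z (g j z)%:E = (I j)%:E)%E.
  case: j => [|j]; last exact: heat_dilate.
  have E z : (g 0 z)%:E = ((u x)%:E * (heat_kernel T z)%:E)%E.
    by rewrite /g scale0r addr0 mulrC EFinM.
  split.
    have := integrableZl measurableT (u x) ih; apply: eq_integrable => // z _.
    by rewrite /= E.
  by under eq_integral do rewrite E; rewrite integralZl// e1h mule1.
have [i1 e1] := @integral_lincomb _ _ _ mu setT m.+1 (@fdiff_coef R m) g measurableT (fun j _ => (gI j).1).
have sE z : \sum_(j < m.+1) fdiff_coef m j * g j z = heat_kernel T z * fdiff z m u x.
  by rewrite fdiffE mulr_sumr; apply: eq_bigr => j _; rewrite mulrCA.
have {}e1 : (\int[mu]_z (heat_kernel T z * fdiff z m u x)%:E =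
    (\sum_(j < m.+1) fdiff_coef m j * I j)%:E)%E.
  transitivity (\int[mu]_z (\sum_(j < m.+1) fdiff_coef m j * g j z)%:E)%E.
    by apply: eq_integral => z _; rewrite sE.
  by rewrite e1; congr EFin; apply: eq_bigr => j _; rewrite (gI j).2.
have hS : `|\sum_(j < m.+1) fdiff_coef m j * I j| <= A.
  rewrite -lee_fin -abse_EFin -e1; apply: le_trans hA.
  apply: (le_trans (le_abse_integral _ _ _)) => //.
    have := measurable_int _ i1; congr measurable_fun; apply/funext => z; by rewrite sE.
  rewrite le_eqVlt; apply/orP; left; apply/eqP; apply: eq_integral => z _.
  by rewrite abse_EFin normrM (ger0_norm (heat_kernel_ge0 _ _)).
have c0 : `|@fdiff_coef R m 0| = 1 by rewrite fdiff_coef0 normrX normrN1 expr1n.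
rewrite big_ord_recl/= in hS.
set S := \sum_(i < m) _ in hS.
have hT : `|S| <= fdiff_mass (R := R) m * (B * T `^ (- (ms / 2))).
  apply: (le_trans (ler_norm_sum _ _ _)); rewrite /fdiff_mass mulr_suml [leRHS]big_ord_recl.
  rewrite ler_wpDl ?mulr_ge0 ?powR_ge0//; apply: ler_sum => j _.
  by rewrite normrM ler_wpM2l// hB.
have -> : `|u x| = `|fdiff_coef m 0 * u x + S - S| by rewrite addrK normrM c0 mul1r.
by apply: (le_trans (ler_normB _ _)); exact: lerD.
Qed.

Lemma potential_besov_le (s sigma ms : R) : (0 < n)%N -> 0 < s -> s < n%:R ->
  0 <= sigma -> sigma < s -> 0 < ms -> exists2 C : R, 0 < C & forall u f (B : R),
  measurable_fun setT f -> measurable_fun setT u ->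
  (forall phi, schwartz phi -> mu.-integrable setT (fun y => (u y * phi y)%:E)) ->
  (besov_norm ms (distribution_of u) <= B%:E)%E ->
  {ae mu, forall y, (u y)%:E = neg_laplacian_pow s f y} ->
  {ae mu, forall x, forall K, 0 <= K -> cube_bounded f x K (n%:R - sigma) ->
   (`|(u x)%:E| <= (C * (K `^ (ms / (s - sigma + ms)) *
      B `^ ((s - sigma) / (s - sigma + ms))))%:E)%E}.
Proof.
move=> n0 s0 sn sg0 ss ms0.
pose a := (s - sigma) / 2; have a0 : 0 < a by rewrite divr_gt0// subr_gt0.
pose b := ms / 2; have b0 : 0 < b by rewrite divr_gt0.
have dN : s - sigma + ms != 0 by rewrite gt_eqF// addr_gt0// subr_gt0.
have abE : a + b = (s - sigma + ms) / 2 by rewrite /a /b -mulrDl.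
have Eb : ms / (s - sigma + ms) = b / (a + b) by rewrite abE /b; field.
have Ea : (s - sigma) / (s - sigma + ms) = a / (a + b) by rewrite abE /a; field.
(* This is why differences of order n are enough: s - sigma <= s < n. *)
have sm : s - sigma < n%:R by rewrite (le_lt_trans _ sn)// gerBl.
have [C1 C10 H1] := @integral_fdiff_time R n s sigma n sn sg0 ss sm.
pose G := (Gamma (s / 2))^-1 : R; have G0 : 0 <= G by rewrite invr_ge0 Gamma_ge0.
pose mass := @fdiff_mass R n; have mass0 : 0 <= mass by exact: fdiff_mass_ge0.
pose c := G * C1 + mass + 1.
have GC0 : 0 <= G * C1 by rewrite mulr_ge0// ltW.
have c0 : 0 < c by rewrite ltr_wpDl// addr_ge0.
have cc1 : G * C1 <= c by rewrite /c -addrA lerDl addr_ge0.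
have cc2 : mass <= c by rewrite /c addrAC lerDr addr_ge0.
exists ((1 + 2 `^ b) * c).
  by rewrite mulr_gt0// ltr_wpDr// powR_ge0.
move=> u f B mf mu_ hu hB hae; have B0 := besov_bound_ge0 hB.
(* One null set serves all j and all dyadic times, a countable family; [pickle] indexes the times by
   nat for [ae_foralln]. *)
have tail : {ae mu, forall x, forall k j : nat, forall i : int, pickle i = k ->
    `|heat (distribution_of u) (j.+1%:R ^+ 2 * dyad i) x| <= B * dyad i `^ (- (ms / 2))}.
  apply: ae_foralln => k; apply: ae_foralln => j.
  case E : (@unpickle int k) => [i|]; last first.
    by apply: nearW => x i ik; move: E; rewrite -ik pickleK.
  have di : 0 < dyad i :> R by exact: dyad_gt0.
  have ji : 0 < j.+1%:R ^+ 2 * dyad i :> R by rewrite mulr_gt0// exprn_gt0.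
  have := besov_heat_le ji hB; apply: filterS => x hx i' i'k.
  have -> : i' = i by move: E; rewrite -i'k pickleK => -[].
  apply: (le_trans hx); rewrite ler_wpM2l// !powRN lef_pV2 ?posrE ?powR_gt0//.
  apply: le_powR; rewrite ?(ltW di) ?divr_ge0 ?(ltW ms0)// ler_peMl ?(ltW di)//.
  by rewrite exprn_ege1// ler1n.
move: (hae) tail; apply: filterS2 => x hx htail K K0 hK.
have := @dyadic_optimisation R `|(u x)%:E|%E (c * K) (c * B) a b a0 b0.
rewrite !mulr_ge0 ?(ltW c0)// => /(_ isT isT) h.
rewrite Ea Eb; apply: (le_trans (h _)).
  move=> k; have T0 : 0 < dyad k :> R by exact: dyad_gt0.
  have hA : (\int[mu]_z (heat_kernel (dyad k) z * `|fdiff z n u x|)%:E <=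
      (G * (C1 * K * dyad k `^ a))%:E)%E.
    apply: (le_trans (integral_fdiff_potential n n0 s0 sn mf mu_ T0 hae hx)).
    by rewrite EFinM lee_wpmul2l ?lee_fin//; exact: H1.
  rewrite abse_EFin lee_fin.
  apply: (le_trans (potential_le T0 B0 hu (fun j => htail _ j k erefl) hA)).
  apply: lerD.
    rewrite (_ : G * _ = G * C1 * (dyad k `^ a * K)); last by ring.
    by rewrite [leRHS]mulrCA ler_wpM2r ?mulr_ge0 ?powR_ge0.
  rewrite -/mass -/b (_ : mass * _ = mass * (dyad k `^ (- b) * B)); last by ring.
  by rewrite [leRHS]mulrCA ler_wpM2r ?mulr_ge0 ?powR_ge0.
rewrite lee_fin !powRM ?(ltW c0)// mulrACA -powRD; last by rewrite (gt_eqF c0) implybT.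
have -> : b / (a + b) + a / (a + b) = 1 by rewrite -mulrDl addrC divff// abE mulf_neq0// invr_neq0.
by rewrite powRr1 ?(ltW c0)// -[leRHS]mulrA.
Qed.

End potential_besov.

(** * Weighted norms *)

Section weighted_norms.
Context {R : realType} {n : nat}.
Hypothesis n0 : (0 < n)%N.
Local Notation mu := (@lebesgue_rV R n).
Implicit Types (f : 'rV[R]_n -> R) (g : 'rV[R]_n -> \bar R) (x : 'rV[R]_n).

Let n1 : 1 <= n%:R :> R. Proof. by rewrite ler1n. Qed.

Lemma enorm_powR_le x (a : R) : x != 0 ->
  `|x| `^ a <= n%:R `^ `|a| * enorm x `^ a /\ enorm x `^ a <= n%:R `^ `|a| * `|x| `^ a.
Proof.
move=> xN; have x0 : 0 < `|x| by rewrite normr_gt0.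
have e0 : 0 < enorm x by apply: lt_le_trans (norm_le_enorm x).
have h1 : `|x| <= n%:R * enorm x.
  by apply: (le_trans (norm_le_enorm x)); rewrite ler_peMl ?enorm_ge0.
have h2 := enorm_le_norm x.
by split; apply: powR_comparable.
Qed.

Lemma weighted_normE (a q : R) g :
  weighted_norm a q g = ((\int[mu]_x `|(enorm x `^ a)%:E * g x| `^ q) `^ q^-1)%E.
Proof. by rewrite /weighted_norm unlock. Qed.

Lemma weighted_norm_ge0 (a q : R) g : (0 <= weighted_norm a q g)%E.
Proof. exact: Lnorm_ge0. Qed.

(** i is the p-th power of the norm, named as a real number so that later exponents are handled in
    R. The factor in front of it pays for the sup norm in the weight. *)
Lemma weighted_Lp_finite (a p : R) f : 0 < p -> weighted_Lp a p f ->
  exists i : R, [/\ 0 <= i, weighted_norm a p (EFin \o f) = (i `^ p^-1)%:E &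
    (\int[mu]_x ((`|x| `^ a * `|f x|) `^ p)%:E <= (n%:R `^ (`|a| * p) * i)%:E)%E].
Proof.
move=> p0 [mf]; rewrite weighted_normE; set I := (\int[mu]_x _)%E => hI.
have I0 : (0 <= I)%E by apply: integral_ge0 => x _; exact: poweR_ge0.
have pN : p^-1 != 0 by rewrite invr_neq0// gt_eqF.
have Ifin : I \is a fin_num.
  move: hI I0; case: I => [r| |]//=.
  by rewrite (negbTE pN).
exists (fine I); have IE : I = (fine I)%:E by rewrite fineK.
split; [exact: fine_ge0|by rewrite {1}IE|].
rewrite EFinM -IE.
have mI : measurable_fun setT (fun x => (`|(enorm x `^ a)%:E * (EFin \o f) x| `^ p)%E).
  apply: measurable_fun_poweR; apply: measurableT_comp => //.
  apply: emeasurable_funM; last exact/measurable_EFinP.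
  by apply/measurable_EFinP; apply: measurable_fun_powR; exact: measurable_enorm.
rewrite /I -integral_scale ?powR_ge0//; last by move=> x; exact: poweR_ge0.
apply: ge0_ae_le_integral_nm.
- by move=> x; rewrite lee_fin powR_ge0.
- by move=> x; rewrite mule_ge0 ?poweR_ge0// lee_fin powR_ge0.
- exact: measurable_funeM.
have := @ae_rV_neq0 R n n0; apply: filterS => x xN.
have [h _] := enorm_powR_le a xN.
rewrite /= -?EFinM lee_fin powRrM -powRM ?powR_ge0//.
rewrite normrM (ger0_norm (powR_ge0 _ _)) mulrA.
by apply: le_powR; rewrite ?(ltW p0) ?mulr_ge0 ?powR_ge0// ler_wpM2r.
Qed.

Lemma weighted_norm_le (a q v : R) g : 0 < q ->
  (\int[mu]_x `|(enorm x `^ a)%:E * g x| `^ q <= v%:E)%E ->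
  (weighted_norm a q g <= (v `^ q^-1)%:E)%E.
Proof.
move=> q0 h; rewrite weighted_normE -poweR_EFin; apply: le_poweR => //.
  by rewrite invr_ge0 ltW.
by apply: integral_ge0 => x _; exact: poweR_ge0.
Qed.

(** Brings the majorant into the form of the pointwise estimates: its weighted L^q norm is finite
    and the weight is positive off the origin, so it is finite almost everywhere and may be taken
    real-valued. *)
Lemma fractional_maximal_cube (p q alpha gam sigma : R) :
  1 < p -> p <= q -> gam <= alpha -> alpha < n%:R - n%:R / p -> 0 < gam + n%:R / q ->
  gam + n%:R / q = alpha + n%:R / p - sigma ->
  exists2 C : R, 0 < C & forall f, weighted_Lp alpha p f ->
  exists N : 'rV[R]_n -> R, [/\ measurable_fun setT N, forall x, 0 <= N x,
    {ae mu, forall x, cube_bounded f x (N x) (n%:R - sigma)} &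
    forall i : R, 0 <= i -> weighted_norm alpha p (EFin \o f) = (i `^ p^-1)%:E ->
    (\int[mu]_x ((`|x| `^ gam * N x) `^ q)%:E <= (C * i `^ (q / p))%:E)%E].
Proof.
move=> p1 pq ga ap gq e; have p0 := lt_trans ltr01 p1; have q0 := lt_le_trans p0 pq.
have [C C0 H] := fractional_maximal n0 p1 pq ga ap gq e.
pose L := n%:R `^ (`|alpha| * p) : R; have L0 : 0 <= L by exact: powR_ge0.
have Lp : 0 < L by rewrite powR_gt0// (lt_le_trans ltr01).
exists (C * L `^ (q / p)); first by rewrite mulr_gt0// powR_gt0.
move=> f hf; have [i [i0 hi hS]] := weighted_Lp_finite p0 hf.
have [N [mN N0 hN hI]] := H f hf.1 (le_lt_trans hS (ltry _)).
have qp0 : 0 <= q / p by rewrite divr_ge0 ?(ltW q0) ?(ltW p0).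
have {}hI : (\int[mu]_x ((`|x| `^ gam)%:E * N x) `^ q <= (C * L `^ (q / p) * i `^ (q / p))%:E)%E.
  apply: (le_trans hI); rewrite -mulrA EFinM lee_wpmul2l ?lee_fin ?(ltW C0)//.
  rewrite -powRM// -poweR_EFin; apply: le_poweR => //.
  by apply: integral_ge0 => x _; rewrite lee_fin powR_ge0.
have mW : measurable_fun setT (fun x => (((`|x| `^ gam)%:E * N x) `^ q)%E).
  apply: measurable_fun_poweR; apply: emeasurable_funM => //.
  apply/measurable_EFinP; exact: (measurable_fun_powR gam (@measurable_rV_norm R n)).
have W0 x : (0 <= ((`|x| `^ gam)%:E * N x) `^ q)%E by exact: poweR_ge0.
have Nfin : {ae mu, forall x, N x \is a fin_num}.
  have iW : mu.-integrable setT (fun x => (((`|x| `^ gam)%:E * N x) `^ q)%E).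
    apply/integrableP; split => //; under eq_integral do rewrite gee0_abs//.
    by apply: le_lt_trans hI _; rewrite ltry.
  have := integrable_ae measurableT iW; have := @ae_rV_neq0 R n n0.
  apply: filterS2 => x xN /(_ I).
  have xp : 0 < `|x| `^ gam by rewrite powR_gt0// normr_gt0.
  have := N0 x; case: (N x) => [r| |]//.
  by rewrite gt0_muley ?lte_fin//= gt_eqF.
have feq : {ae mu, forall x, N x = (fine (N x))%:E}.
  by apply: filterS Nfin => x h; rewrite fineK.
exists (fun x => fine (N x)); split.
- exact: measurableT_comp.
- by move=> x; exact: fine_ge0.
- by apply: filterS feq => x hx rho rho0; rewrite EFinM -hx; exact: hN.
move=> i' i'0 hi'.
(* The p-th root is injective on nonnegative reals, so the norm determines i. *)
have <- : i = i'.
  move: hi'; rewrite hi => -[h]; rewrite -[i]powRr1// -[i']powRr1//.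
  by rewrite -(mulVf (lt0r_neq0 p0)) !powRrM h.
apply: le_trans hI; apply: ge0_ae_le_integral_nm => //.
  by move=> x; rewrite lee_fin powR_ge0.
by apply: filterS feq => x hx; rewrite {2}hx -EFinM poweR_EFin.
Qed.

(** |x|^gam N^theta is the theta-th power of |x|^(gam / theta) N, so its L^r norm is the theta-th
    power of an L^(theta r) norm. This dictates the exponents given to the majorant. *)
Lemma weighted_norm_interpolation (p r alpha gam theta sigma C1 : R) :
  1 < p -> 0 < theta -> p <= theta * r -> gam / theta <= alpha ->
  alpha < n%:R - n%:R / p -> 0 < gam + n%:R / r ->
  (gam + n%:R / r) / theta = alpha + n%:R / p - sigma -> 0 < C1 ->
  exists2 C : R, 0 < C & forall f g (B : R), weighted_Lp alpha p f -> 0 <= B ->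
  {ae mu, forall x, forall K, 0 <= K -> cube_bounded f x K (n%:R - sigma) ->
    (`|g x| <= (C1 * (K `^ theta * B `^ (1 - theta)))%:E)%E} ->
  (weighted_norm gam r g <= C%:E * weighted_norm alpha p (EFin \o f) `^ theta *
     B%:E `^ (1 - theta))%E.
Proof.
move=> p1 th0 ptr ga ap gr e C10; have p0 := lt_trans ltr01 p1.
have tr0 := lt_le_trans p0 ptr; have r0 : 0 < r by rewrite -(pmulr_rgt0 _ th0).
have thN := lt0r_neq0 th0; have rN := lt0r_neq0 r0; have pN := lt0r_neq0 p0.
have eq : gam / theta + n%:R / (theta * r) = (gam + n%:R / r) / theta.
  by field; rewrite thN rN.
have gq : 0 < gam / theta + n%:R / (theta * r) by rewrite eq divr_gt0.
have [C2 C20 H] := fractional_maximal_cube p1 ptr ga ap gq (etrans eq e).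
pose L := n%:R `^ `|gam| : R.
have L0 : 0 < L by rewrite powR_gt0// (lt_le_trans ltr01).
exists (L * C1 * C2 `^ r^-1); first by rewrite !mulr_gt0// powR_gt0.
move=> f g B hf B0 hg.
have [i [i0 hi _]] := weighted_Lp_finite p0 hf.
have [N [mN N0 hN hI]] := H f hf.
have {}hI := hI i i0 hi.
pose c := L * C1 * B `^ (1 - theta).
have c0 : 0 <= c by rewrite !mulr_ge0 ?powR_ge0// ltW.
pose A x := `|x| `^ (gam / theta) * N x.
have mA : measurable_fun setT A.
  by apply: measurable_funM => //; exact: (measurable_fun_powR _ (@measurable_rV_norm R n)).
have A0 x : 0 <= A x by rewrite mulr_ge0 ?powR_ge0.
have bound : (\int[mu]_x `|(enorm x `^ gam)%:E * g x| `^ r <=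
    (c `^ r * (C2 * i `^ (theta * r / p)))%:E)%E.
  apply: (@le_trans _ _ (\int[mu]_x ((c `^ r)%:E * (A x `^ (theta * r))%:E))%E); last first.
    rewrite integral_scale ?powR_ge0//; last 2 first.
    - by apply/measurable_EFinP; exact: measurable_fun_powR.
    - by move=> x; rewrite lee_fin powR_ge0.
    by rewrite EFinM lee_wpmul2l ?lee_fin ?powR_ge0.
  apply: ge0_ae_le_integral_nm.
  - by move=> x; exact: poweR_ge0.
  - by move=> x; rewrite mule_ge0// lee_fin powR_ge0.
  - by apply: measurable_funeM; apply/measurable_EFinP; exact: measurable_fun_powR.
  have := @ae_rV_neq0 R n n0; move: hg hN; apply: filterS3 => x hgx hNx xN.
  have {}hgx := hgx _ (N0 x) hNx.
  have [_ hw] := enorm_powR_le gam xN.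
  have x0 : 0 < `|x| by rewrite normr_gt0.
  have hE : (`|(enorm x `^ gam)%:E * g x| <= (c * A x `^ theta)%:E)%E.
    rewrite abseM abse_EFin (ger0_norm (powR_ge0 _ _)).
    apply: (le_trans (lee_wpmul2l _ hgx)); first by rewrite lee_fin powR_ge0.
    rewrite -EFinM lee_fin /A powRM ?powR_ge0// -powRrM divfK//.
    apply: (le_trans (ler_wpM2r _ hw)).
      by rewrite mulr_ge0 ?(ltW C10)// mulr_ge0 ?powR_ge0.
    by rewrite /c -/L le_eqVlt; apply/orP; left; apply/eqP; ring.
  apply: (le_trans (le_poweR (ltW r0) (abse_ge0 _) hE)).
  by rewrite poweR_EFin -EFinM lee_fin powRM ?powR_ge0// -powRrM.
apply: (le_trans (weighted_norm_le r0 bound)).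
rewrite hi !poweR_EFin -!EFinM lee_fin powRM ?powR_ge0//; last first.
  by rewrite mulr_ge0 ?(ltW C20) ?powR_ge0.
rewrite powRM ?powR_ge0 ?(ltW C20)// -!powRrM mulfV// powRr1//.
have -> : theta * r / p / r = p^-1 * theta by field; rewrite pN rN.
by rewrite /c le_eqVlt; apply/orP; left; apply/eqP; ring.
Qed.

End weighted_norms.

(** * The endpoint theta = 1 *)

Section endpoint.
Context {R : realType} {n : nat}.
Hypothesis n0 : (0 < n)%N.
Local Notation mu := (@lebesgue_rV R n).
Implicit Types (f : 'rV[R]_n -> R) (g : 'rV[R]_n -> \bar R) (x : 'rV[R]_n).

Lemma poweR_le_bound (X : \bar R) (c i q k : R) : 0 <= c -> 0 <= i -> 0 <= k -> (0 <= X)%E ->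
  (X <= (c * i `^ q)%:E)%E -> (X `^ k <= (c `^ k * i `^ (q * k))%:E)%E.
Proof.
move=> c0 i0 k0 X0 h; apply: (le_trans (le_poweR k0 X0 h)).
by rewrite poweR_EFin lee_fin powRM ?powR_ge0// -powRrM.
Qed.

(** Each majorant lies in its own weighted space of exponent r1 or r2. As 1/r1 + 1/r2 = 2/r,
    Hoelder's inequality puts the product of their square roots in L^r, with the mean of the two
    weight exponents. *)
Lemma weighted_norm_hoelder (p r r1 r2 alpha gam1 gam2 sigma1 sigma2 C1 : R) :
  1 < p -> p <= r1 -> p <= r2 -> 0 < r -> r1^-1 + r2^-1 = 2 * r^-1 ->
  gam1 <= alpha -> gam2 <= alpha -> alpha < n%:R - n%:R / p ->
  0 < gam1 + n%:R / r1 -> 0 < gam2 + n%:R / r2 ->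
  gam1 + n%:R / r1 = alpha + n%:R / p - sigma1 ->
  gam2 + n%:R / r2 = alpha + n%:R / p - sigma2 -> 0 < C1 ->
  exists2 C : R, 0 < C & forall f g, weighted_Lp alpha p f ->
  {ae mu, forall x, forall K1 K2, 0 <= K1 -> 0 <= K2 -> cube_bounded f x K1 (n%:R - sigma1) ->
    cube_bounded f x K2 (n%:R - sigma2) ->
    (`|g x| <= (C1 * (K1 `^ 2^-1 * K2 `^ 2^-1))%:E)%E} ->
  (weighted_norm ((gam1 + gam2) / 2) r g <= C%:E * weighted_norm alpha p (EFin \o f))%E.
Proof.
move=> p1 pr1 pr2 r0 er ga1 ga2 ap gp1 gp2 e1 e2 C10; have p0 := lt_trans ltr01 p1.
have r10 := lt_le_trans p0 pr1; have r20 := lt_le_trans p0 pr2.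
have [c1 c10 H1] := fractional_maximal_cube n0 p1 pr1 ga1 ap gp1 e1.
have [c2 c20 H2] := fractional_maximal_cube n0 p1 pr2 ga2 ap gp2 e2.
have rN := lt0r_neq0 r0; have r1N := lt0r_neq0 r10; have r2N := lt0r_neq0 r20.
have pN := lt0r_neq0 p0.
set gam := (gam1 + gam2) / 2.
pose L := n%:R `^ `|gam| : R.
have L0 : 0 < L by rewrite powR_gt0// ltr0n.
(* The exponent for which (A2^(r / 2))^P = A2^r2; the relation between r, r1 and r2 makes its
   conjugate 2 r1 / r. *)
pose P := 2 * r2 / r; have P0 : 0 < P by rewrite divr_gt0// mulr_gt0.
have PV : P^-1 = r / (2 * r2) by rewrite /P invf_div.
have PV1 : 1 - P^-1 = r / (2 * r1).
  rewrite PV; have -> : r / (2 * r2) = r * r2^-1 / 2 by field.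
  by have -> : r2^-1 = 2 * r^-1 - r1^-1 by [rewrite -er addrAC subrr add0r]; field; rewrite ?rN ?r1N.
have Pgt1 : 1 < P by rewrite -invf_lt1// -subr_gt0 PV1 divr_gt0// mulr_gt0.
have PP : P / (P - 1) = 2 * r1 / r.
  have P1N : P - 1 != 0 by rewrite subr_eq0 gt_eqF.
  have -> : P / (P - 1) = (1 - P^-1)^-1.
    by field; rewrite P1N (lt0r_neq0 P0).
  by rewrite PV1 invf_div.
pose D := c1 `^ (1 - P^-1) * c2 `^ P^-1.
have D0 : 0 < D by rewrite mulr_gt0 ?powR_gt0.
exists (L * C1 * D `^ r^-1); first by rewrite !mulr_gt0// powR_gt0.
move=> f g hf hg; have [i [i0 hi _]] := weighted_Lp_finite n0 p0 hf.
have [N1 [mN1 N10 hN1 hI1]] := H1 f hf; have {}hI1 := hI1 i i0 hi.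
have [N2 [mN2 N20 hN2 hI2]] := H2 f hf; have {}hI2 := hI2 i i0 hi.
pose A1 x := `|x| `^ gam1 * N1 x; pose A2 x := `|x| `^ gam2 * N2 x.
have mA1 : measurable_fun setT A1.
  by apply: measurable_funM => //; exact: (measurable_fun_powR _ (@measurable_rV_norm R n)).
have mA2 : measurable_fun setT A2.
  by apply: measurable_funM => //; exact: (measurable_fun_powR _ (@measurable_rV_norm R n)).
have A10 x : 0 <= A1 x by rewrite mulr_ge0 ?powR_ge0.
have A20 x : 0 <= A2 x by rewrite mulr_ge0 ?powR_ge0.
pose F x := A1 x `^ (r / 2); pose G x := A2 x `^ (r / 2).
have mF : measurable_fun setT F by exact: measurable_fun_powR.
have mG : measurable_fun setT G by exact: measurable_fun_powR.
have r0' : 0 <= r by exact: ltW.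
have FG : (\int[mu]_x (F x * G x)%:E <= (D * i `^ (r / p))%:E)%E.
  have b1 : (\int[mu]_x (F x `^ (P / (P - 1)))%:E <= (c1 * i `^ (r1 / p))%:E)%E.
    apply: le_trans hI1; rewrite le_eqVlt; apply/orP; left; apply/eqP.
    apply: eq_integral => x _; rewrite /F -powRrM PP; congr (_ `^ _)%:E.
    by field; rewrite rN.
  have b2 : (\int[mu]_x (G x `^ P)%:E <= (c2 * i `^ (r2 / p))%:E)%E.
    apply: le_trans hI2; rewrite le_eqVlt; apply/orP; left; apply/eqP.
    apply: eq_integral => x _; rewrite /G -powRrM /P; congr (_ `^ _)%:E.
    by field; rewrite rN.
  have X1 : (0 <= \int[mu]_x (F x `^ (P / (P - 1)))%:E)%E.
    by apply: integral_ge0 => x _; rewrite lee_fin powR_ge0.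
  have X2 : (0 <= \int[mu]_x (G x `^ P)%:E)%E.
    by apply: integral_ge0 => x _; rewrite lee_fin powR_ge0.
  have k1 : 0 <= 1 - P^-1 by rewrite PV1 divr_ge0// mulr_ge0// ltW.
  have k2 : 0 <= P^-1 by rewrite invr_ge0 ltW.
  have h := @hoelder_set R n setT F G P measurableT Pgt1 mF mG (fun x => powR_ge0 _ _) (fun x => powR_ge0 _ _).
  apply: (le_trans h).
  apply: (le_trans (lee_pmul (poweR_ge0 _ _) (poweR_ge0 _ _)
    (poweR_le_bound (ltW c10) i0 k1 X1 b1) (poweR_le_bound (ltW c20) i0 k2 X2 b2))).
  rewrite -EFinM lee_fin mulrACA -/D.
  have E1 : r1 / p * (1 - P^-1) = r / p / 2 by rewrite PV1; field; rewrite r1N pN.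
  have E2 : r2 / p * P^-1 = r / p / 2 by rewrite PV; field; rewrite r2N pN.
  have E3 : r / p / 2 + r / p / 2 = r / p by field.
  rewrite E1 E2 -powRD E3//.
  by rewrite mulf_eq0 invr_eq0 (negbTE rN) (negbTE pN).
pose c := L * C1; have c0 : 0 < c by rewrite mulr_gt0.
have bound : (\int[mu]_x `|(enorm x `^ gam)%:E * g x| `^ r <= (c `^ r * (D * i `^ (r / p)))%:E)%E.
  apply: (@le_trans _ _ (\int[mu]_x ((c `^ r)%:E * (F x * G x)%:E))%E); last first.
    rewrite integral_scale ?powR_ge0//; last 2 first.
    - by apply/measurable_EFinP; exact: measurable_funM.
    - by move=> x; rewrite lee_fin mulr_ge0 ?powR_ge0.
    by rewrite EFinM lee_wpmul2l ?lee_fin ?powR_ge0.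
  apply: ge0_ae_le_integral_nm.
  - by move=> x; exact: poweR_ge0.
  - by move=> x; rewrite mule_ge0// lee_fin ?powR_ge0// mulr_ge0 ?powR_ge0.
  - by apply: measurable_funeM; apply/measurable_EFinP; exact: measurable_funM.
  have aeg : {ae mu, forall x, (`|g x| <= (C1 * (N1 x `^ 2^-1 * N2 x `^ 2^-1))%:E)%E}.
    by move: hg hN1 hN2; apply: filterS3 => x h; exact: h.
  have := @ae_rV_neq0 R n n0; move: aeg; apply: filterS2 => x hgx xN.
  have [_ hw] := enorm_powR_le n0 gam xN.
  have x0 : 0 < `|x| by rewrite normr_gt0.
  have hE : (`|(enorm x `^ gam)%:E * g x| <= (c * (A1 x `^ 2^-1 * A2 x `^ 2^-1))%:E)%E.
    rewrite abseM abse_EFin (ger0_norm (powR_ge0 _ _)).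
    apply: (le_trans (lee_wpmul2l _ hgx)); first by rewrite lee_fin powR_ge0.
    rewrite -EFinM lee_fin /A1 /A2 !powRM ?powR_ge0// -!powRrM.
    have gE : `|x| `^ gam = `|x| `^ (gam1 * 2^-1) * `|x| `^ (gam2 * 2^-1).
      by rewrite -powRD ?(gt_eqF x0) ?implybT// -mulrDl.
    rewrite gE in hw; apply: (le_trans (ler_wpM2r _ hw)).
      by rewrite mulr_ge0 ?(ltW C10)// mulr_ge0 ?powR_ge0.
    by rewrite /c -/L le_eqVlt; apply/orP; left; apply/eqP; ring.
  apply: (le_trans (le_poweR r0' (abse_ge0 _) hE)).
  rewrite poweR_EFin -EFinM lee_fin powRM ?(ltW c0) ?mulr_ge0 ?powR_ge0//.
  by rewrite ler_wpM2l ?powR_ge0// powRM ?powR_ge0// -!powRrM /F /G ![2^-1 * r]mulrC.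
apply: (le_trans (weighted_norm_le r0 bound)).
rewrite hi -EFinM lee_fin powRM ?powR_ge0//; last by rewrite mulr_ge0 ?(ltW D0) ?powR_ge0.
rewrite powRM ?powR_ge0 ?(ltW D0)// -!powRrM mulfV// powRr1 ?(ltW c0)//.
have -> : r / p / r = p^-1 by field; rewrite pN rN.
by rewrite mulrA.
Qed.

End endpoint.

Section interpolation.
Context {R : realType} {n : nat}.
Hypothesis n0 : (0 < n)%N.
Implicit Types (f : 'rV[R]_n -> R) (g : 'rV[R]_n -> \bar R).
Local Notation mu := (@lebesgue_rV R n).

(* The estimates at the regularities s - ep and s + ep are multiplied; ep is
   absorbed by the exponent r when p < r, and by the weight when p = r. *)
Lemma stein_weiss (s p r alpha gam : R) : 0 < s -> s < n%:R -> 1 < p -> p <= r ->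
  alpha < n%:R - n%:R / p -> 0 < gam + n%:R / r -> gam <= alpha ->
  gam + n%:R / r = alpha + n%:R / p - s ->
  exists2 C : R, 0 < C & forall f g, weighted_Lp alpha p f ->
  {ae mu, forall x, g x = neg_laplacian_pow s f x} ->
  (weighted_norm gam r g <= C%:E * weighted_norm alpha p (EFin \o f))%E.
Proof.
move=> s0 sn p1 pr ap gr ga e; have p0 := lt_trans ltr01 p1; have r0 := lt_le_trans p0 pr.
have N0 : 0 < n%:R :> R by rewrite ltr0n.
have NN := lt0r_neq0 N0; have rN := lt0r_neq0 r0; have pN := lt0r_neq0 p0.
have main ep r1 r2 gam1 gam2 : 0 < ep -> s + ep < n%:R -> p <= r1 -> p <= r2 ->
    r1^-1 + r2^-1 = 2 * r^-1 -> gam1 <= alpha -> gam2 <= alpha ->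
    0 < gam1 + n%:R / r1 -> 0 < gam2 + n%:R / r2 ->
    gam1 + n%:R / r1 = alpha + n%:R / p - (s - ep) ->
    gam2 + n%:R / r2 = alpha + n%:R / p - (s + ep) ->
    (gam1 + gam2) / 2 = gam ->
    exists2 C : R, 0 < C & forall f g, weighted_Lp alpha p f ->
  {ae mu, forall x, g x = neg_laplacian_pow s f x} ->
  (weighted_norm gam r g <= C%:E * weighted_norm alpha p (EFin \o f))%E.
  move=> ep0 sen pr1 pr2 er ga1 ga2 gp1 gp2 e1 e2 <-.
  have [C1 C10 H] := neg_laplacian_two_le n0 s0 sn ep0 sen.
  have [C C0 H'] := weighted_norm_hoelder n0 p1 pr1 pr2 r0 er ga1 ga2 ap gp1 gp2 e1 e2 C10.
  exists C => // f g hf hg; apply: H' => //; apply: filterS hg => x -> K1 K2 K10 K20 h1 h2.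
  exact: H hf.1 K10 K20 h1 h2.
have gs : 0 < n%:R - s by rewrite subr_gt0.
move: pr; rewrite le_eqVlt => /orP[/eqP pr|pr].
(* When p = r one has gam = alpha - s. So ep < s keeps gam + ep below alpha, ep < n - s keeps s + ep
   below n, and the last bound keeps gam - ep + n/p positive. *)
- pose ep := Num.min s (Num.min (n%:R - s) (gam + n%:R / r)) / 2.
  have m0 : 0 < Num.min s (Num.min (n%:R - s) (gam + n%:R / r)) by rewrite !lt_min s0 gs gr.
  have ep0 : 0 < ep by rewrite divr_gt0.
  have epm : ep < Num.min s (Num.min (n%:R - s) (gam + n%:R / r)) by rewrite /ep; lra.
  move: epm; rewrite !lt_min => /and3P[h1 h2 h3].
  rewrite -pr in e gr h3 *; rewrite -pr in main.
  apply: (main ep p p (gam + ep) (gam - ep)) => //; lra.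
- have rp : 0 < n%:R / p - n%:R / r.
    by rewrite -mulrBr mulr_gt0// subr_gt0 ltf_pV2.
  have nr : 0 < n%:R / r by rewrite divr_gt0.
  (* The weight stays gam, and n/r1 = n/r + ep, n/r2 = n/r - ep. The four bounds give in turn s + ep
     < n, a positive scaling exponent for r2, r1 >= p, and r2 > 0. *)
  pose m := Num.min (n%:R - s) (Num.min (gam + n%:R / r) (Num.min (n%:R / p - n%:R / r) (n%:R / r))).
  pose ep := m / 2.
  have m0 : 0 < m by rewrite !lt_min gs gr rp nr.
  have ep0 : 0 < ep by rewrite divr_gt0.
  have epm : ep < m by rewrite /ep; lra.
  move: epm; rewrite !lt_min => /and4P[h2 h3 h4 h5].
  pose t1 := (n%:R / r + ep) / n%:R; pose t2 := (n%:R / r - ep) / n%:R.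
  have t10 : 0 < t1 by rewrite divr_gt0// addr_gt0.
  have t20 : 0 < t2 by rewrite divr_gt0// subr_gt0.
  have T1 : n%:R / t1^-1 = n%:R / r + ep by rewrite invrK /t1 mulrC divfK.
  have T2 : n%:R / t2^-1 = n%:R / r - ep by rewrite invrK /t2 mulrC divfK.
  have pt (t : R) : 0 < t -> n%:R * t <= n%:R / p -> p <= t^-1.
    by move=> t0; rewrite ler_pM2l// => h; rewrite -[p]invrK lef_pV2 ?posrE ?invr_gt0.
  rewrite invrK in T1; rewrite invrK in T2.
  apply: (main ep t1^-1 t2^-1 gam gam); rewrite ?invrK ?T1 ?T2//; try lra.
  + by apply: pt => //; rewrite T1; lra.
  + by apply: pt => //; rewrite T2; lra.
  + by rewrite /t1 /t2; field; rewrite NN rN.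
Qed.

End interpolation.

Theorem theorem3p1 (R : realType) (n : nat)
    (s p p' r alpha gamma mu theta : R) :
  (2 <= n)%N ->
  0 < s -> s < n%:R ->
  1 < p -> p <= r ->
  p^-1 + p'^-1 = 1 ->
  alpha < n%:R / p' ->
  - gamma < n%:R / r ->
  0 <= alpha - gamma / theta ->
  0 < mu ->
  Num.max (p / r) (mu / (mu + s)) <= theta -> theta <= 1 ->
  gamma + n%:R / r = theta * (alpha + n%:R / p - s) + (1 - theta) * mu ->
  exists C : R, 0 < C /\
    (forall f : 'rV[R]_n -> R,
       weighted_Lp alpha p f -> in_besov (mu + s) f ->
       (weighted_norm gamma r (neg_laplacian_pow s f) <=
        C%:E * weighted_norm alpha p (EFin \o f) `^ theta *
        besov_norm (mu + s) (distribution_of f) `^ (1 - theta))%E) /\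
    (forall u f : 'rV[R]_n -> R,
       potential_of s p alpha u f -> in_besov mu u ->
       (weighted_norm gamma r (EFin \o u) <=
        C%:E * weighted_norm alpha p (EFin \o f) `^ theta *
        besov_norm mu (distribution_of u) `^ (1 - theta))%E).
Proof.
move=> n2 s0 sn p1 pr pp' ap' gr' ga' mu0 th1 th_le1 e.
have n0 : (0 < n)%N by exact: ltn_trans n2.
have p0 := lt_trans ltr01 p1; have r0 := lt_le_trans p0 pr.
have pN := lt0r_neq0 p0; have rN := lt0r_neq0 r0.
have ap : alpha < n%:R - n%:R / p.
  by have := ap'; rewrite (_ : p'^-1 = 1 - p^-1) ?mulrBr ?mulr1// -pp' addrAC subrr add0r.
have gr : 0 < gamma + n%:R / r by rewrite -ltrBlDl sub0r.
move: th1; rewrite ge_max => /andP[th1 th2].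
have th0 : 0 < theta by apply: lt_le_trans th1; rewrite divr_gt0.
have thN := lt0r_neq0 th0.
have ga : gamma / theta <= alpha by rewrite -subr_ge0.
have ptr : p <= theta * r by rewrite -ler_pdivrMr.
have ms0 : 0 < mu + s by rewrite addr_gt0.
have tms : mu <= theta * (mu + s) by rewrite -ler_pdivrMr.
have mE : mu / theta * theta = mu by rewrite divfK.
have [th_lt1|th_ge1] := ltP theta 1.
(* With this choice mu + s - sigma = mu / theta, so the exponent mu / (mu + s - sigma) of the
   optimisation is theta. *)
- pose sigma := s + mu - mu / theta.
  have mt : mu < mu / theta by rewrite ltr_pdivlMr// gtr_pMr.
  have ss : sigma < s by rewrite /sigma -addrA gtrDl subr_lt0.
  (* This is the hypothesis theta >= mu / (mu + s). *)
  have sg0 : 0 <= sigma.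
    by rewrite subr_ge0 ler_pdivrMr// addrC mulrC.
  have ee : (gamma + n%:R / r) / theta = alpha + n%:R / p - sigma.
    by rewrite e /sigma; field; rewrite pN thN.
  have E1 : (mu + s - s) / (mu + s - sigma) = theta.
    rewrite addrK /sigma opprB addrCA [X in _ / X](_ : _ = mu / theta); last by ring.
    by rewrite invf_div mulrCA divff ?mulr1// gt_eqF.
  have E2 : (s - sigma) / (mu + s - sigma) = 1 - theta.
    by rewrite -E1 addrK; field; rewrite gt_eqF// subr_gt0 (lt_trans ss)// ltrDr.
  have E3 : s - sigma + mu = mu + s - sigma by rewrite addrC addrA.
  have E4 : mu / (mu + s - sigma) = theta by move: E1; rewrite addrK.
  have smu : s < mu + s by rewrite ltrDr.
  have [C1 C10 H1] := neg_laplacian_besov_le n0 s0 sn ss smu.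
  have [C2 C20 H2] := potential_besov_le n0 s0 sn sg0 ss mu0.
  have [D1 D10 K1] := weighted_norm_interpolation n0 p1 th0 ptr ga ap gr ee C10.
  have [D2 D20 K2] := weighted_norm_interpolation n0 p1 th0 ptr ga ap gr ee C20.
  have D0 : 0 < Num.max D1 D2 by rewrite lt_max D10.
  exists (Num.max D1 D2); split => //; split => [f hf [_ [_ hb]]|u f [hf mu_ hu] [hi [_ hb]]].
  + have [B B0 BE] := besov_norm_finite hb.
    rewrite BE; apply: (@le_trans _ _ (D1%:E * weighted_norm alpha p (EFin \o f) `^ theta * B%:E `^ (1 - theta))%E).
      apply: K1 => //; have := H1 f B hf.1; rewrite BE lexx => /(_ isT).
      by rewrite E1 E2.
    apply: lee_wpmul2r; first exact: poweR_ge0.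
    by apply: lee_wpmul2r; [exact: poweR_ge0|rewrite lee_fin le_max lexx].
  + have [B B0 BE] := besov_norm_finite hb.
    rewrite BE; apply: (@le_trans _ _ (D2%:E * weighted_norm alpha p (EFin \o f) `^ theta * B%:E `^ (1 - theta))%E).
      apply: K2 => //; have := H2 u f B hf.1 mu_ hi; rewrite BE lexx => /(_ isT hu).
      by rewrite E3 E4 E2.
    apply: lee_wpmul2r; first exact: poweR_ge0.
    by apply: lee_wpmul2r; [exact: poweR_ge0|rewrite lee_fin le_max lexx orbT].
(* The Besov factor has exponent 0 and so equals 1 for every value of the norm; what remains has the
   scaling of sigma = s. *)
- have th : theta = 1 by apply/eqP; rewrite eq_le th_le1.
  have ga1 : gamma <= alpha by move: ga; rewrite th divr1.
  have e1 : gamma + n%:R / r = alpha + n%:R / p - s by rewrite e th subrr mul0r addr0 mul1r.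
  have [C C0 H] := stein_weiss n0 s0 sn p1 pr ap gr ga1 e1.
  have simp (B W : \bar R) : (0 <= W)%E -> (C%:E * W `^ theta * B `^ (1 - theta) = C%:E * W)%E.
    by move=> W0; rewrite th subrr poweRe0 mule1 poweRe1.
  exists C; split => //; split => [f hf _|u f [hf mu_ hu] _].
    by rewrite simp ?weighted_norm_ge0//; apply: H => //; exact: nearW.
  by rewrite simp ?weighted_norm_ge0//; exact: H.
Qed.
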